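(* Let $P_{X,X',Y'}=P_XP_{X'|X}P_{Y'|X}$, let $\mathcal V>0$ be an integer, fix $\epsilon>0$, and suppose $(P_X,P_{Y'|X},Q_{Y'})$ satisfies the extended bounding condition with constant $\omega\geq 1$, i.e. $\max_{x,y'}P_{Y'|X}(y'|x)/Q_{Y'}(y')\le\omega$. Consider the Wyner–Ziv compression protocol described in the context with batch size $N\ge\max(N_0(\epsilon),\omega)$, where $N_0(\epsilon)$ is defined in the context. Then $$\Pr\big(Y'_{K_A}\ne Y'_{K_B}\big)\le\mathbb{E}_{X,Y',X'}\left[1-\Big(1+\epsilon+(1+\epsilon)\,\mathcal V^{-1}\,2^{\,i_{Y';X}(Y';X)-i_{Y';X'}(Y';X')}\Big)^{-1}\right].$$ Moreover, the coding cost is $\log(\mathcal V)+r$, where $r$ is the coding cost of sending the selected batch index $K_{1,A}$, and $r\le 4$ bits.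
   Context: Logarithms are base 2. Distributions are identified with densities (or mass functions) with respect to common reference measures. $P_{Y'}$ and $P_{Y'|X'}$ are the marginal and conditional distributions under $P_{X,X',Y'}=P_XP_{X'|X}P_{Y'|X}$. Information densities: $i_{Y';X}(y';x)=\log P_{Y'|X}(y'|x)-\log P_{Y'}(y')$ and $i_{Y';X'}(y';x')=\log P_{Y'|X'}(y'|x')-\log P_{Y'}(y')$. Setting: the encoder observes $X=x\sim P_X$; the decoder observes side information $X'\sim P_{X'|X}(\cdot|x)$ not available to the encoder. $(X,X')$ is independent of the shared randomness $W=\{(B_1,U_1),(B_2,U_2),\dots\}$, where $U_i\sim\mathcal U(0,1)$ and batch $B_i$ consists of $(Y_{ij},S_{ij})$, $1\le j\le N$, with $Y_{ij}=(Y'_{ij},V_{ij})$, $Y'_{ij}\sim Q_{Y'}$, $V_{ij}$ uniform on $\{1,\dots,\mathcal V\}$ and $S_{ij}\sim\mathrm{Exp}(1)$, all independent. Encoder: runs Ensemble Rejection Sampling with target $P_{Y'|X}(\cdot|x)$ and proposal $Q_{Y'}$: with $\omega_x=\max_{y'}P_{Y'|X}(y'|x)/Q_{Y'}(y')$, it processes batches $i=1,2,\dots$; in batch $i$ it sets $\lambda_{ik}=P_{Y'|X}(Y'_{ik}|x)/Q_{Y'}(Y'_{ik})$, $K_i^{\mathrm{cand}}=\arg\min_{1\le k\le N}S_{ik}/\lambda_{ik}$, $\hat Z=\sum_{k=1}^N\lambda_{ik}$, $\bar Z=\hat Z+\omega_x-\lambda_{i,K_i^{\mathrm{cand}}}$,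 and accepts if $U_i\le\hat Z/\bar Z$. At the first accepted batch $i$ it sets $K_{1,A}=i$ and $K_{2,A}=K_i^{\mathrm{cand}}$; $K_A$ denotes the resulting position $(K_{1,A},K_{2,A})$ in $W$. It sends the batch index $K_{1,A}$ and the hash $V_{K_A}$ to the decoder. Decoder: in batch $i=K_{1,A}$ it discards all $j$ with $V_{ij}\ne V_{K_A}$ and, given $X'=x'$, selects among the remaining $j$ the minimizer $K_{2,B}$ of $S_{ij}\big/\frac{P_{Y'|X'}(Y'_{ij}|x')}{Q_{Y'}(Y'_{ij})}$; $K_B$ denotes the position $(K_{1,A},K_{2,B})$. The hash costs $\log\mathcal V$ bits. The batch index is sent with a prefix-free code (built from a Zipf distribution) and $r$ is its expected length. Threshold $N_0(\epsilon)$: with $d_2(Q\|P)=\mathbb{E}_{Y\sim Q}[Q(Y)/P(Y)]$ and $\mathbb I_N(\omega,2)=2\cdot\mathbf 1_{N>2}+\omega\cdot\mathbf 1_{N=2}$, $N_0(\epsilon)\ge2$ is an integer such that for all $N\ge N_0(\epsilon)$ and all $x$, $$\frac{3\omega}{N}\le\epsilon\quad\text{and}\quad\frac{\omega}{N}\,\mathbb I_N(\omega,2)\,d_2\big(Q_{Y'}\|P_{Y'|X}(\cdot|x)\big)\le\epsilon$$ (such an integer is assumed to exist). *)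

(* Defs.v *)
From HB Require Import structures.
From mathcomp Require Import all_boot all_order all_algebra.
From mathcomp Require Import all_classical all_reals all_analysis.

Set Implicit Arguments.
Unset Strict Implicit.
Unset Printing Implicit Defensive.

Import Order.TTheory GRing.Theory Num.Theory.
Import numFieldNormedType.Exports.

Local Open Scope classical_set_scope.
Local Open Scope ring_scope.

Definition log2 {R : realType} (x : R) : R := ln x / ln 2.

Definition is_density {R : realType} d (T : measurableType d)
    (mu : {measure set T -> \bar R}) (p : T -> R) : Prop :=
  [/\ measurable_fun setT p, forall t, 0 <= p t
    & (\int[mu]_t (p t)%:E = 1)%E].

Definition is_cond_density {R : realType} d d' (S : measurableType d)
    (T : measurableType d') (mu : {measure set T -> \bar R})
    (p : S -> T -> R) : Prop :=
  measurable_fun setT (fun z : S * T => p z.1 z.2) /\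
  forall s, is_density mu (p s).

(* d_2(q || p).  The quotient is the extended-real one, for which
   a / 0 = +oo when a > 0, and 0 / 0 = 0. *)
Definition d2 {R : realType} d (T : measurableType d)
    (mu : {measure set T -> \bar R}) (q p : T -> R) : \bar R :=
  (\int[mu]_y ((q y)%:E * ((q y)%:E / (p y)%:E)))%E.

(* max_{x, y} p(y|x) / q(y) <= omega, with the same convention on quotients:
   p(y|x) has to vanish wherever q(y) does. *)
Definition extended_bounding {R : realType} (TX TY : Type)
    (pYX : TX -> TY -> R) (q : TY -> R) (omega : R) : Prop :=
  forall x y, ((pYX x y)%:E / (q y)%:E <= omega%:E)%E.

Definition indicator_N {R : realType} (N : nat) (omega : R) : R :=
  2 * (2 < N)%N%:R + omega * (N == 2)%N%:R.

Definition is_threshold {R : realType} (TX : Type) d (TY : measurableType d)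
    (muY : {measure set TY -> \bar R}) (pYX : TX -> TY -> R) (q : TY -> R)
    (omega eps : R) (N0 : nat) : Prop :=
  (2 <= N0)%N /\
  forall N, (N0 <= N)%N -> forall x,
    3 * omega / N%:R <= eps /\
    ((omega / N%:R * indicator_N N omega)%:E * d2 muY q (pYX x) <= eps%:E)%E.

Section Information.
Context {R : realType} {dX dX' dY : measure_display}
  {TX : measurableType dX} {TX' : measurableType dX'} {TY : measurableType dY}.
Variables (muX : {sigma_finite_measure set TX -> \bar R})
  (muX' : {sigma_finite_measure set TX' -> \bar R})
  (muY : {sigma_finite_measure set TY -> \bar R}).
Variables (pX : TX -> R) (pX'X : TX -> TX' -> R) (pYX : TX -> TY -> R).

Definition joint (x : TX) (x' : TX') (y : TY) : R :=
  pX x * pX'X x x' * pYX x y.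

Definition marginal_X' (x' : TX') : R :=
  fine (\int[muX]_x \int[muY]_y (joint x x' y)%:E)%E.

Definition marginal_Y (y : TY) : R :=
  fine (\int[muX]_x \int[muX']_x' (joint x x' y)%:E)%E.

Definition cond_YX' (x' : TX') (y : TY) : R :=
  fine (\int[muX]_x (joint x x' y)%:E)%E / marginal_X' x'.

Definition info_YX (y : TY) (x : TX) : R :=
  log2 (pYX x y) - log2 (marginal_Y y).

Definition info_YX' (y : TY) (x' : TX') : R :=
  log2 (cond_YX' x' y) - log2 (marginal_Y y).

Definition joint_expectation (f : TX -> TX' -> TY -> R) : \bar R :=
  (\int[muX]_x \int[muX']_x' \int[muY]_y (joint x x' y * f x x' y)%:E)%E.

End Information.

(* Batches have n.+1 proposals; batches and positions are numbered from 0. *)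

Record batch (R : realType) (TY : Type) (n : nat) := Batch {
  batch_u : R;
  batch_y : 'I_n.+1 -> TY;
  batch_v : 'I_n.+1 -> nat;
  batch_s : 'I_n.+1 -> R }.

Section Protocol.
Context {R : realType} {TY : Type} {n : nat}.
Implicit Types (p q : TY -> R) (b : batch R TY n) (W : nat -> batch R TY n).

(* The junk value x / 0 = 0 is harmless: the bounding condition forces p y = 0
   wherever q y = 0. *)
Definition weight p q (y : TY) : R := p y / q y.

Definition sup_weight p q : R := sup (range (weight p q)).

(* The quotient is the extended-real one: a proposal of weight 0 gets the
   value +oo, so it is not selected. *)
Definition race p q b (k : 'I_n.+1) : \bar R :=
  ((batch_s b k)%:E / (weight p q (batch_y b k))%:E)%E.

Definition candidate p q b : 'I_n.+1 :=
  [arg min_(k < ord0) race p q b k]%O.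

Definition accepts p q b : bool :=
  let Zhat := \sum_(k < n.+1) weight p q (batch_y b k) in
  let Zbar := Zhat + sup_weight p q
              - weight p q (batch_y b (candidate p q b)) in
  batch_u b <= Zhat / Zbar.

(* The default value 0 is only used when no batch at all is accepted. *)
Definition first_accepted p q W : nat :=
  xget 0%N [set i | accepts p q (W i) /\
                    forall j, (j < i)%N -> ~~ accepts p q (W j)].

Definition encoder_select p q W : nat * 'I_n.+1 :=
  let i := first_accepted p q W in (i, candidate p q (W i)).

Definition encoder_message p q W : nat * nat :=
  let K := encoder_select p q W in (K.1, batch_v (W K.1) K.2).

(* ord0 is a dummy: it is only returned when no position carries the hash. *)
Definition decoder_select p' q W (m : nat * nat) : nat * 'I_n.+1 :=
  (m.1, [arg min_(j < ord0 | batch_v (W m.1) j == m.2)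
           race p' q (W m.1) j]%O).

Definition proposal_at W (K : nat * 'I_n.+1) : TY := batch_y (W K.1) K.2.

End Protocol.

Definition prefix_free (c : nat -> seq bool) : Prop :=
  forall k l, k != l -> ~~ prefix (c k) (c l).

(* Zipf distribution with exponent s on {1, 2, ...}; k stands for k + 1. *)
Definition zipf {R : realType} (s : R) (k : nat) : R :=
  k.+1%:R `^ (- s) / limn (series (fun j : nat => j.+1%:R `^ (- s) : R)).

(* Prefix-free code with the Shannon code lengths of a Zipf distribution. *)
Definition zipf_code {R : realType} (s : R) (c : nat -> seq bool) : Prop :=
  [/\ 1 < s, prefix_free c
    & forall k, (size (c k))%:Z = Num.ceil (- log2 (zipf s k))].

Definition mutually_independent {R : realType} d (Omega : measurableType d)
    (P : probability Omega R) (I : Type) (F : I -> set (set Omega)) : Prop :=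
  forall (m : nat) (idx : 'I_m -> I) (A : 'I_m -> set Omega),
    injective idx -> (forall k, F (idx k) (A k)) ->
    fine (P (\bigcap_(k in [set: 'I_m]) A k)) = \prod_(k < m) fine (P (A k)).

Definition sigma_rv d d' (Omega : measurableType d) (T : measurableType d')
    (X : Omega -> T) : set (set Omega) :=
  preimage_set_system setT X measurable.

(* The pair (X, X') is a single component. *)
Inductive component (n : nat) :=
  | Source
  | Uniform of nat
  | Proposal of nat & 'I_n.+1
  | Hash of nat & 'I_n.+1
  | Clock of nat & 'I_n.+1.
Arguments Source {n}.
Arguments Uniform {n}.

Section Model.
Context {R : realType} {d dX dX' dY : measure_display}
  {Omega : measurableType d} {P : probability Omega R}
  {TX : measurableType dX} {TX' : measurableType dX'} {TY : measurableType dY}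
  {n : nat}.
Variables (muX : {sigma_finite_measure set TX -> \bar R})
  (muX' : {sigma_finite_measure set TX' -> \bar R})
  (muY : {sigma_finite_measure set TY -> \bar R}).
Variables (pX : TX -> R) (pX'X : TX -> TX' -> R) (q : TY -> R) (V : nat).
Variables (X : {RV P >-> TX}) (X' : {RV P >-> TX'})
  (U : nat -> {RV P >-> R}) (Y : nat -> 'I_n.+1 -> {RV P >-> TY})
  (H : nat -> 'I_n.+1 -> {RV P >-> nat}) (S : nat -> 'I_n.+1 -> {RV P >-> R}).

Definition source_pair (w : Omega) : TX * TX' := (X w, X' w).

Definition component_sigma (c : component n) : set (set Omega) :=
  match c with
  | Source => sigma_rv source_pair
  | Uniform i => sigma_rv (U i)
  | Proposal i j => sigma_rv (Y i j)
  | Hash i j => sigma_rv (H i j)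
  | Clock i j => sigma_rv (S i j)
  end.

Record wz_model : Prop := WZModel {
  law_source : forall A, measurable A ->
    P (source_pair @^-1` A)
      = (\int[muX \x muX']_(z in A) (pX z.1 * pX'X z.1 z.2)%:E)%E;
  law_uniform : forall i A, measurable A ->
    distribution P (U i) A = uniform_prob (@ltr01 R) A;
  law_proposal : forall i j A, measurable A ->
    distribution P (Y i j) A = (\int[muY]_(y in A) (q y)%:E)%E;
  law_hash : forall i j v, (1 <= v <= V)%N ->
    distribution P (H i j) [set v] = (V%:R^-1)%:E;
  law_clock : forall i j A, measurable A ->
    distribution P (S i j) A = exponential_prob (1 : R) A;
  model_independent : mutually_independent P component_sigma }.

Definition shared (w : Omega) (i : nat) : batch R TY n :=
  Batch (U i w) (fun j => Y i j w) (fun j => H i j w) (fun j => S i j w).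

Variable pYX : TX -> TY -> R.

Definition K_A (w : Omega) : nat * 'I_n.+1 :=
  encoder_select (pYX (X w)) q (shared w).

Definition message (w : Omega) : nat * nat :=
  encoder_message (pYX (X w)) q (shared w).

Definition K_B (w : Omega) : nat * 'I_n.+1 :=
  decoder_select (cond_YX' muX muY pX pX'X pYX (X' w)) q (shared w) (message w).

Definition mismatch : set Omega :=
  [set w | proposal_at (shared w) (K_A w) <> proposal_at (shared w) (K_B w)].

Definition index_cost (c : nat -> seq bool) : \bar R :=
  'E_P[fun w => (size (c (message w).1))%:R : R].

Definition coding_cost (c : nat -> seq bool) : \bar R :=
  'E_P[fun w => log2 V%:R + (size (c (message w).1))%:R : R].

End Model.

(* Main.v *)
(* It suffices to look at the first batch.  Write l_j and m_j for the weights of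
   its proposal j at the encoder and at the decoder.  The encoder accepts k and
   the decoder selects k as soon as U <= Zhat / Zbar and S_k a_j < S_j for all
   j <> k, where a_j = l_j / l_k + [H_j = H_k] m_j / m_k.  Integrating out U and
   the clocks, this event has a probability of the form E[l_k / D].  By Jensen's
   inequality for 1 / D this is at least E[l_k / c], where c dominates the mean
   of D given X, X' and Y_k: E l_j = 1, two hashes agree with probability 1 / V,
   and the mean of m_j (1 + omega / Zhat) is controlled by d_2 and the
   inequality between the arithmetic and the harmonic means.  This gives
   c = N (1 + eps) (1 + V^-1 l_k / m_k), and summing over k gives the bound.
   For the coding cost, a batch is accepted with probability at least 1/2, and
   the Zipf code with exponent 2 spends at most 2 k + 1 bits on the index k. *)

Require Import Defs.
From HB Require Import structures.
From mathcomp Require Import all_boot all_order all_algebra.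
From mathcomp Require Import all_classical all_reals all_analysis.
From mathcomp Require Import measurable_realfun.
From mathcomp Require Import lra ring zify.

Set Implicit Arguments.
Unset Strict Implicit.
Unset Printing Implicit Defensive.

Import Order.TTheory GRing.Theory Num.Theory.
Import numFieldNormedType.Exports.

Local Open Scope classical_set_scope.
Local Open Scope ring_scope.

(** * Densities and independence *)

(** Looking at the first batch alone is affordable because its rejection is cheap: without the
    decoder, the winning probabilities add up to at least N / (N - 1 + omega), and [eps] absorbs
    this loss. The ratio a_j is a sum rather than a maximum so that 1 + sum_j a_j is linear in the
    weights: its encoder part is Zhat / l_k, which cancels the Zhat of the acceptance ratio, and the
    remainder has a tractable mean. The obstacle is that m_j and Zhat involve the same proposal, so
    the mean of m_j / Zhat does not factor. Zhat is therefore bounded below by the weights at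
    positions other than j and k. For N = 2 no such position is left, whence the two cases of the
    threshold. No conditional expectation is ever formed. A component is integrated out against
    weights that are measurable for the sigma-algebra of all the others, and Jensen's inequality is
    used in an integrated form, where c dominates D only on average. *)

Lemma measurable_invr (R : realType) : measurable_fun [set: R] (@GRing.inv R).
Proof.
have -> : [set: R] = [set~ 0] `|` [set 0] by rewrite setUC setUv.
have mC : measurable [set~ (0 : R)] by exact: measurableC.
apply/(measurable_funU _ mC (measurable_set1 0)); split.
  apply: open_continuous_measurable_fun.
    exact/closed_openC/accessible_closed_set1/hausdorff_accessible/Rhausdorff.
  by move=> x; rewrite inE => /= /eqP x0; exact: inv_continuous.
exact: measurable_fun_set1.
Qed.

Lemma measurable_inve (R : realType) : measurable_fun [set: \bar R] (@inve R).
Proof.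
have -> : @inve R = fun x => if x == 0%E then +oo%E else
    if x == +oo%E then 0%E else if x == -oo%E then -oo%E else (fine x)^-1%:E.
  by apply/funext => -[r||] /=; rewrite ?invey ?inveNy// eqe inver.
have m1 (y : \bar R) : measurable_fun [set: \bar R] (fun x => x == y).
  by apply: measurable_fun_eqe => //; exact: measurable_cst.
do 3 (apply: measurable_fun_ifT => //).
apply/measurable_EFinP; apply: measurableT_comp; first exact: measurable_invr.
exact: fine_measurable.
Qed.

Section density.
Context d (T : measurableType d) (R : realType).
Variables (nu mu : {measure set T -> \bar R}) (f : T -> R).
Hypotheses (f0 : forall x, 0 <= f x) (mf : measurable_fun setT f).
Hypothesis nuE : forall A, measurable A -> nu A = (\int[mu]_(x in A) (f x)%:E)%E.
Local Open Scope ereal_scope.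
Import HBNNSimple.

(** Monotone convergence from simple functions: [nu] has to be known on measurable sets only, which
    is how the laws of the model are given, and neither measure has to be finite. *)
Lemma integral_density (g : T -> \bar R) :
  measurable_fun setT g -> (forall x, 0 <= g x) ->
  \int[nu]_x g x = \int[mu]_x ((f x)%:E * g x).
Proof.
move=> mg g0; pose h := nnsfun_approx measurableT mg.
have hg x : (EFin \o h n) x @[n --> \oo] --> g x by exact: cvg_nnsfun_approx.
transitivity (lim (\int[nu]_x ((EFin \o h n) x) @[n --> \oo])).
  rewrite -monotone_convergence//.
  - by apply: eq_integral => x _; apply/esym/cvg_lim.
  - by move=> n; exact/measurable_EFinP.
  - by move=> n x _; rewrite lee_fin.
  - by move=> x _ a b ab; rewrite lee_fin; exact/lefP/nd_nnsfun_approx.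
transitivity (lim (\int[mu]_x ((f x)%:E * (EFin \o h n) x) @[n --> \oo])); last first.
  rewrite -monotone_convergence//.
  - by apply: eq_integral => x _; apply/cvg_lim => //; exact: cvgeZl.
  - move=> n; apply: emeasurable_funM; first exact/measurable_EFinP.
    exact/measurable_EFinP.
  - by move=> n x _; rewrite mule_ge0// lee_fin.
  - move=> x _ a b ab; rewrite lee_wpmul2l ?lee_fin//.
    exact/lefP/nd_nnsfun_approx.
suff E n : \int[nu]_x ((EFin \o h n) x) =
    \int[mu]_x ((f x)%:E * (EFin \o h n) x).
  by under eq_fun do rewrite E.
under eq_integral do rewrite /= fimfunE -fsumEFin//.
transitivity (\int[mu]_x \sum_(y \in range (h n))
    ((f x)%:E * (y * \1_(h n @^-1` [set y]) x)%:E)); last first.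
  apply: eq_integral => x _; rewrite /= (fimfunE (h n)) -fsumEFin//.
  by rewrite ge0_mule_fsumr// => y; exact: nnfun_muleindic_ge0.
have mind (y : R) : measurable_fun setT (fun x => (y * \1_(h n @^-1` [set y]) x)%:E).
  by apply/measurable_EFinP; exact: measurable_funM.
rewrite ge0_integral_fsum//; last first.
  by move=> y x _; exact: nnfun_muleindic_ge0.
rewrite ge0_integral_fsum//; last 2 first.
- move=> y; apply: emeasurable_funM; first exact/measurable_EFinP.
  exact: mind.
- move=> y x _; rewrite mule_ge0 ?lee_fin//; exact: nnfun_muleindic_ge0.
apply: eq_fsbigr => y; rewrite inE => -[t _ <-{y}].
have mA : measurable (h n @^-1` [set h n t]) by [].
under eq_integral do rewrite EFinM.
rewrite ge0_integralZl//; last 2 first.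
- exact/measurable_EFinP.
- by rewrite lee_fin.
under [RHS]eq_integral do rewrite EFinM muleCA.
rewrite ge0_integralZl//; last 3 first.
- apply: emeasurable_funM; exact/measurable_EFinP.
- by move=> x _; rewrite mule_ge0// lee_fin.
- by rewrite lee_fin.
congr (_ * _); rewrite integral_indic// setIT nuE// integral_mkcond.
by apply: eq_integral => x _; rewrite epatch_indic.
Qed.

End density.

Section independence.
Context {R : realType} {d} {Omega : measurableType d} (P : probability Omega R).
Variables (I : choiceType) (F : I -> set (set Omega)).
Hypotheses (Fm : forall i, F i `<=` measurable) (FT : forall i, F i setT)
  (FI : forall i, setI_closed (F i)) (indep : mutually_independent P F).

(** With lists and extended reals in place of injections from ['I_m] and [fine], adding one
    component to a family is a mere [cons]. *)
Lemma independent_bigcap (s : seq I) (B : I -> set Omega) :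
  uniq s -> (forall j, F j (B j)) ->
  P (\bigcap_(j in [set` s]) B j) = (\prod_(j <- s) P (B j))%E.
Proof.
move=> us FB; case: s us => [|x0 s'] us.
  by rewrite bigcap_seq !big_nil probability_setT.
set s := x0 :: s' in us *.
have mB j : measurable (B j) by exact/Fm/FB.
have mcap : measurable (\bigcap_(j in [set` s]) B j).
  by rewrite bigcap_seq; apply: bigsetI_measurable.
have inj : injective (fun k : 'I_(size s) => nth x0 s k).
  by move=> a b /eqP; rewrite nth_uniq// => /eqP/val_inj.
have /= := @indep (size s) (fun k => nth x0 s k) (fun k => B (nth x0 s k)) inj
  (fun k => FB _).
have -> : \bigcap_(k in [set: 'I_(size s)]) B (nth x0 s k) =
    \bigcap_(j in [set` s]) B j.
  apply/seteqP; split => w Bw.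
    move=> j /= js; have js' : (index j s < size s)%N by rewrite index_mem.
    by have := Bw (Ordinal js') Logic.I; rewrite /= nth_index.
  by move=> k _; apply: Bw => /=; exact: mem_nth.
move=> e; rewrite -(fineK (fin_num_measure P _ mcap)) e.
under [RHS]eq_bigr do rewrite -(fineK (fin_num_measure P _ (mB _))).
by rewrite prodEFin; congr (_%:E); rewrite (big_nth x0) big_mkord.
Qed.

(** The same sample space with fewer events. Measurability of [f : sub_sigma D -> T] then expresses
    that [f] depends on the components in [D] only, without naming their joint vector. *)
Definition sub_sigma (D : set I) := g_sigma_algebraType (\bigcup_(i in D) F i).

Lemma sub_sigma_measurable (D : set I) (A : set Omega) :
  measurable (A : set (sub_sigma D)) -> measurable A.
Proof.
move: A; apply: smallest_sub; first exact: sigma_algebra_measurable.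
by move=> A [i _ /Fm].
Qed.

Lemma measurable_sub_sigma (D : set I) (i : I) (A : set Omega) :
  D i -> F i A -> measurable (A : set (sub_sigma D)).
Proof. by move=> Di FA; apply: sub_sigma_algebra; exists i. Qed.

Lemma measurable_fun_sub_sigma (D : set I) d' (T : measurableType d')
  (f : Omega -> T) :
  measurable_fun setT (f : sub_sigma D -> T) -> measurable_fun setT f.
Proof.
by move=> mf _ B mB; apply: (@sub_sigma_measurable D); exact: mf.
Qed.

(** Uniqueness of finite measures. The probability of the intersection with [B] and the product with
    [P B] are two finite measures of [A]; they agree on [Pi], the finite intersections of events of
    components in [D], which is a pi-system generating the sigma-algebra. *)
Lemma independent_sub_sigma (D : set I) (c : I) (A B : set Omega) :
  ~ D c -> measurable (A : set (sub_sigma D)) -> F c B ->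
  P (A `&` B) = (P A * P B)%E.
Proof.
move=> Dc mA FB.
have mB : measurable B := Fm FB.
pose Pi := [set A | exists s E, [/\ uniq s, forall j, j \in s -> D j,
  forall j, F j (E j) & A = \bigcap_(j in [set` s]) E j]].
have PiI : setI_closed Pi.
  move=> _ _ [s1 [E1 [u1 D1 F1 ->]]] [s2 [E2 [u2 D2 F2 ->]]].
  (* An index of one list only is completed by [setT] on the other side; an index of both lists
     calls for [FI]. *)
  exists (undup (s1 ++ s2)), (fun j => (if j \in s1 then E1 j else setT) `&`
    (if j \in s2 then E2 j else setT)); split.
  - exact: undup_uniq.
  - by move=> j; rewrite mem_undup mem_cat => /orP[/D1|/D2].
  - by move=> j; apply: FI; case: ifP.
  - apply/seteqP; split => w.
      move=> [h1 h2] j _; split; case: ifPn => // js; [exact: h1|exact: h2].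
    move=> h; split => j /= js.
      have /h[] : [set` undup (s1 ++ s2)] j by rewrite /= mem_undup mem_cat js.
      by rewrite js.
    have /h[_] : [set` undup (s1 ++ s2)] j by rewrite /= mem_undup mem_cat js orbT.
    by rewrite js.
have PiE : <<s \bigcup_(i in D) F i >> = <<s Pi >>.
  apply/seteqP; split.
    apply: smallest_sub; first exact: smallest_sigma_algebra.
    move=> X [i Di FX]; apply: sub_sigma_algebra.
    exists [:: i], (fun j => if j == i then X else setT); split => //.
    - by move=> j; rewrite inE => /eqP ->.
    - by move=> j; case: eqP => [->|].
    - by rewrite bigcap_seq big_seq1 eqxx.
  apply: smallest_sub; first exact: smallest_sigma_algebra.
  move=> _ [s [E [_ sD FE ->]]].
  rewrite bigcap_seq; rewrite big_seq; apply: (@bigsetI_measurable _ (sub_sigma D)).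
  by move=> j /sD Dj; exact: measurable_sub_sigma (FE j).
have mPi X : <<s Pi >> X -> measurable X.
  by rewrite -PiE; exact: (@sub_sigma_measurable D).
rewrite /measurable/= PiE in mA.
pose k : {nonneg R} := NngNum (fine_ge0 (measure_ge0 P B)).
have kE : k%:num%:E = P B by rewrite /= fineK// fin_num_measure.
have kP X : mscale k P X = (P B * P X)%E by rewrite -kE.
transitivity (mscale k P A); last by rewrite kP muleC.
apply: (@g_sigma_algebra_measure_unique _ R Omega Pi _ (fun=> setT) _ _
  (mrestr P mB) (mscale k P)) => //.
- by move=> X PX; apply: mPi; exact: sub_sigma_algebra.
- move=> n; exists [::], (fun=> setT); split => //.
  by rewrite bigcap_seq big_nil.
- by rewrite bigcup_const.
- move=> _ [s [E [us sD FE ->]]].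
  apply: (etrans _ (esym (kP _))); rewrite /mrestr.
  have cs : c \notin s by apply/negP => /sD.
  have := @independent_bigcap (c :: s) (fun j => if j == c then B else E j).
  move=> /(_ _ _) h.
  transitivity (P (\bigcap_(j in [set` c :: s]) (if j == c then B else E j))).
    congr (P _); rewrite !bigcap_seq big_cons eqxx setIC; congr (_ `&` _).
    rewrite big_seq [RHS]big_seq; apply: eq_bigr => j js.
    by case: eqP => // jc; rewrite -jc js in cs.
  rewrite h//=; last 2 first.
  - by rewrite cs.
  - by move=> j; case: eqP => [->|].
  rewrite big_cons eqxx independent_bigcap//; congr (_ * _)%E.
  rewrite big_seq [RHS]big_seq; apply: eq_bigr => j js.
  by case: eqP => // jc; rewrite -jc js in cs.
- move=> _; apply: (@le_lt_trans _ _ 1%E); last exact: ltry.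
  by apply: (@probability_le1 _ _ _ P (setT `&` B)); exact: measurableI.
Qed.

Section freeze.
Context (D : set I) (c : I) (Dc : ~ D c) {d'} {T : measurableType d'}.
Variable Z : {RV P >-> T}.
Hypothesis FZ : forall B, measurable B -> F c (Z @^-1` B).
Local Open Scope ereal_scope.

Let idm : measurable_fun setT (id : Omega -> sub_sigma D).
Proof. by move=> _ A mA; rewrite setTI; exact: (@sub_sigma_measurable D). Qed.

Let pairm : measurable_fun setT (fun w => (w, Z w) : sub_sigma D * T).
Proof. exact: measurable_fun_pair. Qed.

Let idm_mixin := isMeasurableFun.Build _ _ _ _ _ idm.
Let idm_pack : {mfun Omega >-> sub_sigma D} := HB.pack (id : Omega -> sub_sigma D) idm_mixin.
Let pairm_mixin := isMeasurableFun.Build _ _ _ _ _ pairm.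
Let pairm_pack : {mfun Omega >-> (sub_sigma D * T)%type} :=
  HB.pack (fun w => (w, Z w) : sub_sigma D * T) pairm_mixin.

(** The pair formed by the sample point itself, read in [sub_sigma D], and [Z] has the product of
    its marginals as law, because the rectangles factor by [independent_sub_sigma]. Tonelli's
    theorem concludes. *)
Lemma integral_freeze (f : sub_sigma D * T -> \bar R) :
  measurable_fun setT f -> (forall z, 0 <= f z) ->
  \int[P]_w f (w, Z w) = \int[P]_w \int[distribution P Z]_z f (w, z).
Proof.
move=> mf f0.
pose P1 : probability (sub_sigma D) R := distribution P idm_pack.
pose P2 : probability (sub_sigma D * T)%type R := distribution P pairm_pack.
have E A : measurable A -> (P1 \x distribution P Z) A = P2 A.
  apply: product_measure_unique => A1 A2 mA1 mA2.
  rewrite -[RHS]/(P A1 * P (Z @^-1` A2)) -(independent_sub_sigma Dc)//.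
  exact: FZ.
transitivity (\int[P2]_z f z).
  by rewrite ge0_integral_pushforward.
rewrite (@eq_measure_integral _ _ _ _ (P1 \x distribution P Z)); last first.
  by move=> A mA _; exact/esym/E.
rewrite fubini_tonelli1// ge0_integral_pushforward//.
- by apply: measurable_fun_fubini_tonelli_F.
- by move=> w _; apply: integral_ge0 => z _; exact: f0.
Qed.

End freeze.
End independence.

(** * Exponential races *)

(** [i0] need not satisfy [Q]: the decoder's default [ord0] may carry another hash. Strict
    inequalities make the tie-breaking rule irrelevant. *)
Lemma arg_min_unique {disp} {T : orderType disp} {I : finType} (i0 k : I)
    (Q : pred I) (f : I -> T) :
  Q k -> (forall j, Q j -> j != k -> (f k < f j)%O) ->
  [arg min_(j < i0 | Q j) f j]%O = k.
Proof.
move=> Qk fk; rewrite /Order.arg_min /extremum.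
case: pickP => [j /andP[Qj /forallP/(_ k)]|/(_ k)]/=.
  rewrite Qk /= => fjk; apply/eqP/negPn/negP => jk.
  by have := fk _ Qj jk; rewrite ltNge fjk.
rewrite Qk /= => /negbT/forallPn[j]; rewrite negb_imply -ltNge => /andP[Qj fjk].
have [jk|jk] := eqVneq j k; first by rewrite jk ltxx in fjk.
by have := lt_trans fjk (fk _ Qj jk); rewrite ltxx.
Qed.

Section deterministic.
Context {R : realType} {TY : Type} {n : nat}.
Implicit Types (p q : TY -> R) (b : batch R TY n).

(** An upper bound [a] on the ratio of the weights suffices, so that a single value of [a] can
    decide the encoder's and the decoder's race at once. *)
Lemma race_lt p q b (k j : 'I_n.+1) (a : R) :
  (forall y, 0 <= weight p q y) -> 0 < weight p q (batch_y b k) ->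
  0 <= batch_s b k -> weight p q (batch_y b j) / weight p q (batch_y b k) <= a ->
  batch_s b k * a < batch_s b j -> (race p q b k < race p q b j)%E.
Proof.
move=> w0 wk sk la sa; rewrite /race.
set lk := weight p q (batch_y b k) in wk la *.
set lj := weight p q (batch_y b j) in la *.
have lj0 : 0 <= lj by exact: w0.
(* This positivity is what gives a rival of weight 0 the race value +oo; with a clock equal to 0 the
   value would be 0. *)
have sj : 0 < batch_s b j.
  by apply: le_lt_trans sa; rewrite mulr_ge0// (le_trans _ la)// divr_ge0// ltW.
rewrite !inver (gt_eqF wk) -EFinM; case: eqVneq => [_|lj1].
  by rewrite gt0_muley ?lte_fin// ltry.
have lj2 : 0 < lj by rewrite lt_neqAle eq_sym lj1.
rewrite -EFinM lte_fin ltr_pdivlMr// mulrAC -mulrA.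
by apply: le_lt_trans sa; rewrite ler_wpM2l.
Qed.

Lemma candidate_eq p q b (k : 'I_n.+1) (a : 'I_n.+1 -> R) :
  (forall y, 0 <= weight p q y) -> 0 < weight p q (batch_y b k) ->
  0 <= batch_s b k ->
  (forall j, j != k ->
    weight p q (batch_y b j) / weight p q (batch_y b k) <= a j) ->
  (forall j, j != k -> batch_s b k * a j < batch_s b j) ->
  candidate p q b = k.
Proof.
move=> w0 wk sk la sa; apply: arg_min_unique => // j _ jk.
by apply: (@race_lt _ _ _ _ _ (a j)) => //; [exact: la|exact: sa].
Qed.

End deterministic.

(** * Measurability of races, selections and acceptance *)

Section measurability.
Context {R : realType} {d} {T : measurableType d}.

(** There are finitely many truth tables, so the preimage is a finite union of finite intersections.
    An arg min is measurable because it is a function of the table of pairwise comparisons. *)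
Lemma measurable_finfun_pred (J : finType) (g : J -> T -> bool)
    (A : pred {ffun J -> bool}) :
  (forall j, measurable_fun setT (g j)) ->
  measurable_fun setT (fun t => A [ffun j => g j t]).
Proof.
move=> mg; apply: (measurable_fun_bool true); rewrite setTI.
rewrite (_ : _ @^-1` _ = \bigcup_(f in [set f : {ffun J -> bool} | A f])
    \bigcap_(j in [set: J]) (g j @^-1` [set f j])); last first.
  apply/seteqP; split => t.
    by move=> /= At; exists [ffun j => g j t] => //= j _; rewrite /= ffunE.
  move=> [f Af] gf; rewrite /= (_ : [ffun _ => _] = f)//.
  by apply/ffunP => j; rewrite ffunE gf.
apply: fin_bigcup_measurable; first exact: finite_finset.
move=> f _; apply: fin_bigcap_measurable; first exact: finite_finset.
by move=> j _; rewrite -[X in measurable X]setTI; exact: mg.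
Qed.

End measurability.

Section measurability_rules.
Context {R : realType} {d} {T : measurableType d}.
Implicit Types f g : T -> R.

Lemma measurable_funV f : measurable_fun setT f ->
  measurable_fun setT (fun t => (f t)^-1).
Proof. by move=> mf; apply: measurableT_comp mf; exact: measurable_invr. Qed.

Lemma measurable_fun_expR f : measurable_fun setT f ->
  measurable_fun setT (fun t => expR (f t)).
Proof. by move=> mf; apply: measurableT_comp mf. Qed.

Lemma measurable_fun_natr_bool (b : T -> bool) : measurable_fun setT b ->
  measurable_fun setT (fun t => (b t)%:R : R).
Proof.
move=> mb; apply: (eq_measurable_fun (fun t => if b t then 1 else 0 : R)).
  by move=> t _; case: (b t).
exact: measurable_fun_ifT.
Qed.

Lemma measurable_fun_sumr (J : Type) (s : seq J) (Q : pred J) (h : J -> T -> R) :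
  (forall j, Q j -> measurable_fun setT (h j)) ->
  measurable_fun setT (fun t => \sum_(j <- s | Q j) h j t).
Proof.
move=> mh; elim: s => [|j s IH].
  by under eq_fun do rewrite big_nil; exact: measurable_cst.
under eq_fun do rewrite big_cons; have [Qj|//] := boolP (Q j).
by apply: measurable_funD => //; exact: mh.
Qed.

Lemma measurable_fun_sume (J : Type) (s : seq J) (Q : pred J) (h : J -> T -> \bar R) :
  (forall j, Q j -> measurable_fun setT (h j)) ->
  measurable_fun setT (fun t => \sum_(j <- s | Q j) h j t)%E.
Proof.
move=> mh; elim: s => [|j s IH].
  by under eq_fun do rewrite big_nil; exact: measurable_cst.
under eq_fun do rewrite big_cons; have [Qj|//] := boolP (Q j).
by apply: emeasurable_funD => //; exact: mh.
Qed.

Lemma measurable_fun_prodr (J : Type) (s : seq J) (Q : pred J) (h : J -> T -> R) :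
  (forall j, Q j -> measurable_fun setT (h j)) ->
  measurable_fun setT (fun t => \prod_(j <- s | Q j) h j t).
Proof.
move=> mh; elim: s => [|j s IH].
  by under eq_fun do rewrite big_nil; exact: measurable_cst.
under eq_fun do rewrite big_cons; have [Qj|//] := boolP (Q j).
by apply: measurable_funM => //; exact: mh.
Qed.

Lemma measurable_fun_eq_nat (f g : T -> nat) : measurable_fun setT f ->
  measurable_fun setT g -> measurable_fun setT (fun t => f t == g t).
Proof. exact: measurable_fun_eqn. Qed.

Lemma measurable_EFin f : measurable_fun setT f ->
  measurable_fun setT (fun t => (f t)%:E).
Proof. by move=> /measurable_EFinP. Qed.

End measurability_rules.

(* The rules are selected on the syntax of the goal: unification alone would
   unfold [weight], [race], etc. *)
Ltac mfun_step := first
  [ lazymatch goal with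
    | |- measurable_fun _ (fun x => (@?f x)%:E) => apply: measurable_EFin
    | |- measurable_fun _ (fun x => (@?f x + @?g x)%R) => apply: measurable_funD
    | |- measurable_fun _ (fun x => (@?f x * @?g x)%R) => apply: measurable_funM
    | |- measurable_fun _ (fun x => (- @?g x)%R) => apply: measurable_funN
    | |- measurable_fun _ (fun x => ((@?f x)^-1)%R) => apply: measurable_funV
    | |- measurable_fun _ (fun x => (@?f x ^+ _)%R) => apply: measurable_funX
    end
  | assumption
  | match goal with H : forall _, measurable_fun _ _ |- _ => exact: H end
  | match goal with H : forall _ _, measurable_fun _ _ |- _ => exact: H end
  | exact: measurable_cst
  | lazymatch goal with
    | |- measurable_fun _ (fun x => x) => exact: measurable_id
    | |- measurable_fun _ (fun x => x.1) => exact: measurable_fst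
    | |- measurable_fun _ (fun x => x.2) => exact: measurable_snd
    | |- measurable_fun _ (fun x => (nat_of_bool (@?f x))%:R) =>
        apply: measurable_fun_natr_bool
    | |- measurable_fun _ (fun x => \sum_(j <- _ | _) _) =>
        first [apply: measurable_fun_sumr => ? ? | apply: measurable_fun_sume => ? ?]
    | |- measurable_fun _ (fun x => \prod_(j <- _ | _) _) =>
        apply: measurable_fun_prodr => ? ?
    | |- measurable_fun _ (fun x => (@?f x < @?g x)%R) => apply: measurable_fun_ltr
    | |- measurable_fun _ (fun x => (@?f x <= @?g x)%R) => apply: measurable_fun_ler
    | |- measurable_fun _ (@fst _ _) => exact: measurable_fst
    | |- measurable_fun _ (@snd _ _) => exact: measurable_snd
    | |- measurable_fun _ (fun x => expR (@?f x)) => apply: measurable_fun_expR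
    | |- measurable_fun _ (Order.lt _) => apply: measurable_fun_ltr
    | |- measurable_fun _ (Order.le _) => apply: measurable_fun_ler
    | |- measurable_fun _ (fun x => @?f x == @?g x) =>
        apply: measurable_fun_eq_nat
    | |- measurable_fun _ (fun x => @?f x && @?g x) => apply: measurable_and
    | |- measurable_fun _ (fun x => ~~ @?f x) => apply: measurable_neg
    | |- measurable_fun _ (fun x => (@?f x * @?g x)%E) => apply: emeasurable_funM
    | |- measurable_fun _ (fun x => (@?f x + @?g x)%E) => apply: emeasurable_funD
    end ].
Ltac mfun := repeat mfun_step.

Section protocol_measurability.
Context {R : realType} {d dX dY} {T : measurableType d} {TX : measurableType dX}
  {TY : measurableType dY} {n : nat}.
Variables (p : TX -> TY -> R) (q : TY -> R).
Hypotheses (mp : measurable_fun setT (fun z : TX * TY => p z.1 z.2))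
  (mq : measurable_fun setT q).

Lemma measurable_weight (x : T -> TX) (y : T -> TY) :
  measurable_fun setT x -> measurable_fun setT y ->
  measurable_fun setT (fun t => weight (p (x t)) q (y t)).
Proof.
move=> mx my; rewrite /weight; apply: measurable_funM.
  by apply: (measurableT_comp mp (measurable_fun_pair mx my)).
by apply: measurable_funV; exact: measurableT_comp mq my.
Qed.

Variables (x : T -> TX) (bat : T -> batch R TY n).
Hypotheses (mx : measurable_fun setT x)
  (mu : measurable_fun setT (fun t => batch_u (bat t)))
  (my : forall k, measurable_fun setT (fun t => batch_y (bat t) k))
  (mv : forall k, measurable_fun setT (fun t => batch_v (bat t) k))
  (ms : forall k, measurable_fun setT (fun t => batch_s (bat t) k)).

Lemma measurable_race k : measurable_fun setT (fun t => race (p (x t)) q (bat t) k).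
Proof.
rewrite /race; apply: emeasurable_funM; first exact: measurable_EFin.
apply: measurableT_comp; first exact: measurable_inve.
by apply: measurable_EFin; exact: measurable_weight.
Qed.

Let leb (t : T) (ij : 'I_n.+1 * 'I_n.+1) :=
  (race (p (x t)) q (bat t) ij.1 <= race (p (x t)) q (bat t) ij.2)%E.

Let measurable_leb ij : measurable_fun setT (leb ^~ ij).
Proof. by apply: measurable_fun_lee; exact: measurable_race. Qed.

Lemma measurable_candidate k :
  measurable_fun setT (fun t => candidate (p (x t)) q (bat t) == k).
Proof.
pose A (f : {ffun 'I_n.+1 * 'I_n.+1 -> bool}) :=
  odflt ord0 [pick k | true && [forall j, true ==> f (k, j)]] == k.
rewrite (_ : (fun _ => _) = (fun t => A [ffun ij => leb t ij])).
  exact: measurable_finfun_pred.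
apply/funext => t; rewrite /candidate /Order.arg_min /extremum /A.
congr (odflt _ _ == _); apply: eq_pick => i /=.
by apply: eq_forallb => j; rewrite ffunE.
Qed.

Lemma measurable_decoder k k' : measurable_fun setT (fun t =>
  ([arg min_(j < ord0 | batch_v (bat t) j == batch_v (bat t) k)
      race (p (x t)) q (bat t) j]%O : 'I_n.+1) == k').
Proof.
(* The table also records which positions carry the hash of [k], as the arg min ranges over these
   only. *)
pose A (f : {ffun ('I_n.+1 * 'I_n.+1 + 'I_n.+1) -> bool}) :=
  odflt ord0 [pick i | f (inr i) && [forall j, f (inr j) ==> f (inl (i, j))]] == k'.
pose g t (c : 'I_n.+1 * 'I_n.+1 + 'I_n.+1) := match c with
  | inl ij => leb t ij | inr j => batch_v (bat t) j == batch_v (bat t) k end.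
rewrite (_ : (fun _ => _) = (fun t => A [ffun c => g t c])).
  apply: (measurable_finfun_pred (g := fun c t => g t c)).
  move=> [ij|j]; first exact: measurable_leb.
  exact: measurable_fun_eq_nat.
apply/funext => t; rewrite /Order.arg_min /extremum /A.
congr (odflt _ _ == _); apply: eq_pick => i /=; rewrite !ffunE/=.
by congr andb; apply: eq_forallb => j; rewrite !ffunE.
Qed.

Lemma measurable_accepts :
  measurable_fun setT (fun t => sup_weight (p (x t)) q) ->
  measurable_fun setT (fun t => accepts (p (x t)) q (bat t)).
Proof.
move=> mo; rewrite /accepts.
have mw k : measurable_fun setT (fun t => weight (p (x t)) q (batch_y (bat t) k)).
  exact: measurable_weight.
(* The weight at the random position [candidate] is expanded over all positions, each with the
   indicator of being the candidate. *)
rewrite (_ : (fun _ => _) = (fun t => batch_u (bat t) <=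
    (\sum_(k < n.+1) weight (p (x t)) q (batch_y (bat t) k)) /
    (\sum_(k < n.+1) weight (p (x t)) q (batch_y (bat t) k) +
      sup_weight (p (x t)) q -
      \sum_(k < n.+1) (candidate (p (x t)) q (bat t) == k)%:R *
        weight (p (x t)) q (batch_y (bat t) k)))); last first.
  apply/funext => t /=; congr (_ <= _ / (_ - _)).
  rewrite (bigD1 (candidate (p (x t)) q (bat t)))//= eqxx mul1r big1 ?addr0//.
  by move=> k; rewrite eq_sym => /negbTE ->; rewrite mul0r.
have mc := measurable_candidate.
by mfun.
Qed.

End protocol_measurability.

(** * A prefix-free code for the Zipf distribution *)

(** The most significant digit comes first, so that taking a prefix amounts to dividing by a power
    of 2. *)
Fixpoint bits (m a : nat) : seq bool :=
  if m is m'.+1 then rcons (bits m' a./2) (odd a) else [::].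

Lemma size_bits m a : size (bits m a) = m.
Proof. by elim: m a => //= m IH a; rewrite size_rcons IH. Qed.

Lemma take_bits m e a : take m (bits (m + e) a) = bits m (a %/ 2 ^ e).
Proof.
elim: e a => [|e IH] a.
  by rewrite addn0 expn0 divn1 take_oversize// size_bits.
rewrite addnS /= -cats1 takel_cat ?size_bits ?leq_addr// IH.
by rewrite -divn2 -divnMA expnS.
Qed.

Lemma bits_inj m a b : (a < 2 ^ m)%N -> (b < 2 ^ m)%N ->
  bits m a = bits m b -> a = b.
Proof.
elim: m a b => [|m IH] a b /=; first by rewrite expn0; lia.
rewrite expnS => am bm /rcons_inj[/IH h o].
have {}h : a./2 = b./2 by apply: h; lia.
by rewrite -(odd_double_half a) -(odd_double_half b) h o.
Qed.

Section kraft.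
Variables (l : nat -> nat).
Hypotheses (l_nd : forall k, (l k <= l k.+1)%N)
  (kraft : forall k, (\sum_(j < k.+1) 2 ^ (l k - l j) <= 2 ^ l k)%N).

Let l_homo k j : (k <= j)%N -> (l k <= l j)%N.
Proof. by move=> kj; exact: (homo_leq leqnn leq_trans l_nd). Qed.

(* [kraft_num k / 2 ^ l k] is the partial sum of the [2 ^ - l j] for [j < k]. *)
Fixpoint kraft_num (k : nat) : nat :=
  if k is k'.+1 then ((kraft_num k').+1 * 2 ^ (l k - l k'))%N else 0%N.

(** Shannon's construction: the codeword consists of the first [l k] binary digits of the cumulative
    Kraft sum. As [l] is nondecreasing, this sum is a multiple of [2 ^ - l k] and nothing is
    truncated. *)
Definition kraft_code k := bits (l k) (kraft_num k).

(** The successor accounts for the term [j = k]. The Kraft inequality at [k] therefore makes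
    [kraft_num k] strictly smaller than [2 ^ l k], and it fits on [l k] digits. *)
Let kraft_numE k : (kraft_num k).+1 = (\sum_(j < k.+1) 2 ^ (l k - l j))%N.
Proof.
elim: k => [|k IH]; first by rewrite big_ord1 subnn.
rewrite big_ord_recr/= subnn expn0 addn1 IH big_distrl/=; congr _.+1.
apply: eq_bigr => j _; rewrite -expnD; congr (_ ^ _)%N.
have := l_nd k; have := @l_homo j k (ltn_ord j); lia.
Qed.

Let kraft_num_lt k : (kraft_num k < 2 ^ l k)%N.
Proof. by rewrite kraft_numE. Qed.

Let kraft_num_ge k j : (k < j)%N ->
  ((kraft_num k).+1 * 2 ^ (l j - l k) <= kraft_num j)%N.
Proof.
elim: j => // j IH; rewrite ltnS leq_eqVlt => /predU1P[->//|kj].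
rewrite [kraft_num j.+1]/=; apply: (@leq_trans (kraft_num j * 2 ^ (l j.+1 - l j))).
  rewrite (_ : l j.+1 - l k = (l j - l k) + (l j.+1 - l j))%N; last first.
    by have := l_nd j; have := l_homo (ltnW kj); lia.
  by rewrite expnD mulnA leq_mul2r IH// orbT.
by rewrite leq_mul2r leqnSn orbT.
Qed.

Lemma size_kraft_code k : size (kraft_code k) = l k.
Proof. exact: size_bits. Qed.

(** A prefix would put the cumulative sum of [j] inside the dyadic interval of length [2 ^ - l k]
    that starts at the sum of [k], whereas [kraft_num_ge] puts it at or beyond the right end. *)
Let not_prefix_lt k j : (k < j)%N -> ~~ prefix (kraft_code k) (kraft_code j).
Proof.
move=> kj; apply/negP; rewrite prefixE size_kraft_code /kraft_code => /eqP.
have -> : l j = (l k + (l j - l k))%N by have := l_homo (ltnW kj); lia.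
rewrite take_bits => /bits_inj e.
have p0 : (0 < 2 ^ (l j - l k))%N by rewrite expn_gt0.
have := kraft_num_ge kj; rewrite -leq_divRL// e ?ltnn//.
rewrite ltn_divLR// -expnD subnKC//; exact: l_homo (ltnW kj).
Qed.

Lemma prefix_free_kraft_code : prefix_free kraft_code.
Proof.
move=> k j; case: (ltngtP k j) => // kj _; first exact: not_prefix_lt.
(* Here [j < k], so the word of [k] is not shorter than that of [j]. Being a prefix of it, it is
   equal to it, and the case already treated gives a contradiction. *)
apply/negP => pr; have := not_prefix_lt kj; move: pr.
rewrite !prefixE !size_kraft_code => /eqP pr.
have lkj : l k = l j.
  have := congr1 size pr; rewrite size_take !size_kraft_code.
  by have := l_homo (ltnW kj); case: ltnP; lia.
rewrite -pr lkj take_oversize ?size_kraft_code// take_oversize ?size_kraft_code ?lkj//.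
by rewrite eqxx.
Qed.

End kraft.

(** * Shannon lengths for the Zipf exponent 2 *)

Section zipf2.
Context {R : realType}.

Let u (j : nat) : R := j.+1%:R `^ (- 2).

Let uE j : u j = (j.+1%:R ^+ 2)^-1.
Proof. by rewrite /u powR_invn. Qed.

Let u_gt0 j : 0 < u j.
Proof. by rewrite /u powR_gt0. Qed.

Let series_u_nd : nondecreasing_seq (series u).
Proof. by apply: nondecreasing_series => j _ _; exact: ltW. Qed.

(** Telescoping, from [(x + 1)^-2 <= x^-1 - (x + 1)^-1] with [x = n + 1]. *)
Let series_u_le n : series u n.+1 <= 2 - n.+1%:R^-1.
Proof.
elim: n => [|n IH].
  by rewrite seriesEnat/= big_nat1 uE expr1n invr1; lra.
rewrite seriesSr; apply: le_trans (lerD IH (lexx _)) _.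
have x0 : 0 < n.+1%:R :> R by [].
rewrite uE -[n.+2%:R]natr1; move: (n.+1%:R : R) x0 => x x0.
rewrite -subr_ge0 (_ : _ - _ = (x * (x + 1) ^+ 2)^-1).
  by rewrite invr_ge0 mulr_ge0 ?exprn_ge0// ?addr_ge0// ltW.
by field; rewrite (gt_eqF x0) gt_eqF// addr_gt0.
Qed.

Let series_u_le2 n : series u n <= 2.
Proof.
case: n => [|n]; first by rewrite seriesEnat/= big_geq.
by apply: le_trans (series_u_le n) _; rewrite gerBl invr_ge0.
Qed.

Let series_u_cvg : cvgn (series u).
Proof. by apply: nondecreasing_is_cvgn => //; exists 2 => _ [n _ <-]. Qed.

Let zeta2 := limn (series u).

Let zeta2_le2 : zeta2 <= 2.
Proof. by apply: limr_le => //; near=> n; exact: series_u_le2. Unshelve. all: by end_near. Qed.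

Let series_le_zeta2 n : series u n <= zeta2.
Proof. exact: nondecreasing_cvgn_le. Qed.

Let zeta2_gt0 : 0 < zeta2.
Proof.
apply: lt_le_trans (series_le_zeta2 1); rewrite seriesEnat/= big_nat1; exact: u_gt0.
Qed.

Let zipf2E k : zipf (2 : R) k = u k / zeta2.
Proof. by []. Qed.

Let zipf2_gt0 k : 0 < zipf (2 : R) k.
Proof. by rewrite zipf2E divr_gt0. Qed.

Let sum_zipf2 k : \sum_(j < k) zipf (2 : R) j <= 1.
Proof.
under eq_bigr do rewrite zipf2E.
rewrite -mulr_suml ler_pdivrMr// mul1r.
by have := series_le_zeta2 k; rewrite seriesEord.
Qed.

Let zipf2_le1 k : zipf (2 : R) k <= 1.
Proof.
have := sum_zipf2 k.+1; rewrite big_ord_recr/=; apply: le_trans.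
by rewrite lerDr sumr_ge0// => j _; exact: ltW.
Qed.

Let ln2_gt0 : 0 < ln (2 : R).
Proof. by rewrite ln_gt0// ltr1n. Qed.

Let zlen (k : nat) : nat := `|Num.ceil (- log2 (zipf (2 : R) k))|%N.

Let log2_zipf2_ge0 k : 0 <= - log2 (zipf (2 : R) k).
Proof. by rewrite oppr_ge0 /log2 pmulr_lle0 ?invr_gt0// ln_le0. Qed.

Let zlenE k : (zlen k)%:Z = Num.ceil (- log2 (zipf (2 : R) k)).
Proof. by rewrite /zlen gez0_abs// ceil_ge0 (lt_le_trans _ (log2_zipf2_ge0 k))// ltrN10. Qed.

Let zlen_ge k : - log2 (zipf (2 : R) k) <= (zlen k)%:R.
Proof. by rewrite -[(zlen k)%:R]/((zlen k)%:Z%:~R) zlenE ceil_ge. Qed.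

Let pow2_zlen k : (2 ^+ zlen k)^-1 <= zipf (2 : R) k.
Proof.
have := zlen_ge k; rewrite /log2 -mulNr ler_pdivrMr// mulr_natl.
rewrite lerNl -lnXn// -lnV ?posrE ?exprn_gt0//.
by rewrite ler_ln ?posrE ?invr_gt0 ?exprn_gt0.
Qed.

Let zlen_nd k : (zlen k <= zlen k.+1)%N.
Proof.
rewrite -lez_nat !zlenE le_ceil// lerN2 /log2 ler_wpM2r ?invr_ge0 ?(ltW ln2_gt0)//.
rewrite ler_ln ?posrE// !zipf2E ler_wpM2r ?invr_ge0 ?(ltW zeta2_gt0)//.
by rewrite !uE lef_pV2 ?posrE ?exprn_gt0// lerXn2r ?nnegrE// ler_nat.
Qed.

Let zlen_kraft k : (\sum_(j < k.+1) 2 ^ (zlen k - zlen j) <= 2 ^ zlen k)%N.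
Proof.
rewrite -(ler_nat R) natrX natr_sum.
rewrite (eq_bigr (fun j : 'I_k.+1 => 2 ^+ zlen k * (2 ^+ zlen j)^-1)); last first.
  move=> j _; rewrite natrX expfB_cond ?pnatr_eq0//.
  have zh := homo_leq leqnn leq_trans zlen_nd.
  by rewrite add0n; exact: (zh j k (ltn_ord j)).
rewrite -mulr_sumr ger_pMr ?exprn_gt0//.
by apply: le_trans (sum_zipf2 k.+1); apply: ler_sum => j _; exact: pow2_zlen.
Qed.

(** The ideal length is log2 (zeta2 (k + 1)^2). The constant [zeta2 <= 2] costs at most one bit and
    [k + 1 <= 2 ^ k] bounds the rest by 2 k. The bound is an integer, so rounding up is free. Being
    linear in [k], it only asks for the mean of the index. *)
Let zlen_le k : (zlen k <= k.*2.+1)%N.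
Proof.
rewrite -lez_nat zlenE ceil_le_int -[_%:~R]/(k.*2.+1%:R).
rewrite /log2 -mulNr ler_pdivrMr// -lnV ?posrE// zipf2E uE invf_div invrK.
apply: (@le_trans _ _ (ln (2 * (2 ^+ k) ^+ 2))).
  rewrite ler_ln ?posrE ?mulr_gt0 ?exprn_gt0// ler_pM ?(ltW zeta2_gt0) ?exprn_ge0//.
  by rewrite lerXn2r ?nnegrE ?exprn_ge0// -natrX ler_nat ltn_expl.
rewrite lnM ?posrE ?exprn_gt0// !lnXn ?exprn_gt0// -mulrnA muln2 mulr_natl.
by rewrite [X in _ <= X]mulrS.
Qed.

Lemma zipf2_code_exists : exists c : nat -> seq bool,
  zipf_code (2 : R) c /\ forall k, (size (c k) <= k.*2.+1)%N.
Proof.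
exists (kraft_code zlen); split; last by move=> k; rewrite size_kraft_code.
split; first by rewrite ltr1n.
- exact: prefix_free_kraft_code.
- by move=> k; rewrite size_kraft_code zlenE.
Qed.

End zipf2.

(** * Integrating out one component *)

Lemma sigma_rv_measurable d d' (Omega : measurableType d) (T : measurableType d')
  (f : Omega -> T) : measurable_fun setT f -> sigma_rv f `<=` measurable.
Proof. by move=> mf A [B mB <-]; exact: mf. Qed.

Lemma sigma_rvT d d' (Omega : measurableType d) (T : measurableType d')
  (f : Omega -> T) : sigma_rv f setT.
Proof. by exists setT => //; rewrite setTI. Qed.

Lemma sigma_rvI d d' (Omega : measurableType d) (T : measurableType d')
  (f : Omega -> T) : setI_closed (sigma_rv f).
Proof.
move=> A A' [B mB <-] [B' mB' <-]; exists (B `&` B'); first exact: measurableI.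
by rewrite !setTI preimage_setI.
Qed.

Section exponential_law.
Context {R : realType}.
Local Open Scope ereal_scope.
Notation mu := (@lebesgue_measure R).

Lemma exponential_prob_gt (t : R) : (0 <= t)%R ->
  exponential_prob (1 : R) `]t, +oo[ = (expR (- t))%:E.
Proof.
move=> t0; have mpdf := measurable_exponential_pdf (1 : R).
have e0 x : 0 <= (exponential_pdf (1 : R) x)%:E.
  by rewrite lee_fin exponential_pdf_ge0.
have e1 : \int[mu]_(x in `]-oo, t]) (exponential_pdf (1 : R) x)%:E
    = (1 - expR (- t))%:E.
  rewrite (_ : `]-oo, t]%classic = `]-oo, (0 : R)%R[%classic `|` `[(0 : R)%R, t]%classic); last first.
    apply/seteqP; split => x /=; rewrite !in_itv/=.
      by move=> xt; case: (ltP x 0%R) => x0; [left|right; rewrite xt].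
    by move=> [x0|/andP[_ ->//]]; rewrite (ltW (lt_le_trans x0 t0)).
  rewrite ge0_integral_setU//=; last 2 first.
  - exact/measurable_funTS/measurable_EFinP.
  - rewrite disj_set2E; apply/eqP/seteqP; split => // x /=; rewrite !in_itv/=.
    by move=> [+ /andP[+ _]]; case: ltP.
  rewrite integral0_eq ?add0e; last first.
    by move=> x /=; rewrite in_itv/= => /lt0_exponential_pdf ->.
  have [->|t1] := eqVneq t 0%R.
    by rewrite set_itv1 integral_set1 oppr0 expR0 subrr.
  have := @exponential_prob_itv0c R 1 t.
  rewrite lt_neqAle eq_sym t1 t0 /exponential_prob => -> //.
  by rewrite mulN1r EFinB.
have := @integral_exponential_pdf R 1 ltr01.
rewrite (_ : setT = `]-oo, t]%classic `|` `]t, +oo[%classic); last first.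
  by apply/seteqP; split => // x _ /=; rewrite !in_itv/=; case: leP; [left|right].
rewrite ge0_integral_setU//=; last 2 first.
- exact/measurable_funTS/measurable_EFinP.
- rewrite disj_set2E; apply/eqP/seteqP; split => // x /=; rewrite !in_itv/=.
  by rewrite andbT => -[]; case: leP.
rewrite e1 /exponential_prob; case: (integral _ _ _) => [b| |]//.
by rewrite -EFinD => -[] b1; congr (_%:E); lra.
Qed.

(** The integrand is [(1 + a)^-1] times the density of the exponential law of rate [1 + a]. *)
Lemma integral_exponential_laplace (a : R) : (0 <= a)%R ->
  \int[mu]_s ((exponential_pdf (1 : R) s)%:E * ((0 <= (s : R))%R%:R * expR (- (s * a)))%:E)
    = (1 + a)^-1%:E.
Proof.
move=> a0; have a1 : (0 < 1 + a)%R by lra.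
transitivity (\int[mu]_s ((1 + a)^-1%:E * (exponential_pdf (1 + a) s)%:E)).
  apply: eq_integral => s _; have [s0|s0] := leP 0%R (s : R).
    rewrite !exponential_pdfE// -!EFinM !mul1r; congr (_%:E).
    rewrite mulrA mulVf ?gt_eqF// mul1r -expRD; congr expR; ring.
  by rewrite !lt0_exponential_pdf// mule0 mul0e.
rewrite ge0_integralZl_EFin//; last 3 first.
- by move=> s _; rewrite lee_fin exponential_pdf_ge0// ltW.
- by apply/measurable_EFinP; exact: measurable_exponential_pdf.
- by rewrite invr_ge0 ltW.
by rewrite integral_exponential_pdf// mule1.
Qed.

End exponential_law.

Section model.
Context {R : realType} {d dX dX' dY : measure_display}
  {Omega : measurableType d} {P : probability Omega R}
  {TX : measurableType dX} {TX' : measurableType dX'} {TY : measurableType dY}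
  {n : nat}.
Variables (muX : {sigma_finite_measure set TX -> \bar R})
  (muX' : {sigma_finite_measure set TX' -> \bar R})
  (muY : {sigma_finite_measure set TY -> \bar R}).
Variables (pX : TX -> R) (pX'X : TX -> TX' -> R) (q : TY -> R) (V : nat).
Variables (X : {RV P >-> TX}) (X' : {RV P >-> TX'})
  (U : nat -> {RV P >-> R}) (Y : nat -> 'I_n.+1 -> {RV P >-> TY})
  (H : nat -> 'I_n.+1 -> {RV P >-> nat}) (S : nat -> 'I_n.+1 -> {RV P >-> R}).
Hypotheses (densX : is_density muX pX) (densX'X : is_cond_density muX' pX'X)
  (densQ : is_density muY q) (V_gt0 : (0 < V)%N)
  (model : wz_model muX muX' muY pX pX'X q V X X' U Y H S).

Notation F := (component_sigma X X' U Y H S : {classic (component n)} -> _).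

Let Fm c : F c `<=` measurable.
Proof.
case: c => [|i|i j|i j|i j]; apply: sigma_rv_measurable => //.
exact: measurable_fun_pair.
Qed.

Let FT c : F c setT.
Proof. by case: c => *; exact: sigma_rvT. Qed.

Let FI c : setI_closed (F c).
Proof. by case: c => *; exact: sigma_rvI. Qed.

(* [Others c] is the sample space with the sigma-algebra generated by all the
   components other than [c]. *)
Definition Others (c : component n) := sub_sigma F [set~ c].

Lemma measurable_Others c d' (T : measurableType d') (f : Omega -> T) :
  measurable_fun setT (f : Others c -> T) -> measurable_fun setT f.
Proof. exact: measurable_fun_sub_sigma. Qed.

Let measurable_Others_rv c c' d' (T : measurableType d') (f : Omega -> T) :
  c' <> c -> sigma_rv f `<=` F c' -> measurable_fun setT (f : Others c -> T).
Proof.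
move=> cc' sf _ B mB; rewrite setTI.
by apply: (@measurable_sub_sigma _ _ _ _ [set~ c] c') => //; apply: sf; exists B => //;
  rewrite setTI.
Qed.

Lemma measurable_Others_X c : Source <> c -> measurable_fun setT (X : Others c -> TX).
Proof.
move=> /measurable_Others_rv; apply => A [B mB <-]; exists (B `*` setT).
  exact: measurableX.
by rewrite !setTI; apply/seteqP; split => w //= [].
Qed.

Lemma measurable_Others_X' c : Source <> c -> measurable_fun setT (X' : Others c -> TX').
Proof.
move=> /measurable_Others_rv; apply => A [B mB <-]; exists (setT `*` B).
  exact: measurableX.
by rewrite !setTI; apply/seteqP; split => w //= [].
Qed.

Lemma measurable_Others_U c i : Defs.Uniform i <> c ->
  measurable_fun setT (U i : Others c -> R).
Proof. by move=> /measurable_Others_rv; apply. Qed.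

Lemma measurable_Others_Y c i j : Proposal i j <> c ->
  measurable_fun setT (Y i j : Others c -> TY).
Proof. by move=> /measurable_Others_rv; apply. Qed.

Lemma measurable_Others_H c i j : Hash i j <> c ->
  measurable_fun setT (H i j : Others c -> nat).
Proof. by move=> /measurable_Others_rv; apply. Qed.

Lemma measurable_Others_S c i j : Clock i j <> c ->
  measurable_fun setT (S i j : Others c -> R).
Proof. by move=> /measurable_Others_rv; apply. Qed.

Local Open Scope ereal_scope.

Let freeze c d' (T : measurableType d') (Z : {RV P >-> T}) (f : Others c * T -> \bar R) :
  (forall B, measurable B -> F c (Z @^-1` B)) ->
  measurable_fun setT f -> (forall z, 0 <= f z) ->
  \int[P]_w f (w, Z w) = \int[P]_w \int[distribution P Z]_z f (w, z).
Proof.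
move=> FZ mf f0.
apply: (@integral_freeze _ _ _ P _ F Fm FT FI (model_independent model) [set~ c] c) => //.
by move=> /(_ erefl).
Qed.

(** Measurability of [g] and [r] with respect to [Others] is the form in which their independence of
    [U i] is assumed. The lemmas on the other components follow the same pattern. *)
Lemma integral_uniform i (g r : Omega -> R) :
  measurable_fun setT (g : Others (Defs.Uniform i) -> R) ->
  measurable_fun setT (r : Others (Defs.Uniform i) -> R) ->
  (forall w, 0 <= g w)%R -> (forall w, 0 <= r w <= 1)%R ->
  \int[P]_w (g w * (U i w <= r w)%R%:R)%:E = \int[P]_w (g w * r w)%:E.
Proof.
move=> mg mr g0 r01.
rewrite (@freeze (Defs.Uniform i) _ _ (U i)
    (fun z => (g z.1 * (z.2 <= r z.1)%R%:R)%:E))//; last 3 first.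
- by move=> B mB; exists B => //; rewrite setTI.
- have mg1 := measurableT_comp mg (@measurable_fst _ _ (Others (Defs.Uniform i)) R).
  have mr1 := measurableT_comp mr (@measurable_fst _ _ (Others (Defs.Uniform i)) R).
  by mfun.
- by move=> z; rewrite lee_fin mulr_ge0.
apply: eq_integral => w _ /=.
under eq_integral do rewrite EFinM.
rewrite ge0_integralZl_EFin//; last first.
  by mfun.
rewrite EFinM; congr (_ * _).
rewrite (eq_integral (EFin \o \1_(`]-oo, r w]))); last first.
  by move=> z _; rewrite /= indicE mem_setE in_itv.
rewrite integral_indic// setIT; apply: (etrans (law_uniform model i _)) => //.
rewrite /uniform_prob integral_uniform_pdf.
rewrite (_ : _ `&` _ = `[0%R, r w]%classic); last first.
  apply/seteqP; split => x /=; rewrite !in_itv/=; first by move=> [-> /andP[-> _]].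
  by move=> /andP[x0 xr]; rewrite xr x0 (le_trans xr)//; case/andP: (r01 w).
rewrite (eq_integral (cst 1)); last first.
  move=> x; rewrite inE/= in_itv/= /uniform_pdf => /andP[x0 xr].
  by rewrite x0 (le_trans xr) ?subr0 ?invr1//; case/andP: (r01 w).
rewrite integral_cst//= mul1e lebesgue_measure_itv/= lte_fin.
case: ltP => [_|r0]; first by rewrite oppr0 adde0.
by congr (_%:E); apply/eqP; rewrite eq_le r0; case/andP: (r01 w) => ->.
Qed.

(** [t] has to be nonnegative only where [g] does not vanish: it will be a multiple of another
    clock, which is nonnegative only almost surely, and [g] will carry the indicator of that
    event. *)
Lemma integral_clock_gt i j (g t : Omega -> R) :
  measurable_fun setT (g : Others (Clock i j) -> R) ->
  measurable_fun setT (t : Others (Clock i j) -> R) ->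
  (forall w, 0 <= g w)%R -> (forall w, g w != 0 -> 0 <= t w)%R ->
  \int[P]_w (g w * (t w < S i j w)%R%:R)%:E = \int[P]_w (g w * expR (- t w))%:E.
Proof.
move=> mg mt g0 t0.
rewrite (@freeze (Clock i j) _ _ (S i j)
    (fun z => (g z.1 * (t z.1 < z.2)%R%:R)%:E))//; last 3 first.
- by move=> B mB; exists B => //; rewrite setTI.
- have mg1 := measurableT_comp mg (@measurable_fst _ _ (Others (Clock i j)) R).
  have mt1 := measurableT_comp mt (@measurable_fst _ _ (Others (Clock i j)) R).
  by mfun.
- by move=> z; rewrite lee_fin mulr_ge0.
apply: eq_integral => w _ /=.
under eq_integral do rewrite EFinM.
rewrite ge0_integralZl_EFin//; last first.
  by mfun.
have [->|gw] := eqVneq (g w) 0%R; first by rewrite mul0e mul0r.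
rewrite EFinM; congr (_ * _).
rewrite (eq_integral (EFin \o \1_(`]t w, +oo[))); last first.
  by move=> z _; rewrite /= indicE mem_setE in_itv/= andbT.
rewrite integral_indic// setIT; apply: (etrans (law_clock model i j _)) => //.
by rewrite exponential_prob_gt// t0.
Qed.

(* The random variables take their values in [R] with its default display,
   while the Lebesgue measure lives on [measurableTypeR R]. *)
Lemma integral_clock_density i j (g : R -> \bar R) :
  measurable_fun setT g -> (forall s, 0 <= g s) ->
  \int[distribution P (S i j)]_s g s =
  \int[lebesgue_measure]_s ((exponential_pdf (1 : R) s)%:E * g s).
Proof.
move=> mg g0; rewrite ge0_integral_distribution//.
have mS : measurable_fun setT (S i j : Omega -> measurableTypeR R).
  exact: (@measurable_funP _ _ _ _ setT (S i j)).
pose mS_mixin := isMeasurableFun.Build _ _ _ _ _ mS.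
pose S' : {RV P >-> measurableTypeR R} :=
  HB.pack (S i j : Omega -> measurableTypeR R) mS_mixin.
have mg' : measurable_fun setT (g : measurableTypeR R -> \bar R) := mg.
transitivity (\int[distribution P S']_s g s).
  by rewrite ge0_integral_distribution.
apply: integral_density => //.
- by move=> s; exact: exponential_pdf_ge0.
- exact: measurable_exponential_pdf.
- by move=> A mA; exact: law_clock model i j A mA.
Qed.

Lemma integral_clock_laplace i j (g a : Omega -> R) :
  measurable_fun setT (g : Others (Clock i j) -> R) ->
  measurable_fun setT (a : Others (Clock i j) -> R) ->
  (forall w, 0 <= g w)%R -> (forall w, 0 <= a w)%R ->
  \int[P]_w (g w * ((0 <= S i j w)%R%:R * expR (- (S i j w * a w))))%:E
    = \int[P]_w (g w * (1 + a w)^-1)%:E.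
Proof.
move=> mg ma g0 a0.
rewrite (@freeze (Clock i j) _ _ (S i j)
    (fun z => (g z.1 * ((0 <= z.2)%R%:R * expR (- (z.2 * a z.1))))%:E))//; last 3 first.
- by move=> B mB; exists B => //; rewrite setTI.
- have mg1 := measurableT_comp mg (@measurable_fst _ _ (Others (Clock i j)) R).
  have ma1 := measurableT_comp ma (@measurable_fst _ _ (Others (Clock i j)) R).
  by mfun.
- by move=> z; rewrite lee_fin mulr_ge0// mulr_ge0// expR_ge0.
apply: eq_integral => w _ /=.
have mexpw : measurable_fun setT (fun s : R => (0 <= s)%R%:R * expR (- (s * a w)))%R.
  by mfun.
under eq_integral do rewrite EFinM.
rewrite ge0_integralZl_EFin//; last exact/measurable_EFinP.
rewrite EFinM; congr (_ * _).
rewrite -integral_exponential_laplace// integral_clock_density//.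
exact/measurable_EFinP.
Qed.

(** An inequality, because [h] may take a value outside 1..V. Such a value has probability 0, since
    the V prescribed values already exhaust the total mass. *)
Lemma integral_hash_le i j (g : Omega -> R) (h : Omega -> nat) :
  measurable_fun setT (g : Others (Hash i j) -> R) ->
  measurable_fun setT (h : Others (Hash i j) -> nat) ->
  (forall w, 0 <= g w)%R ->
  \int[P]_w (g w * (H i j w == h w)%:R)%:E <= \int[P]_w (g w * V%:R^-1)%:E.
Proof.
move=> mg mh g0.
pose f (z : Others (Hash i j) * nat) := (g z.1 * (z.2 == h z.1)%:R)%:E.
have mf : measurable_fun setT f.
  have mg1 := measurableT_comp mg (@measurable_fst _ _ (Others (Hash i j)) nat).
  have mh1 := measurableT_comp mh (@measurable_fst _ _ (Others (Hash i j)) nat).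
  by rewrite /f; mfun.
have f0 z : 0 <= f z by rewrite lee_fin mulr_ge0.
rewrite (@freeze (Hash i j) _ _ (H i j) f)//; last first.
  by move=> B mB; exists B => //; rewrite setTI.
have hV v : distribution P (H i j) [set v] <= V%:R^-1%:E.
  have [vV|vV] := boolP (1 <= v <= V)%N; first by rewrite [X in X <= _](law_hash model i j vV).
  pose B (u : nat) : set nat := [set u.+1].
  have tot : \sum_(u < V) distribution P (H i j) (B u) = 1.
    rewrite (eq_bigr (fun=> V%:R^-1%:E)); last first.
      move=> u _; have hu : (1 <= u.+1 <= V)%N by rewrite ltn_ord.
      exact: law_hash model i j _ hu.
    by rewrite sumEFin sumr_const card_ord -[X in X%:E]mulr_natl divff// pnatr_eq0 -lt0n.
  suff -> : distribution P (H i j) [set v] = 0 by rewrite lee_fin invr_ge0.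
  have mB : measurable (\big[setU/set0]_(u < V) B u) by exact: bigsetU_measurable.
  have : distribution P (H i j) [set v] + 1 <= 0 + 1.
    rewrite -{1}tot add0e -(@measure_bigsetU _ _ _ (distribution P (H i j)) B)//; last first.
      by apply/trivIsetP => a b _ _ ab; apply/seteqP; split => // x /= [-> []] /eqP;
        rewrite (negbTE ab).
    rewrite -(measureU (distribution P (H i j)))//.
      by apply: probability_le1; exact: measurableU.
    apply/seteqP; split => // x [/= ->]; rewrite -(bigcup_mkord V B).
    by case=> u /= uV vu; rewrite vu /= uV in vV.
  rewrite leeD2rE// => h0; apply/eqP; rewrite eq_le h0; exact: measure_ge0.
apply: ge0_le_integral => //.
- by move=> w _; apply: integral_ge0.
- apply: (@measurable_Others (Hash i j)).
  by apply: (measurable_fun_fubini_tonelli_F (m2 := distribution P (H i j))).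
- by apply/measurable_EFinP; apply: measurable_funM => //; exact: measurable_Others mg.
move=> w _; rewrite /f/=; under eq_integral do rewrite EFinM.
rewrite ge0_integralZl_EFin//.
rewrite EFinM lee_wpmul2l ?lee_fin//.
rewrite (eq_integral (EFin \o \1_([set h w]))); last first.
  by move=> z _; rewrite /= indicE in_set1.
rewrite integral_indic// setIT; exact: hV.
Qed.

Lemma integral_proposal i j (f : Others (Proposal i j) * TY -> \bar R) :
  measurable_fun setT f -> (forall z, 0 <= f z) ->
  \int[P]_w f (w, Y i j w) = \int[P]_w \int[muY]_y ((q y)%:E * f (w, y)).
Proof.
move=> mf f0; have [mq q0 _] := densQ.
rewrite (@freeze (Proposal i j))//; last by move=> B mB; exists B => //; rewrite setTI.
apply: eq_integral => w _; apply: integral_density => //.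
- by move=> A mA; exact: law_proposal model i j A mA.
- exact: (measurable_fun_pair2 (w : Others (Proposal i j)) mf).
Qed.

Lemma measurable_integral_proposal i j (f : Others (Proposal i j) * TY -> \bar R) :
  measurable_fun setT f -> (forall z, 0 <= f z) ->
  measurable_fun setT (fun w : Omega => \int[muY]_y ((q y)%:E * f (w, y))).
Proof.
move=> mf f0; have [mq q0 _] := densQ.
apply: (@measurable_Others (Proposal i j)).
apply: (@measurable_fun_fubini_tonelli_F _ _ _ _ _ muY
  (fun z : Others (Proposal i j) * TY => (q z.2)%:E * f z)).
  apply: emeasurable_funM => //; apply: measurable_EFin.
  exact: measurableT_comp mq measurable_snd.
by move=> z; rewrite mule_ge0// lee_fin.
Qed.

Lemma integral_source (h : TX * TX' -> \bar R) :
  measurable_fun setT h -> (forall z, 0 <= h z) ->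
  \int[P]_w h (X w, X' w) =
  \int[muX]_x \int[muX']_x' ((pX x * pX'X x x')%:E * h (x, x')).
Proof.
move=> mh h0; have [mpX pX0 _] := densX; have [mpX'X pX'X0] := densX'X.
have mXX : measurable_fun setT (source_pair X X') by exact: measurable_fun_pair.
pose mXX_mixin := isMeasurableFun.Build _ _ _ _ _ mXX.
pose XX : {RV P >-> (TX * TX')%type} := HB.pack (source_pair X X') mXX_mixin.
have mpp : measurable_fun setT (fun z : TX * TX' => (pX z.1 * pX'X z.1 z.2)%R).
  by apply: measurable_funM => //; exact: measurableT_comp mpX measurable_fst.
transitivity (\int[distribution P XX]_z h z).
  by rewrite ge0_integral_distribution.
rewrite (@integral_density _ _ _ (distribution P XX) (muX \x muX')
    (fun z => pX z.1 * pX'X z.1 z.2)%R)//.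
- rewrite fubini_tonelli1//.
  + by apply: emeasurable_funM => //; exact: measurable_EFin.
  + move=> z; rewrite mule_ge0// lee_fin mulr_ge0//.
    by have [] := pX'X0 z.1.
- by move=> z; rewrite mulr_ge0//; have [] := pX'X0 z.1.
- by move=> A mA; exact: law_source model A mA.
Qed.

(* The clocks [S i j], [j <> k], are integrated out one after the other, and
   the clock [S i k] last. *)
Lemma integral_race i k (g r : Omega -> R) (a : 'I_n.+1 -> Omega -> R) :
  measurable_fun setT (g : Others (Defs.Uniform i) -> R) ->
  measurable_fun setT (r : Others (Defs.Uniform i) -> R) ->
  (forall j, measurable_fun setT (a j : Others (Defs.Uniform i) -> R)) ->
  (forall j, measurable_fun setT (g : Others (Clock i j) -> R)) ->
  (forall j, measurable_fun setT (r : Others (Clock i j) -> R)) ->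
  (forall j j', measurable_fun setT (a j' : Others (Clock i j) -> R)) ->
  (forall w, 0 <= g w)%R -> (forall w, 0 <= r w <= 1)%R ->
  (forall j w, 0 <= a j w)%R ->
  \int[P]_w (g w * (U i w <= r w)%R%:R * (0 <= S i k w)%R%:R *
      \prod_(j | j != k) (S i k w * a j w < S i j w)%R%:R)%:E
  = \int[P]_w (g w * (r w / (1 + \sum_(j | j != k) a j w)))%:E.
Proof.
move=> mgU mrU maU mgS mrS maS g0 r01 a0.
have mexp d1 (T1 : measurableType d1) (h : T1 -> R) :
  measurable_fun setT h -> measurable_fun setT (fun z => expR (h z)).
  by move=> mh; exact: measurableT_comp mh.
have r0 w : (0 <= r w)%R by case/andP: (r01 w).
have clocks (s : seq 'I_n.+1) (G : Omega -> R) : uniq s -> k \notin s ->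
    (forall j, j \in s -> measurable_fun setT (G : Others (Clock i j) -> R)) ->
    (forall w, 0 <= G w)%R -> (forall w, G w != 0 -> 0 <= S i k w)%R ->
  \int[P]_w (G w * \prod_(j <- s) (S i k w * a j w < S i j w)%R%:R)%:E =
  \int[P]_w (G w * \prod_(j <- s) expR (- (S i k w * a j w)))%:E.
  elim: s G => [|j s IH] G.
    by move=> *; apply: eq_integral => w _; rewrite !big_nil.
  rewrite /= inE negb_or => /andP[js us] /andP[kj ks] mG G0 GS.
  have mSk : measurable_fun setT (S i k : Others (Clock i j) -> R).
    by apply: measurable_Others_S => -[kj']; rewrite kj' eqxx in kj.
  transitivity (\int[P]_w
      (G w * \prod_(j <- s) (S i k w * a j w < S i j w)%R%:R *
       (S i k w * a j w < S i j w)%R%:R)%:E).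
    by apply: eq_integral => w _; rewrite big_cons; congr (_%:E); ring.
  rewrite integral_clock_gt//; last 4 first.
  - apply: measurable_funM; first by apply: mG; rewrite mem_head.
    apply: measurable_prod => j' j's.
    apply: measurable_fun_natr_bool; apply: measurable_fun_ltr.
      by apply: measurable_funM.
    by apply: measurable_Others_S => -[jj']; rewrite -jj' j's in js.
  - by apply: measurable_funM.
  - by move=> w; rewrite mulr_ge0// prodr_ge0.
  - by move=> w; rewrite mulf_eq0 negb_or => /andP[/GS Sk _]; rewrite mulr_ge0.
  (* The exponential joins the weight [G]: it involves the clock [S i k], but none of the clocks
     left in [s]. *)
  transitivity (\int[P]_w ((G w * expR (- (S i k w * a j w))) *
      \prod_(j <- s) (S i k w * a j w < S i j w)%R%:R)%:E).
    by apply: eq_integral => w _; congr (_%:E); ring.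
  rewrite IH//.
  - by apply: eq_integral => w _; rewrite big_cons; congr (_%:E); ring.
  - move=> j' j's; apply: measurable_funM; first by apply: mG; rewrite inE j's orbT.
    apply: mexp; apply: measurable_funN; apply: measurable_funM => //.
    by apply: measurable_Others_S => -[kj']; rewrite kj' j's in ks.
  - by move=> w; rewrite mulr_ge0 ?expR_ge0.
  - by move=> w; rewrite mulf_eq0 negb_or => /andP[/GS].
pose G w := (g w * r w * (0 <= S i k w)%R%:R)%R.
transitivity (\int[P]_w (G w * \prod_(j <- [seq j <- index_enum 'I_n.+1 | j != k])
    (S i k w * a j w < S i j w)%R%:R)%:E).
  transitivity (\int[P]_w (g w * (0 <= S i k w)%R%:R *
      \prod_(j | j != k) (S i k w * a j w < S i j w)%R%:R *
      (U i w <= r w)%R%:R)%:E).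
    by apply: eq_integral => w _; congr (_%:E); ring.
  have mS j : measurable_fun setT (S i j : Others (Defs.Uniform i) -> R).
    exact: measurable_Others_S.
  rewrite integral_uniform//; last 2 first.
  - by mfun.
  - by move=> w; rewrite !mulr_ge0// prodr_ge0.
  by apply: eq_integral => w _; congr (_%:E); rewrite /G big_filter; ring.
rewrite clocks; last 5 first.
- by rewrite filter_uniq// index_enum_uniq.
- by rewrite mem_filter eqxx.
- move=> j; rewrite mem_filter => /andP[jk _].
  have mSk : measurable_fun setT (S i k : Others (Clock i j) -> R).
    by apply: measurable_Others_S => -[kj']; rewrite kj' eqxx in jk.
  by rewrite /G; mfun.
- by move=> w; rewrite /G !mulr_ge0.
- by move=> w; rewrite /G; case: leP => //; rewrite mulr0 eqxx.
transitivity (\int[P]_w (g w * r w * ((0 <= S i k w)%R%:R *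
    expR (- (S i k w * \sum_(j | j != k) a j w))))%:E).
  apply: eq_integral => w _; congr (_%:E); rewrite /G big_filter.
  rewrite -(big_morph _ (@expRD R) (@expR0 R)) sumrN -mulr_sumr; ring.
rewrite integral_clock_laplace//.
- by apply: eq_integral => w _; congr (_%:E); ring.
- by mfun.
- by mfun.
- by move=> w; rewrite mulr_ge0.
- by move=> w; rewrite sumr_ge0.
Qed.

End model.

(** * Conditional laws *)

Section bounding.
Context {R : realType} {dY : measure_display} {TX : Type} {TY : measurableType dY}.
Variables (muY : {measure set TY -> \bar R}) (pYX : TX -> TY -> R) (q : TY -> R)
  (omega : R).
Hypotheses (densYX : forall x, is_density muY (pYX x)) (densQ : is_density muY q)
  (bounding : extended_bounding pYX q omega).

Let q0 y : 0 <= q y. Proof. by have [] := densQ. Qed.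
Let p0 x y : 0 <= pYX x y. Proof. by have [] := densYX x. Qed.

Lemma bounding_eq0 x y : q y = 0 -> pYX x y = 0.
Proof.
move=> qy; have := bounding x y; rewrite qy inver eqxx.
have := p0 x y; rewrite le_eqVlt => /predU1P[//|pxy].
by rewrite gt0_muley ?lte_fin// leye_eq.
Qed.

Lemma weight_ge0 x y : 0 <= weight (pYX x) q y.
Proof. by rewrite /weight divr_ge0. Qed.

Lemma mul_weight x y : q y * weight (pYX x) q y = pYX x y.
Proof.
rewrite /weight; have [q0'|qy] := eqVneq (q y) 0.
  by rewrite q0' mul0r bounding_eq0.
by rewrite mulrC divfK.
Qed.

Lemma weight_le (omega_ge0 : 0 <= omega) x y : weight (pYX x) q y <= omega.
Proof.
rewrite /weight; have [->|qy] := eqVneq (q y) 0; first by rewrite invr0 mulr0.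
by have := bounding x y; rewrite inver (negbTE qy) -EFinM lee_fin.
Qed.

Lemma density_le (omega_ge0 : 0 <= omega) x y : pYX x y <= omega * q y.
Proof. by rewrite -mul_weight mulrC ler_wpM2r// weight_le. Qed.

Lemma weight_le_sup (omega_ge0 : 0 <= omega) x y :
  weight (pYX x) q y <= sup_weight (pYX x) q.
Proof.
rewrite /sup_weight; apply: ub_le_sup; last by exists y.
by exists omega => _ [z _ <-]; exact: weight_le.
Qed.

Lemma sup_weight_le (omega_ge0 : 0 <= omega) x : sup_weight (pYX x) q <= omega.
Proof.
rewrite /sup_weight; apply: ge_sup; last by move=> _ [z _ <-]; exact: weight_le.
by exists (weight (pYX x) q point); exists point.
Qed.

Lemma integral_weight x :
  (\int[muY]_y ((q y)%:E * (weight (pYX x) q y)%:E) = 1)%E.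
Proof.
have [_ _ <-] := densYX x.
by apply: eq_integral => y _; rewrite -EFinM mul_weight.
Qed.

(** The mean of the inverse weight under [q] is the quantity that the harmonic mean produces; this
    is where d_2 comes in. Where [q] vanishes both integrands are 0, whatever the quotients are. *)
Lemma integral_weightV x :
  (\int[muY]_y ((q y)%:E * ((weight (pYX x) q y)%:E)^-1) = d2 muY q (pYX x))%E.
Proof.
apply: eq_integral => y _; have [qy|qy] := eqVneq (q y) 0.
  by rewrite qy !mul0e.
have q1 : 0 < q y by rewrite lt_neqAle eq_sym qy q0.
congr (_ * _)%E; rewrite !inver /weight mulf_eq0 invr_eq0 (negbTE qy) orbF.
case: ifP => [_|_]; first by rewrite gt0_muley// lte_fin.
by rewrite -EFinM invf_div.
Qed.

End bounding.

(** * The law of Y' given X' and its default values *)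

Section conditional.
Context {R : realType} {dX dX' dY : measure_display}
  {TX : measurableType dX} {TX' : measurableType dX'} {TY : measurableType dY}.
Variables (muX : {sigma_finite_measure set TX -> \bar R})
  (muX' : {sigma_finite_measure set TX' -> \bar R})
  (muY : {sigma_finite_measure set TY -> \bar R}).
Variables (pX : TX -> R) (pX'X : TX -> TX' -> R) (pYX : TX -> TY -> R)
  (q : TY -> R) (omega : R).
Hypotheses (densX : is_density muX pX) (densX'X : is_cond_density muX' pX'X)
  (densYX : is_cond_density muY pYX) (densQ : is_density muY q)
  (omega_ge0 : 0 <= omega) (bounding : extended_bounding pYX q omega).
Local Open Scope ereal_scope.

Notation J := (joint pX pX'X pYX).
Notation m1 x' y := (\int[muX]_x (J x x' y)%:E).
Notation m2 x' := (\int[muX]_x \int[muY]_y (J x x' y)%:E).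
Notation p' := (cond_YX' muX muY pX pX'X pYX).

Let pX0 x : (0 <= pX x)%R. Proof. by have [] := densX. Qed.
Let pX'X0 x x' : (0 <= pX'X x x')%R. Proof. by have [_ /(_ x)[]] := densX'X. Qed.
Let pYX0 x y : (0 <= pYX x y)%R. Proof. by have [_ /(_ x)[]] := densYX. Qed.

Lemma joint_ge0 x x' y : (0 <= J x x' y)%R.
Proof. by rewrite /joint !mulr_ge0. Qed.

Section measurable_joint.
Context {d} {T : measurableType d}.
Variables (x : T -> TX) (x' : T -> TX') (y : T -> TY).
Hypotheses (mx : measurable_fun setT x) (mx' : measurable_fun setT x')
  (my : measurable_fun setT y).

Lemma measurable_pX : measurable_fun setT (fun t => pX (x t)).
Proof. by have [mp _ _] := densX; exact: measurableT_comp mp mx. Qed.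

Lemma measurable_pX'X : measurable_fun setT (fun t => pX'X (x t) (x' t)).
Proof.
have [mp _] := densX'X; exact: (measurableT_comp mp (measurable_fun_pair mx mx')).
Qed.

Lemma measurable_pYX : measurable_fun setT (fun t => pYX (x t) (y t)).
Proof.
have [mp _] := densYX; exact: (measurableT_comp mp (measurable_fun_pair mx my)).
Qed.

Lemma measurable_joint : measurable_fun setT (fun t => J (x t) (x' t) (y t)).
Proof.
apply: measurable_funM; last exact: measurable_pYX.
by apply: measurable_funM; [exact: measurable_pX|exact: measurable_pX'X].
Qed.

End measurable_joint.

Let mfine : measurable_fun [set: \bar R] fine.
Proof. exact: fine_measurable. Qed.

Let m1E0 x' y : 0 <= m1 x' y.
Proof. by apply: integral_ge0 => x _; rewrite lee_fin joint_ge0. Qed.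

Let m1m : measurable_fun setT (fun z : TX' * TY => m1 z.1 z.2).
Proof.
apply: (@measurable_fun_fubini_tonelli_G _ _ _ _ _ muX
  (fun z : TX * (TX' * TY) => (J z.1 z.2.1 z.2.2)%:E)).
  apply: measurable_EFin; apply: measurable_joint => //.
    by apply: measurableT_comp measurable_snd.
  by apply: measurableT_comp measurable_snd.
by move=> z; rewrite lee_fin joint_ge0.
Qed.

Let m2E x' : m2 x' = \int[muX]_x (pX x * pX'X x x')%:E.
Proof.
apply: eq_integral => x _; rewrite /joint.
under eq_integral do rewrite EFinM.
have [mp pp p1] : is_density muY (pYX x) by have [_] := densYX.
rewrite ge0_integralZl_EFin ?p1 ?mule1//.
- by move=> y _; rewrite lee_fin.
- exact/measurable_EFinP.
- by rewrite mulr_ge0.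
Qed.

Let m2E0 x' : 0 <= m2 x'.
Proof. by rewrite m2E integral_ge0// => x _; rewrite lee_fin mulr_ge0. Qed.

Let m2m : measurable_fun setT (fun x' => m2 x').
Proof.
rewrite (_ : (fun _ => _) = fun x' => \int[muX]_x (pX x * pX'X x x')%:E); last first.
  by apply/funext => x'; exact: m2E.
apply: (@measurable_fun_fubini_tonelli_G _ _ _ _ _ muX
  (fun z : TX * TX' => (pX z.1 * pX'X z.1 z.2)%:E)).
  apply: measurable_EFin; apply: measurable_funM; first exact: measurable_pX.
  exact: measurable_pX'X.
by move=> z; rewrite lee_fin mulr_ge0.
Qed.

Let int_m1 x' : \int[muY]_y m1 x' y = m2 x'.
Proof.
apply/esym; apply: (fubini_tonelli (fun z : TX * TY => (J z.1 x' z.2)%:E)).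
  by apply: measurable_EFin; apply: measurable_joint => //; exact: measurable_cst.
by move=> z; rewrite lee_fin joint_ge0.
Qed.

(** The bounding condition holds for each [x], hence for mixtures over [x]. This carries it over to
    the decoder's weights. *)
Let m1_le x' y : m1 x' y <= (omega * q y)%:E * m2 x'.
Proof.
have q0 : (0 <= q y)%R by have [] := densQ.
rewrite m2E -ge0_integralZl_EFin ?mulr_ge0//; last 2 first.
- by move=> x _; rewrite lee_fin mulr_ge0.
- apply: measurable_EFin; apply: measurable_funM; first exact: measurable_pX.
  by apply: measurable_pX'X => //; exact: measurable_cst.
apply: ge0_le_integral => //.
- by move=> x _; rewrite lee_fin joint_ge0.
- apply: measurable_EFin; apply: measurable_joint => //; exact: measurable_cst.
- apply: measurable_EFin; apply: measurable_funM; first exact: measurable_cst.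
  apply: measurable_funM; first exact: measurable_pX.
  by apply: measurable_pX'X => //; exact: measurable_cst.
move=> x _; rewrite lee_fin /joint mulrC ler_wpM2r ?mulr_ge0//.
have densYX' x0 : is_density muY (pYX x0) by have [_] := densYX.
exact: (density_le densYX' densQ).
Qed.

Lemma cond_YX'_ge0 x' y : (0 <= p' x' y)%R.
Proof. by rewrite divr_ge0// fine_ge0. Qed.

Lemma measurable_cond_YX' :
  measurable_fun setT (fun z : TX' * TY => p' z.1 z.2).
Proof.
apply: measurable_funM.
  by exact: (measurableT_comp mfine m1m).
apply: measurable_funV.
exact: (measurableT_comp mfine (measurableT_comp m2m measurable_fst)).
Qed.

Lemma cond_YX'_le x' y : (p' x' y <= omega * q y)%R.
Proof.
have q0 : (0 <= q y)%R by have [] := densQ.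
rewrite /cond_YX' /marginal_X'.
have := m1_le x' y; have := m1E0 x' y; have := m2E0 x'.
case: (m2 x') => [b| |]//; last 1 first.
  by rewrite /= invr0 mulr0 mulr_ge0.
rewrite lee_fin => b0; case: (m1 x' y) => [a| |]//=.
move=> _; rewrite -EFinM lee_fin => ab; have [->|b1] := eqVneq b 0%R.
  by rewrite invr0 mulr0 mulr_ge0.
by rewrite ler_pdivrMr// lt_neqAle eq_sym b1.
Qed.

(** Not an equality: where the marginal of X' is 0 or +oo, the inverse of its [fine] is 0 and the
    conditional density is identically 0. An upper bound is what the estimate of the denominator
    calls for. *)
Lemma integral_cond_YX'_le1 x' : \int[muY]_y (p' x' y)%:E <= 1.
Proof.
have mm1 : measurable_fun setT (fun y => m1 x' y).
  exact: (measurable_fun_pair2 x' m1m).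
have mf : measurable_fun setT (fun y => fine (m1 x' y)).
  by exact: (measurableT_comp mfine mm1).
rewrite /cond_YX' /marginal_X'.
under eq_integral do rewrite mulrC EFinM.
rewrite ge0_integralZl_EFin//; last 3 first.
- by move=> y _; rewrite lee_fin fine_ge0.
- exact: measurable_EFin.
- by rewrite invr_ge0 fine_ge0.
have : \int[muY]_y (fine (m1 x' y))%:E <= m2 x'.
  rewrite -int_m1; apply: ge0_le_integral => //.
  - by move=> y _; rewrite lee_fin fine_ge0.
  - exact: measurable_EFin.
  - by move=> y _; case: (m1 x' y) (m1E0 x' y) => //= *; exact: lexx.
have : 0 <= \int[muY]_y (fine (m1 x' y))%:E.
  by apply: integral_ge0 => y _; rewrite lee_fin fine_ge0.
have := m2E0 x'; case: (m2 x') => [b| |]//; last by rewrite /= invr0 mul0e.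
case: (integral _ _ _) => [a| |]//; rewrite !lee_fin => b0 a0 ab.
have [->|b1] := eqVneq b 0%R; first by rewrite /= invr0 mul0r.
by rewrite /= ler_pdivrMl ?mulr1// lt_neqAle eq_sym b1.
Qed.

Lemma integral_swap3 (g : TX * TX' * TY -> \bar R) :
  measurable_fun setT g -> (forall z, 0 <= g z) ->
  \int[muX]_x \int[muX']_x' \int[muY]_y g (x, x', y) =
  \int[muX']_x' \int[muY]_y \int[muX]_x g (x, x', y).
Proof.
move=> mg g0; transitivity (\int[muX']_x' \int[muX]_x \int[muY]_y g (x, x', y)).
  apply: (fubini_tonelli (fun z : TX * TX' => \int[muY]_y g (z, y))).
    exact: (@measurable_fun_fubini_tonelli_F _ _ _ _ _ muY g).
  by move=> z; apply: integral_ge0.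
apply: eq_integral => x' _.
apply: (fubini_tonelli (fun z : TX * TY => g (z.1, x', z.2))) => //.
have mh : measurable_fun setT (fun z : TX * TY => (z.1, x', z.2)).
  by apply: measurable_fun_pair => //; apply: measurable_fun_pair => //; exact: measurable_cst.
exact: (measurableT_comp mg mh).
Qed.

Let int_m2 : \int[muX']_x' m2 x' = 1.
Proof.
under eq_integral do rewrite m2E.
have [mp p0 p1] := densX.
rewrite -(fubini_tonelli (fun z : TX * TX' => (pX z.1 * pX'X z.1 z.2)%:E)).
- rewrite -p1; apply: eq_integral => x _ /=.
  under eq_integral do rewrite EFinM.
  have [mp' p0' p1'] : is_density muX' (pX'X x) by have [_] := densX'X.
  rewrite ge0_integralZl_EFin ?p1' ?mule1//.
  + by move=> y _; rewrite lee_fin.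
  + exact/measurable_EFinP.
- apply: measurable_EFin; apply: measurable_funM; first exact: measurable_pX.
  exact: measurable_pX'X.
- by move=> z; rewrite lee_fin mulr_ge0.
Qed.

Let m2_fin : {ae muX', forall x', m2 x' \is a fin_num}.
Proof.
have : muX'.-integrable setT (fun x' => m2 x').
  apply/integrableP; split; first exact: m2m.
  under eq_integral do rewrite gee0_abs//.
  by rewrite int_m2 ltry.
move=> /(integrable_ae measurableT); apply: filterS => x' h.
exact: h.
Qed.

(* The junk values of [cond_YX'] only occur on a null set of the joint law. *)
Lemma joint_cond_YX'_gt0 (f : TX * TX' * TY -> \bar R) :
  measurable_fun setT f -> (forall z, 0 <= f z <= 1) ->
  \int[muX]_x \int[muX']_x' \int[muY]_y ((J x x' y)%:E * f (x, x', y)) =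
  \int[muX]_x \int[muX']_x' \int[muY]_y
    ((J x x' y)%:E * (f (x, x', y) * (0 < p' x' y)%R%:R%:E)).
Proof.
move=> mf f01.
have mJ : measurable_fun setT (fun z : TX * TX' * TY => J z.1.1 z.1.2 z.2).
  by apply: measurable_joint => //; apply: measurableT_comp measurable_fst.
have f0 z : 0 <= f z by case/andP: (f01 z).
have f1 z : f z <= 1 by case/andP: (f01 z).
have mp' : measurable_fun setT (fun z : TX * TX' * TY => p' z.1.2 z.2).
  have m23 : measurable_fun setT (fun z : TX * TX' * TY => (z.1.2, z.2)).
    apply: measurable_fun_pair => //.
    exact: (measurableT_comp measurable_snd measurable_fst).
  exact: (measurableT_comp measurable_cond_YX' m23).
pose g1 (z : TX * TX' * TY) := (J z.1.1 z.1.2 z.2)%:E * f z.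
pose g2 (z : TX * TX' * TY) :=
  (J z.1.1 z.1.2 z.2)%:E * (f z * (0 < p' z.1.2 z.2)%R%:R%:E).
have mg1 : measurable_fun setT g1 by rewrite /g1; mfun.
have mg2 : measurable_fun setT g2 by rewrite /g2; mfun.
have g10 z : 0 <= g1 z by rewrite mule_ge0// lee_fin joint_ge0.
have g20 z : 0 <= g2 z by rewrite !mule_ge0// lee_fin// joint_ge0.
apply: (etrans (integral_swap3 mg1 g10)).
apply: (etrans _ (esym (integral_swap3 mg2 g20))).
have le_m1 (g : TX * TX' * TY -> \bar R) x' y : measurable_fun setT g -> (forall z, 0 <= g z) ->
    (forall z, g z <= (J z.1.1 z.1.2 z.2)%:E) ->
    \int[muX]_x g (x, x', y) <= m1 x' y.
  move=> mg g0 gJ; apply: ge0_le_integral => //.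
  - have mh : measurable_fun setT (fun x : TX => (x, x', y)).
      by apply: measurable_fun_pair => //; exact: measurable_fun_pair.
    exact: (measurableT_comp mg mh).
  - apply: measurable_EFin; apply: measurable_joint => //; exact: measurable_cst.
have g1J z : g1 z <= (J z.1.1 z.1.2 z.2)%:E.
  by rewrite /g1 -[leRHS]mule1 lee_wpmul2l// lee_fin joint_ge0.
have g2J z : g2 z <= (J z.1.1 z.1.2 z.2)%:E.
  rewrite /g2 -[leRHS]mule1 lee_wpmul2l// ?lee_fin ?joint_ge0//.
  by case: ltP => _; rewrite ?mule1// mule0.
have minn (g : TX * TX' * TY -> \bar R) : measurable_fun setT g -> (forall z, 0 <= g z) ->
    measurable_fun setT (fun z : TX' * TY => \int[muX]_x g (x, z.1, z.2)).
  move=> mg g0.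
  apply: (@measurable_fun_fubini_tonelli_G _ _ _ _ _ muX
    (fun z : TX * (TX' * TY) => g (z.1, z.2.1, z.2.2))) => //.
  have mh : measurable_fun setT (fun z : TX * (TX' * TY) => (z.1, z.2.1, z.2.2)).
    apply: measurable_fun_pair; last exact: (measurableT_comp measurable_snd measurable_snd).
    apply: measurable_fun_pair => //.
    exact: (measurableT_comp measurable_fst measurable_snd).
  exact: (measurableT_comp mg mh).
have mint (g : TX * TX' * TY -> \bar R) : measurable_fun setT g -> (forall z, 0 <= g z) ->
    measurable_fun setT (fun x' => \int[muY]_y \int[muX]_x g (x, x', y)).
  move=> mg g0; have h0 (z : TX' * TY) : 0 <= \int[muX]_x g (x, z.1, z.2).
    by apply: integral_ge0.
  exact: (measurable_fun_fubini_tonelli_F _ (minn _ mg g0) h0).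
have zero (g : TX * TX' * TY -> \bar R) x' : measurable_fun setT g -> (forall z, 0 <= g z) ->
    (forall z, g z <= (J z.1.1 z.1.2 z.2)%:E) -> m2 x' = 0 ->
    \int[muY]_y \int[muX]_x g (x, x', y) = 0.
  move=> mg g0 gJ m20; apply/eqP; rewrite eq_le; apply/andP; split; last first.
    by apply: integral_ge0 => y _; exact: integral_ge0.
  rewrite -m20 -int_m1; apply: ge0_le_integral => //.
  - by move=> y _; exact: integral_ge0.
  - exact: (measurable_fun_pair2 x' (minn _ mg g0)).
  - exact: (measurable_fun_pair2 x' m1m).
  - by move=> y _; exact: le_m1.
apply: ge0_ae_eq_integral => //.
- exact: mint.
- exact: mint.
- by move=> x' _; apply: integral_ge0 => y _; exact: integral_ge0.
- by move=> x' _; apply: integral_ge0 => y _; exact: integral_ge0.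
move: m2_fin; apply: filterS => x' m2f _ /=.
have [m20|m20] := eqVneq (m2 x') 0; first by rewrite !zero.
apply: eq_integral => y _.
have [py|py] := ltP 0%R (p' x' y).
  by apply: eq_integral => x _; rewrite /g1 /g2/= py mule1.
(* The marginal of X' is finite and nonzero here, so a vanishing conditional density comes from a
   vanishing numerator [m1], and [m1] dominates both inner integrals. *)
have m10 : m1 x' y = 0.
  apply/eqP; rewrite eq_le m1E0 andbT.
  have m2gt : (0 < fine (m2 x'))%R.
    by rewrite fine_gt0// lt0e m20 m2E0/= ltey_eq m2f.
  have : m1 x' y \is a fin_num.
    rewrite ge0_fin_numE//; apply: le_lt_trans (m1_le x' y) _.
    by rewrite -(fineK m2f) -EFinM ltry.
  move=> /fineK <-; rewrite lee_fin.
  by move: py; rewrite /cond_YX' /marginal_X' pmulr_lle0// invr_gt0.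
transitivity (0 : \bar R).
  by apply/eqP; rewrite eq_le integral_ge0// andbT -m10; exact: le_m1.
by apply/esym/eqP; rewrite eq_le integral_ge0// andbT -m10; exact: le_m1.
Qed.

Lemma integral_joint : \int[muX]_x \int[muX']_x' \int[muY]_y (J x x' y)%:E = 1.
Proof.
rewrite (integral_swap3 (g := fun z => (J z.1.1 z.1.2 z.2)%:E)).
- by under eq_integral do rewrite int_m1; exact: int_m2.
- apply: measurable_EFin.
  by apply: measurable_joint => //; apply: measurableT_comp measurable_fst.
- by move=> z; rewrite lee_fin joint_ge0.
Qed.

End conditional.

(** * Mismatch probability and code length *)

(* Jensen's inequality for [x^-1], by its tangent line at [c]:
   [x^-1 >= 2 / c - x / c ^ 2]. *)
Lemma integral_div_ge {R : realType} d (T : measurableType d)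
    (mu : {measure set T -> \bar R}) (g D c : T -> R) :
  measurable_fun setT g -> measurable_fun setT D -> measurable_fun setT c ->
  (forall t, 0 <= g t) -> (forall t, g t != 0 -> 0 < D t) -> (forall t, 0 <= D t) ->
  (forall t, 0 < c t) ->
  (\int[mu]_t (g t / c t)%:E < +oo)%E ->
  (\int[mu]_t (g t / c t ^+ 2 * D t)%:E <= \int[mu]_t (g t / c t)%:E)%E ->
  (\int[mu]_t (g t / c t)%:E <= \int[mu]_t (g t / D t)%:E)%E.
Proof.
move=> mg mD mc g0 gD D0 c0 fin le1.
have gc0 t : (0 <= (g t / c t)%:E)%E by rewrite lee_fin divr_ge0// ltW.
have gD0 t : (0 <= (g t / D t)%:E)%E by rewrite lee_fin divr_ge0.
have gDc0 t : (0 <= (g t / c t ^+ 2 * D t)%:E)%E.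
  by rewrite lee_fin mulr_ge0// divr_ge0// exprn_ge0// ltW.
have mc2 : measurable_fun setT (fun t => c t ^+ 2) by exact: measurable_funX.
have mgc : measurable_fun setT (fun t => (g t / c t)%:E) by mfun.
have mgD : measurable_fun setT (fun t => (g t / D t)%:E) by mfun.
have mgDc : measurable_fun setT (fun t => (g t / c t ^+ 2 * D t)%:E) by mfun.
have fin' : (\int[mu]_t (g t / c t)%:E)%E \is a fin_num.
  by rewrite ge0_fin_numE// integral_ge0.
(* Adding the finite integral of [g / c] to both sides avoids subtracting integrals: the tangent
   line is used in the form [2 g / c <= g / D + g D / c ^ 2], and [le1] then replaces the last
   term. *)
rewrite -(leeD2rE _ _ fin'); apply: (le_trans _ (leeD2l _ le1)).
rewrite -!ge0_integralD//; apply: ge0_le_integral => //.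
- by move=> t _; exact: adde_ge0.
- exact: emeasurable_funD.
- exact: emeasurable_funD.
move=> t _; rewrite -!EFinD lee_fin.
have [->|gt0] := eqVneq (g t) 0; first by rewrite !mul0r.
have Dt := gD t gt0; have ct := c0 t.
rewrite -subr_ge0 (_ : _ - _ = g t * (D t)^-1 * (1 - D t / c t) ^+ 2).
  by rewrite mulr_ge0 ?sqr_ge0// mulr_ge0// invr_ge0 ltW.
by field; rewrite !gt_eqF.
Qed.

Lemma prod_natr_bool (R : comPzSemiRingType) (I : finType) (Q f : pred I) :
  \prod_(j | Q j) (f j)%:R = [forall (j | Q j), f j]%:R :> R.
Proof.
have [/forallP fA|/forallPn[j]] := boolP [forall (j | Q j), f j].
  by rewrite big1// => j Qj; have := fA j; rewrite Qj /= => ->.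
rewrite negb_imply => /andP[Qj fj].
by rewrite (bigD1 j)//= (negbTE fj) mul0r.
Qed.

(** The inequality between the harmonic and the arithmetic means. In the extended reals a vanishing
    [l j] makes the right-hand side +oo. The separate [t] allows a sum over more indices than those
    of [Q]. *)
Lemma inv_sum_le (R : realType) (I : finType) (Q : pred I) (l : I -> R) (t : R) :
  (forall j, 0 <= l j) -> (0 < #|Q|)%N -> \sum_(j | Q j) l j <= t ->
  (t^-1%:E <= (#|Q|%:R ^- 2)%:E * \sum_(j | Q j) (l j)%:E^-1)%E.
Proof.
move=> l0 Q0 lt; have m0 : 0 < #|Q|%:R :> R by rewrite ltr0n.
have [/existsP[j /andP[Qj /eqP lj]]|/existsPn ln] :=
    boolP [exists j, Q j && (l j == 0)].
  rewrite (bigD1 j)//= lj inve0 addye; last first.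
    by rewrite gt_eqF// (lt_le_trans (ltNyr 0))// sume_ge0// => i _; rewrite inve_ge0 lee_fin.
  by rewrite gt0_muley ?leey// lte_fin invr_gt0 exprn_gt0.
have lp j : Q j -> 0 < l j.
  by move=> Qj; have := ln j; rewrite Qj /= lt_neqAle eq_sym l0 andbT.
rewrite (eq_bigr (fun j => (l j)^-1%:E)); last first.
  by move=> j Qj; rewrite inver gt_eqF ?lp.
rewrite sumEFin -EFinM lee_fin.
have s0 : 0 < \sum_(j | Q j) l j.
  case/card_gt0P: Q0 => j Qj; rewrite (bigD1 j)//= ltr_pwDl ?lp//.
  by apply: sumr_ge0.
apply: (@le_trans _ _ (\sum_(j | Q j) l j)^-1).
  by rewrite lef_pV2// posrE (lt_le_trans s0).
set z := \sum_(j | Q j) l j in s0 *; set m := #|Q|%:R in m0 *.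
rewrite mulrC ler_pdivlMr ?exprn_gt0//.
(* Tangent lines of the inverse at the mean [z / m]; their values add up to [m ^ 2 / z]. *)
apply: (@le_trans _ _ (\sum_(j | Q j) (2 * m / z - m ^+ 2 / z ^+ 2 * l j))).
  rewrite sumrB sumr_const -mulr_sumr -/z -[X in X - _]mulr_natr -/m.
  by rewrite le_eqVlt; apply/orP; left; apply/eqP; field; rewrite gt_eqF.
apply: ler_sum => j /lp lj.
rewrite -subr_ge0 (_ : _ - _ = (1 - m / z * l j) ^+ 2 / l j).
  by rewrite divr_ge0 ?sqr_ge0// ltW.
by field; rewrite !gt_eqF.
Qed.

Section integral3.
Local Open Scope ereal_scope.
Context {R : realType} {d1 d2 d3 : measure_display} {T1 : measurableType d1}
  {T2 : measurableType d2} {T3 : measurableType d3}.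
Variables (m1 : {sigma_finite_measure set T1 -> \bar R})
  (m2 : {sigma_finite_measure set T2 -> \bar R})
  (m3 : {sigma_finite_measure set T3 -> \bar R}).

Lemma ge0_integral3D (f g : T1 * T2 * T3 -> \bar R) :
  measurable_fun setT f -> (forall z, 0 <= f z) ->
  measurable_fun setT g -> (forall z, 0 <= g z) ->
  \int[m1]_x \int[m2]_y \int[m3]_z (f (x, y, z) + g (x, y, z)) =
  \int[m1]_x \int[m2]_y \int[m3]_z f (x, y, z) +
  \int[m1]_x \int[m2]_y \int[m3]_z g (x, y, z).
Proof.
move=> mf f0 mg g0.
pose F h (u : T1 * T2) := \int[m3]_z h (u, z).
have mF h : measurable_fun setT h -> (forall z, 0 <= h z) -> measurable_fun setT (F h).
  by move=> mh h0; exact: measurable_fun_fubini_tonelli_F.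
have F0 h u : (forall z, 0 <= h z) -> 0 <= F h u.
  by move=> h0; apply: integral_ge0 => z _; exact: h0.
pose G h x := \int[m2]_y F h (x, y).
have mG h : measurable_fun setT h -> (forall z, 0 <= h z) -> measurable_fun setT (G h).
  move=> mh h0; apply: (measurable_fun_fubini_tonelli_F (F h)) => [|u]; first exact: mF.
  exact: F0.
have G0 h x : (forall z, 0 <= h z) -> 0 <= G h x.
  by move=> h0; apply: integral_ge0 => y _; exact: F0.
rewrite -[RHS]/(\int[m1]_x G f x + \int[m1]_x G g x).
rewrite -(ge0_integralD m1 measurableT (fun x _ => G0 f x f0) (mG _ mf f0)
  (fun x _ => G0 g x g0) (mG _ mg g0)).
apply: eq_integral => x _.
rewrite /G -(ge0_integralD m2 measurableT (fun y _ => F0 f (x, y) f0)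
  (measurable_fun_pair2 x (mF _ mf f0)) (fun y _ => F0 g (x, y) g0)
  (measurable_fun_pair2 x (mF _ mg g0))).
apply: eq_integral => y _.
rewrite /F -(ge0_integralD m3 measurableT (fun z _ => f0 (x, y, z))
  (measurable_fun_pair2 (x, y) mf) (fun z _ => g0 (x, y, z))
  (measurable_fun_pair2 (x, y) mg)).
by [].
Qed.

End integral3.

(** * Winning events and the acceptance of a batch *)

Section estimates.
Context {R : realType} {d dX dX' dY : measure_display}
  {Omega : measurableType d} {P : probability Omega R}
  {TX : measurableType dX} {TX' : measurableType dX'} {TY : measurableType dY}
  {n : nat}.
Variables (muX : {sigma_finite_measure set TX -> \bar R})
  (muX' : {sigma_finite_measure set TX' -> \bar R})
  (muY : {sigma_finite_measure set TY -> \bar R}).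
Variables (pX : TX -> R) (pX'X : TX -> TX' -> R) (pYX : TX -> TY -> R)
  (q : TY -> R) (V : nat) (omega : R).
Variables (X : {RV P >-> TX}) (X' : {RV P >-> TX'})
  (U : nat -> {RV P >-> R}) (Y : nat -> 'I_n.+1 -> {RV P >-> TY})
  (H : nat -> 'I_n.+1 -> {RV P >-> nat}) (S : nat -> 'I_n.+1 -> {RV P >-> R}).
Hypotheses (densX : is_density muX pX) (densX'X : is_cond_density muX' pX'X)
  (densYX : is_cond_density muY pYX) (densQ : is_density muY q)
  (meas_omega : measurable_fun setT (fun x => sup_weight (pYX x) q))
  (V_gt0 : (0 < V)%N) (omega_ge1 : 1 <= omega)
  (bounding : extended_bounding pYX q omega)
  (omega_le : omega <= n.+1%:R)
  (model : wz_model muX muX' muY pX pX'X q V X X' U Y H S).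

Notation Others := (Others X X' U Y H S).
Notation shared := (shared U Y H S).

Let omega_ge0 : 0 <= omega. Proof. exact: le_trans omega_ge1. Qed.
Let densYX' x : is_density muY (pYX x). Proof. by have [_] := densYX. Qed.
Let mpYX : measurable_fun setT (fun z : TX * TY => pYX z.1 z.2).
Proof. by have [] := densYX. Qed.
Let mq : measurable_fun setT q. Proof. by have [] := densQ. Qed.
Let q0 y : 0 <= q y. Proof. by have [] := densQ. Qed.

(** In the notation of the protocol, [lam] is lambda, [top] is omega_x and [tot] is Zhat. When the
    candidate is [k], Zbar is [rest + top], which does not involve the proposal at [k]. *)
Definition lam i j w := weight (pYX (X w)) q (Y i j w).
Definition top w := sup_weight (pYX (X w)) q.
Definition tot i w := \sum_(j < n.+1) lam i j w.
Definition rest i k w := \sum_(j < n.+1 | j != k) lam i j w.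

Lemma lam_ge0 i j w : 0 <= lam i j w.
Proof. exact: (weight_ge0 densYX' densQ). Qed.

Lemma lam_le_top i j w : lam i j w <= top w.
Proof. exact: (weight_le_sup bounding). Qed.

Lemma top_le w : top w <= omega.
Proof. exact: (sup_weight_le bounding). Qed.

Lemma rest_ge0 i k w : 0 <= rest i k w.
Proof. by apply: sumr_ge0 => j _; exact: lam_ge0. Qed.

Lemma totE i k w : tot i w = lam i k w + rest i k w.
Proof. by rewrite /tot (bigD1 k). Qed.

Section measurable.
Variable c : component n.
Hypothesis cX : Source <> c.

Lemma measurable_lam i j : Proposal i j <> c ->
  measurable_fun setT (lam i j : Others c -> R).
Proof.
move=> cY; apply: (@measurable_weight _ _ _ _ (Others c) _ _ pYX q) => //.
  exact: measurable_Others_X.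
exact: measurable_Others_Y.
Qed.

Lemma measurable_top : measurable_fun setT (top : Others c -> R).
Proof. by apply: (measurableT_comp meas_omega); exact: measurable_Others_X. Qed.

Lemma measurable_rest i k : (forall j, j != k -> Proposal i j <> c) ->
  measurable_fun setT (rest i k : Others c -> R).
Proof.
move=> cY; apply: measurable_fun_sumr => j jk.
by apply: measurable_lam; exact: cY.
Qed.

End measurable.

(** The acceptance threshold with the candidate frozen at [k]. Unlike Zhat / Zbar it does not depend
    on the clocks, so the uniform variable and the clocks can be integrated out separately. *)
Definition ratio i k w := tot i w / (rest i k w + top w).

Lemma ratio01 i k w : 0 <= ratio i k w <= 1.
Proof.
have r0 := rest_ge0 i k w; have l0 := lam_ge0 i k w; have lt := lam_le_top i k w.
have d0 : 0 <= rest i k w + top w by lra.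
rewrite /ratio (totE _ k); apply/andP; split; first by rewrite divr_ge0// addr_ge0.
have [->|dn] := eqVneq (rest i k w + top w) 0; first by rewrite invr0 mulr0.
by rewrite ler_pdivrMr ?lt_neqAle ?d0 1?eq_sym ?dn//; lra.
Qed.

(* With [b j] the ratio of the speeds of [j] and [k] in the decoder's race, [k]
   wins both the encoder's and the decoder's race: the sum of the two ratios
   dominates each of them. *)
Definition win i k (b : 'I_n.+1 -> Omega -> R) w : bool :=
  [&& 0 < lam i k w, U i w <= ratio i k w, 0 <= S i k w
    & [forall (j | j != k), S i k w * (lam i j w / lam i k w + b j w) < S i j w]].

Lemma win_candidate i k b w : (forall j, 0 <= b j w) -> win i k b w ->
  candidate (pYX (X w)) q (shared w i) = k.
Proof.
move=> b0 /and4P[lk _ Sk /forallP Sj].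
apply: (@candidate_eq _ _ _ _ _ _ k (fun j => lam i j w / lam i k w + b j w)) => //.
- by move=> y; exact: (weight_ge0 densYX' densQ).
- by move=> j _; rewrite lerDl.
- by move=> j jk; have := Sj j; rewrite jk.
Qed.

Lemma win_accepts i k b w : (forall j, 0 <= b j w) -> win i k b w ->
  accepts (pYX (X w)) q (shared w i).
Proof.
move=> b0 W; rewrite /accepts (win_candidate b0 W).
have /and4P[_ Uw _ _] := W; apply: le_trans Uw _.
suff : ratio i k w <= tot i w / (tot i w + top w - lam i k w) by [].
rewrite (_ : tot i w + top w - lam i k w = rest i k w + top w)//.
by rewrite (totE _ k); ring.
Qed.

(** The sum of the [lam i j / lam i k] over all [j] is [tot / lam i k], and this [tot] cancels the
    numerator of the acceptance ratio. With [b = 0] there remains [lam i k] over Zbar. *)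
Lemma integral_win i k (g : Omega -> R) (b : 'I_n.+1 -> Omega -> R) :
  measurable_fun setT (g : Others (Defs.Uniform i) -> R) ->
  (forall j, measurable_fun setT (b j : Others (Defs.Uniform i) -> R)) ->
  (forall j, measurable_fun setT (g : Others (Clock i j) -> R)) ->
  (forall j j', measurable_fun setT (b j' : Others (Clock i j) -> R)) ->
  (forall w, 0 <= g w) -> (forall j w, 0 <= b j w) ->
  (\int[P]_w (g w * (win i k b w)%:R)%:E =
   \int[P]_w (g w * lam i k w / ((rest i k w + top w) *
     (1 + lam i k w * (\sum_(j | j != k) b j w) / tot i w)))%:E)%E.
Proof.
move=> mgU mbU mgS mbS g0 b0.
pose g' w := g w * (0 < lam i k w)%R%:R.
pose a j w := lam i j w / lam i k w + b j w.
have mg' c : Source <> c -> Proposal i k <> c ->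
    measurable_fun setT (g : Others c -> R) -> measurable_fun setT (g' : Others c -> R).
  by move=> cX cY mg; have ml := measurable_lam cX cY; rewrite /g'; mfun.
have ma c : Source <> c -> (forall j, Proposal i j <> c) ->
    (forall j, measurable_fun setT (b j : Others c -> R)) ->
    forall j, measurable_fun setT (a j : Others c -> R).
  move=> cX cY mb j; have ml := measurable_lam cX (cY j).
  by have mlk := measurable_lam cX (cY k); rewrite /a; mfun.
have mr c : Source <> c -> (forall j, Proposal i j <> c) ->
    measurable_fun setT (ratio i k : Others c -> R).
  move=> cX cY; have ml j := measurable_lam cX (cY j).
  have mt := measurable_top cX.
  have mre := @measurable_rest c cX i k (fun j _ => cY j).
  by rewrite /ratio /tot; mfun.
transitivity (\int[P]_w (g' w * (U i w <= ratio i k w)%R%:R * (0 <= S i k w)%R%:R *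
      \prod_(j | j != k) (S i k w * a j w < S i j w)%R%:R)%:E)%E.
  apply: eq_integral => w _; congr (_%:E); rewrite prod_natr_bool /win /g'.
  rewrite -!mulnb !natrM; ring.
rewrite (integral_race model)//.
- apply: eq_integral => w _; congr (_%:E); rewrite /g'.
  have [lk|] := ltP 0%R (lam i k w); last first.
    move=> lk; have -> : lam i k w = 0 by apply/eqP; rewrite eq_le lk lam_ge0.
    by rewrite !(mulr0, mul0r).
  rewrite mulr1 -[RHS]mulrA; congr (_ * _).
  rewrite /a big_split/= -mulr_suml -/(rest i k w) /ratio.
  have t0 : 0 < tot i w by rewrite (totE _ k) ltr_wpDr// rest_ge0.
  have B0 : 0 <= \sum_(j | j != k) b j w by rewrite sumr_ge0.
  have re0 := rest_ge0 i k w; have lt := lam_le_top i k w.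
  move: (\sum_(j | j != k) b j w) B0 => B B0.
  have e1 : 0 < lam i k w + rest i k w + lam i k w * B.
    by have := mulr_ge0 (ltW lk) B0; lra.
  have e2 : 0 < rest i k w + top w by rewrite ltr_wpDl// (lt_le_trans lk).
  rewrite (totE _ k) in t0 *.
  field; rewrite !gt_eqF//.
- exact: mg'.
- exact: mr.
- exact: ma.
- by move=> j; exact: mg'.
- by move=> j; exact: mr.
- by move=> j; exact: ma.
- by move=> w; rewrite mulr_ge0.
- by move=> w; exact: ratio01.
- by move=> j w; rewrite addr_ge0// divr_ge0// lam_ge0.
Qed.

Local Open Scope ereal_scope.

Lemma integral_lam i j (g : Omega -> R) :
  measurable_fun setT (g : Others (Proposal i j) -> R) -> (forall w, 0 <= g w)%R ->
  \int[P]_w (g w * lam i j w)%:E = \int[P]_w (g w)%:E.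
Proof.
move=> mg g0.
have mX : measurable_fun setT (X : Others (Proposal i j) -> TX).
  exact: measurable_Others_X.
have mX1 := measurableT_comp mX (@measurable_fst _ _ (Others (Proposal i j)) TY).
have mg1 := measurableT_comp mg (@measurable_fst _ _ (Others (Proposal i j)) TY).
have mw : measurable_fun setT (fun z : Others (Proposal i j) * TY =>
    weight (pYX (X z.1)) q z.2).
  by apply: (measurable_weight mpYX mq mX1); exact: measurable_snd.
pose f (z : Others (Proposal i j) * TY) := (g z.1 * weight (pYX (X z.1)) q z.2)%:E.
have mf : measurable_fun setT f by rewrite /f; mfun.
have f0 z : 0 <= f z.
  by rewrite lee_fin mulr_ge0//; exact: (weight_ge0 densYX' densQ).
rewrite (integral_proposal densQ model mf f0).
apply: eq_integral => w _ /=.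
rewrite -[RHS]mule1 -(integral_weight densYX' bounding (X w)).
have mw' : measurable_fun setT (fun y => weight (pYX (X w)) q y).
  by apply: (measurable_weight mpYX mq (measurable_cst (X w))); exact: measurable_id.
rewrite -ge0_integralZl_EFin//.
- by apply: eq_integral => y _; rewrite EFinM muleCA.
- by move=> y _; rewrite mule_ge0// lee_fin// (weight_ge0 densYX' densQ).
- by mfun.
Qed.

Local Close Scope ereal_scope.

(** A win of [k] determines the candidate, so the events for distinct [k] are disjoint. *)
Lemma sum_win i (b : 'I_n.+1 -> 'I_n.+1 -> Omega -> R) w :
  (forall k j, 0 <= b k j w) ->
  \sum_(k < n.+1) (win i k (b k) w)%:R = [exists k, win i k (b k) w]%:R :> R.
Proof.
move=> b0; have [/existsP[k W]|/existsPn W] := boolP [exists k, win i k (b k) w].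
  rewrite (bigD1 k)//= W big1 ?addr0// => j jk.
  have [Wj|//] := boolP (win i j (b j) w).
  have := win_candidate (b0 j) Wj.
  by rewrite (win_candidate (b0 k) W) => /eqP; rewrite eq_sym (negbTE jk).
by rewrite big1// => k _; rewrite (negbTE (W k)).
Qed.

Local Open Scope ereal_scope.

Let mlam i j : measurable_fun setT (lam i j).
Proof. by apply: (@measurable_weight _ _ _ _ _ _ _ pYX q). Qed.

Let mtop : measurable_fun setT top.
Proof. exact: (measurableT_comp meas_omega). Qed.

Let mrest i k : measurable_fun setT (rest i k).
Proof. by rewrite /rest; mfun. Qed.

Lemma integral_rest i k (G : Omega -> R) :
  (forall j, j != k -> measurable_fun setT (G : Others (Proposal i j) -> R)) ->
  measurable_fun setT G -> (forall w, 0 <= G w)%R ->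
  \int[P]_w (G w * (rest i k w + omega))%:E = (n%:R + omega)%:E * \int[P]_w (G w)%:E.
Proof.
move=> mGj mG G0.
transitivity (\int[P]_w (\sum_(j < n.+1 | j != k) (G w * lam i j w)%:E + (G w * omega)%:E)).
  apply: eq_integral => w _; rewrite sumEFin -EFinD; congr (_%:E).
  by rewrite mulrDr mulr_sumr.
rewrite ge0_integralD//; last 4 first.
- by move=> w _; apply: sume_ge0 => j _; rewrite lee_fin mulr_ge0// lam_ge0.
- by mfun.
- by move=> w _; rewrite lee_fin mulr_ge0.
- by mfun.
under eq_integral do rewrite -big_filter.
rewrite ge0_integral_sum//; last 2 first.
- by move=> j; mfun.
- by move=> j w _; rewrite lee_fin mulr_ge0// lam_ge0.
rewrite (eq_big_seq (fun=> \int[P]_w (G w)%:E)); last first.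
  move=> j; rewrite mem_filter => /andP[jk _].
  by apply: integral_lam => //; exact: mGj.
have I0 : 0 <= \int[P]_w (G w)%:E by apply: integral_ge0 => w _; rewrite lee_fin.
under [X in _ + X]eq_integral do rewrite mulrC EFinM.
rewrite ge0_integralZl_EFin//; last 2 first.
- by move=> w _; rewrite lee_fin.
- by mfun.
rewrite big_filter sumr_const cardC1 card_ord/= EFinD ge0_muleDl ?lee_fin//.
by congr (_ + _); rewrite mule_natl.
Qed.

Lemma measurable_win i k b : (forall j, measurable_fun setT (b j)) ->
  measurable_fun setT (win i k b).
Proof.
move=> mb; have mS j : measurable_fun setT (S i j) by [].
have mU : measurable_fun setT (U i) by [].
rewrite /win; apply: measurable_and; first by mfun.
apply: measurable_and; first by rewrite /ratio /tot; mfun.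
apply: measurable_and; first by mfun.
pose A (f : {ffun 'I_n.+1 -> bool}) := [forall (j | j != k), f j].
rewrite (_ : (fun _ => _) = (fun w => A [ffun j =>
    (S i k w * (lam i j w / lam i k w + b j w) < S i j w)%R])).
  by apply: measurable_finfun_pred => j; mfun.
by apply/funext => w; apply: eq_forallb => j; rewrite ffunE.
Qed.

Lemma measurable_accept i :
  measurable_fun setT (fun w => accepts (pYX (X w)) q (shared w i)).
Proof. exact: measurable_accepts. Qed.

(** [g] will be the indicator that all earlier batches were rejected. The wins with [b = 0] imply
    acceptance; the mean of their denominator is at most [n + omega], hence at most [c = 2 N]
    because [omega <= N], and the N wins contribute [1 / c] each. *)
Lemma accept_half i (g : Omega -> R) :
  measurable_fun setT (g : Others (Defs.Uniform i) -> R) ->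
  (forall j, measurable_fun setT (g : Others (Clock i j) -> R)) ->
  (forall j, measurable_fun setT (g : Others (Proposal i j) -> R)) ->
  (forall w, 0 <= g w <= 1)%R ->
  2^-1%:E * \int[P]_w (g w)%:E <=
  \int[P]_w (g w * (accepts (pYX (X w)) q (shared w i))%:R)%:E.
Proof.
move=> mgU mgS mgY g01.
have g0 w : (0 <= g w)%R by case/andP: (g01 w).
have mg : measurable_fun setT g by exact: measurable_Others (mgY ord0).
pose b := (fun _ _ => 0%R) : 'I_n.+1 -> Omega -> R.
pose c : R := (2 * n.+1%:R)%R.
have c0 : (0 < c)%R by rewrite mulr_gt0.
have If : \int[P]_w (g w)%:E \is a fin_num.
  rewrite ge0_fin_numE ?integral_ge0//; last by move=> w _; rewrite lee_fin.
  apply: (@le_lt_trans _ _ (\int[P]_w 1)).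
    apply: ge0_le_integral => //; first by move=> w _; rewrite lee_fin.
      exact: measurable_EFin.
    by move=> w _; rewrite lee_fin; case/andP: (g01 w).
  rewrite integral_cst// mul1e; exact: (le_lt_trans (probability_le1 P measurableT) (ltry 1)).
have step k : c^-1%:E * \int[P]_w (g w)%:E <= \int[P]_w (g w * (win i k b w)%:R)%:E.
  rewrite integral_win//; last 2 first.
  - by move=> j; exact: measurable_cst.
  - by move=> j j'; exact: measurable_cst.
  have -> : \int[P]_w (g w * lam i k w / ((rest i k w + top w) *
      (1 + lam i k w * (\sum_(j | j != k) b j w) / tot i w)))%:E =
      \int[P]_w (g w * lam i k w / (rest i k w + top w))%:E.
    by apply: eq_integral => w _; rewrite big1// mulr0 mul0r addr0 mulr1.
  have gl0 w : (0 <= g w * lam i k w)%R by rewrite mulr_ge0// lam_ge0.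
  have e1 : \int[P]_w (g w * lam i k w / c)%:E = c^-1%:E * \int[P]_w (g w)%:E.
    under eq_integral do rewrite mulrC EFinM.
    rewrite ge0_integralZl_EFin//; last 3 first.
    - by move=> w _; rewrite lee_fin.
    - by mfun.
    - by rewrite invr_ge0 ltW.
    by rewrite integral_lam.
  rewrite -e1; apply: (@integral_div_ge _ _ _ P
      (fun w => g w * lam i k w)%R (fun w => rest i k w + top w)%R (fun=> c)) => //.
  - by mfun.
  - by mfun.
  - move=> w; rewrite mulf_eq0 negb_or => /andP[_ lk].
    rewrite ltr_wpDl ?rest_ge0// (lt_le_trans _ (lam_le_top i k w))//.
    by rewrite lt_neqAle eq_sym lk lam_ge0.
  - by move=> w; rewrite addr_ge0 ?rest_ge0// (le_trans (lam_ge0 i k w))// lam_le_top.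
  - by rewrite e1 -(fineK If) -EFinM ltry.
  have gc0 w : (0 <= g w / c ^+ 2)%R by rewrite divr_ge0// exprn_ge0// ltW.
  apply: (@le_trans _ _ (\int[P]_w (g w / c ^+ 2 * lam i k w * (rest i k w + omega))%:E)).
    apply: ge0_le_integral => //.
    - move=> w _; rewrite lee_fin mulr_ge0// ?divr_ge0 ?exprn_ge0// ?(ltW c0)//.
      by rewrite addr_ge0 ?rest_ge0// (le_trans (lam_ge0 i k w))// lam_le_top.
    - by mfun.
    - by mfun.
    move=> w _; rewrite lee_fin [X in (X * _ <= _)%R]mulrAC ler_wpM2l ?lerD2l ?top_le//.
    by rewrite mulr_ge0// lam_ge0.
  rewrite integral_rest; last 3 first.
  - move=> j jk; apply: measurable_funM; first by mfun.
    by apply: measurable_lam => // -[kj]; rewrite kj eqxx in jk.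
  - by mfun.
  - by move=> w; rewrite mulr_ge0// lam_ge0.
  rewrite integral_lam//; last by mfun.
  rewrite e1; under eq_integral do rewrite mulrC EFinM.
  rewrite ge0_integralZl_EFin//; last 3 first.
  - by move=> w _; rewrite lee_fin.
  - by mfun.
  - by rewrite invr_ge0 exprn_ge0// ltW.
  rewrite muleA -EFinM lee_wpmul2r//; first by rewrite integral_ge0// => w _; rewrite lee_fin.
  rewrite lee_fin ler_pdivrMr ?exprn_gt0// expr2 mulrA mulVf ?gt_eqF// mul1r.
  by rewrite /c; move: omega_le; rewrite -natr1; lra.
apply: (@le_trans _ _ (\sum_(k < n.+1) \int[P]_w (g w * (win i k b w)%:R)%:E)).
  apply: (@le_trans _ _ (\sum_(k < n.+1) (c^-1%:E * \int[P]_w (g w)%:E))).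
    rewrite (_ : \sum_(k < n.+1) _ = n.+1%:R%:E * (c^-1%:E * \int[P]_w (g w)%:E)); last first.
      by rewrite sumr_const card_ord mule_natl.
    rewrite muleA -EFinM lee_wpmul2r//.
      by rewrite integral_ge0// => w _; rewrite lee_fin.
    by rewrite lee_fin /c invfM mulrCA divff ?mulr1// pnatr_eq0.
  by apply: lee_sum => k _; exact: step.
rewrite -ge0_integral_sum//; last 2 first.
- by move=> k; apply: measurable_EFin; apply: measurable_funM => //;
    apply: measurable_fun_natr_bool; apply: measurable_win => j; exact: measurable_cst.
- by move=> k w _; rewrite lee_fin mulr_ge0.
apply: ge0_le_integral => //.
- by move=> w _; apply: sume_ge0 => k _; rewrite lee_fin mulr_ge0.
- by apply: measurable_fun_sume => k _; apply: measurable_EFin;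
    apply: measurable_funM => //; apply: measurable_fun_natr_bool; apply: measurable_win => j; exact: measurable_cst.
- apply: measurable_EFin; apply: measurable_funM => //.
  apply: measurable_fun_natr_bool; exact: measurable_accept.
move=> w _; rewrite sumEFin lee_fin -mulr_sumr ler_wpM2l//.
rewrite (sum_win _ (b := fun=> b))// ler_nat.
by case: existsP => // -[k /win_accepts ->].
Qed.

(** * The index of the first accepted batch *)

Fixpoint rejected i w : bool :=
  if i is i'.+1 then rejected i' w && ~~ accepts (pYX (X w)) q (shared w i')
  else true.

Lemma measurable_Others_rejected c i : Source <> c ->
  (forall i', (i' < i)%N -> Defs.Uniform i' <> c) ->
  (forall i' k, (i' < i)%N -> Proposal i' k <> c) ->
  (forall i' k, (i' < i)%N -> Clock i' k <> c) ->
  measurable_fun setT (rejected i : Others c -> bool).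
Proof.
move=> cX; elim: i => [|i IH] cU cY cS; first exact: measurable_cst.
rewrite /=; apply: measurable_and.
  by apply: IH => [i' i'i|i' k i'i|i' k i'i]; [apply: cU|apply: cY|apply: cS];
    rewrite ltnS ltnW.
apply: measurable_neg.
apply: (@measurable_accepts _ _ _ _ (Others c) _ _ _ pYX q mpYX mq X (fun w => shared w i)).
- exact: measurable_Others_X.
- by apply: measurable_Others_U; exact: cU.
- by move=> k; apply: measurable_Others_Y; exact: cY.
- by move=> k; apply: measurable_Others_S; exact: cS.
- exact: measurable_top.
Qed.

Lemma measurable_rejected i : measurable_fun setT (rejected i).
Proof.
elim: i => [|i IH]; first exact: measurable_cst.
by apply: measurable_and => //; apply: measurable_neg; exact: measurable_accept.
Qed.

Lemma integral_rejected_le i : \int[P]_w (rejected i w)%:R%:E <= (2^-1 ^+ i)%:E.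
Proof.
have mr j : measurable_fun setT (fun w => (rejected j w)%:R : R).
  by apply: measurable_fun_natr_bool; exact: measurable_rejected.
elim: i => [|i IH].
  rewrite -[X in X <= _]/(\int[P]_w (cst 1 w)) integral_cst// mul1e expr0.
  exact: (probability_le1 P measurableT).
have h : \int[P]_w (rejected i.+1 w)%:R%:E +
    \int[P]_w ((rejected i w)%:R * (accepts (pYX (X w)) q (shared w i))%:R)%:E =
    \int[P]_w (rejected i w)%:R%:E.
  rewrite -ge0_integralD//.
  - apply: eq_integral => w _ /=; rewrite -EFinD; congr (_%:E).
    by case: rejected; case: accepts; rewrite /= ?mul0r ?mulr0 ?mulr1 ?addr0 ?add0r.
  - exact: measurable_EFin.
  - apply: measurable_EFin; apply: measurable_funM => //.
    by apply: measurable_fun_natr_bool; exact: measurable_accept.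
have half : 2^-1%:E * \int[P]_w (rejected i w)%:R%:E <=
    \int[P]_w ((rejected i w)%:R * (accepts (pYX (X w)) q (shared w i))%:R)%:E.
  apply: accept_half.
  - apply: measurable_fun_natr_bool; apply: measurable_Others_rejected => //.
    by move=> i' i'i [] e; rewrite e ltnn in i'i.
  - move=> j; apply: measurable_fun_natr_bool; apply: measurable_Others_rejected => //.
    by move=> i' k i'i [] e; rewrite e ltnn in i'i.
  - move=> j; apply: measurable_fun_natr_bool; apply: measurable_Others_rejected => //.
    by move=> i' k i'i [] e; rewrite e ltnn in i'i.
  - by move=> w; case: rejected; rewrite ?lexx ?ler01.
have nonneg (g : Omega -> R) : (forall w, 0 <= g w)%R -> 0 <= \int[P]_w (g w)%:E.
  by move=> g0; apply: integral_ge0 => w _; rewrite lee_fin.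
have r0 := nonneg (fun w => (rejected i w)%:R) (fun w => ler0n _ _).
have s0 := nonneg (fun w => (rejected i.+1 w)%:R) (fun w => ler0n _ _).
move: h half IH r0 s0.
case: (\int[P]_w (rejected i w)%:R%:E) => [z| |]//.
case: (\int[P]_w (rejected i.+1 w)%:R%:E) => [x| |]//; case: (integral _ _ _) => [y| |]//.
by rewrite -EFinD -EFinM !lee_fin exprS => -[]; lra.
Qed.

Notation first := (fun w => first_accepted (pYX (X w)) q (shared w)).

Lemma rejectedP i w : reflect
  (forall j, (j < i)%N -> ~~ accepts (pYX (X w)) q (shared w j)) (rejected i w).
Proof.
apply: (iffP idP); elim: i => [|i IH]//=.
  move=> /andP[/IH r a] j; rewrite ltnS leq_eqVlt => /predU1P[->//|]; exact: r.
move=> h; rewrite h// andbT IH// => j ji; apply: h; exact: ltnW.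
Qed.

Lemma first_accepted_rejected w : rejected (first w) w.
Proof. by rewrite /first_accepted; case: xgetP => [i _ [_ /rejectedP]|]. Qed.

Lemma first_accepted_eq i w : accepts (pYX (X w)) q (shared w i) ->
  rejected i w -> first w = i.
Proof.
move=> ai /rejectedP ri; rewrite /first_accepted; case: xgetP => [j _ [aj rj]|].
  case: (ltngtP i j) => // ij; first by have := rj _ ij; rewrite ai.
  by have := ri _ ij; rewrite aj.
by move=> /(_ i) []; split.
Qed.

Lemma measurable_first : measurable_fun setT first.
Proof.
have macc i : measurable_fun setT (fun w => accepts (pYX (X w)) q (shared w i)).
  exact: measurable_accept.
have mset (f : Omega -> bool) : measurable_fun setT f -> measurable [set w | f w].
  by move=> mf; have := mf measurableT [set true] I; rewrite setTI.
have mi i : measurable [set w | accepts (pYX (X w)) q (shared w i) && rejected i w].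
  by apply: mset; apply: measurable_and => //; exact: measurable_rejected.
have mnever : measurable (\bigcap_i [set w | ~~ accepts (pYX (X w)) q (shared w i)]).
  by apply: bigcapT_measurable => i; apply: mset; exact: measurable_neg.
(* The index 0 is also the default when no batch is accepted, so that event has to be added when [B]
   contains 0. *)
move=> _ B _; rewrite setTI (_ : _ @^-1` B =
    \bigcup_(i in B) [set w | accepts (pYX (X w)) q (shared w i) && rejected i w] `|`
    [set w | B 0%N /\ (\bigcap_i [set w | ~~ accepts (pYX (X w)) q (shared w i)]) w]).
  apply: measurableU; first exact: bigcup_measurable.
  have [B0|B0] := pselect (B 0%N).
    by rewrite (_ : [set w | _] = \bigcap_i [set w | ~~ accepts (pYX (X w)) q (shared w i)])//;
      apply/seteqP; split => w //= [].
  by rewrite (_ : [set w | _] = set0)//; apply/seteqP; split => w //= [].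
apply/seteqP; split => w /=.
  move=> Bw; have [[i ai]|na] := pselect (exists i, accepts (pYX (X w)) q (shared w i)).
    left; exists (first w) => //=; rewrite first_accepted_rejected andbT.
    have ex : exists i, accepts (pYX (X w)) q (shared w i) by exists i.
    have am := ex_minnP ex; case: am => m am mmin.
    rewrite (@first_accepted_eq m)//; apply/rejectedP => j jm.
    by apply/negP => /mmin; rewrite leqNgt jm.
  right; have nacc i : ~~ accepts (pYX (X w)) q (shared w i).
    by apply/negP => ai; apply: na; exists i.
  split; last by move=> i _; exact: nacc.
  move: Bw; rewrite /first_accepted; case: xgetP => // i _ [ai].
  by rewrite (negbTE (nacc i)) in ai.
move=> [[i Bi /andP[ai ri]]|[B0 na]]; first by rewrite (first_accepted_eq ai ri).
rewrite /first_accepted; case: xgetP => // i _ [ai _].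
by have := na i I; rewrite /= ai.
Qed.

Lemma integral_first_le1 : \int[P]_w (first w)%:R%:E <= 1.
Proof.
have mr j : measurable_fun setT (fun w => (rejected j w)%:R%:E : \bar R).
  by apply: measurable_EFin; apply: measurable_fun_natr_bool; exact: measurable_rejected.
(* Layer-cake bound: every [i < first w] satisfies [rejected i.+1 w]. This remains true if no batch
   is accepted, [first w] being 0 then. The geometric tails add up to 1. *)
apply: (@le_trans _ _ (\int[P]_w (\sum_(i <oo) (rejected i.+1 w)%:R%:E))).
  apply: ge0_le_integral => //.
  - have mnat : measurable_fun [set: nat] (fun m => m%:R : R) by [].
    exact: (measurable_EFin (measurableT_comp mnat measurable_first)).
  - by apply: ge0_emeasurable_sum => // i _; exact: mr.
  move=> w _; apply: le_trans (nneseries_lim_ge (first w) _); last first.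
    by move=> i _ _; rewrite lee_fin.
  rewrite big_mkord (eq_bigr (fun=> 1)).
    by rewrite sumr_const card_ord /= -[X in _ <= X]mule_natl mule1.
  move=> i _; have /rejectedP := first_accepted_rejected w.
  move=> h; have -> // : rejected i.+1 w.
  by apply/rejectedP => j ji; apply: h; rewrite (leq_trans ji).
rewrite integral_nneseries//.
apply: (@le_trans _ _ (\sum_(i <oo) (2^-1 ^+ i.+1)%:E)).
  by apply: lee_nneseries => // i _ ; [rewrite integral_ge0|exact: integral_rejected_le].
have /cvg_lim := @cvg_geometric_eseries_half R 1%R 0.
rewrite expr0 divr1 => <- //; rewrite le_eqVlt; apply/orP; left; apply/eqP.
by congr (limn _); apply/funext => m; apply: eq_bigr => i _;
  rewrite addn1 natrX -exprVn mul1r.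
Qed.

Lemma expected_length (c : nat -> seq bool) :
  (forall k, (size (c k) <= k.*2.+1)%N) ->
  \int[P]_w (size (c (first w)))%:R%:E <= 3%:E.
Proof.
move=> hc; have mfirst (T := R) (h : nat -> R) :
    measurable_fun setT (fun w => (h (first w))%:E).
  have mh : measurable_fun [set: nat] h by [].
  exact: (measurable_EFin (measurableT_comp mh measurable_first)).
apply: (@le_trans _ _ (\int[P]_w (2%:E * (first w)%:R%:E + cst 1 w))).
  apply: ge0_le_integral => //.
  - exact: (mfirst (fun k => (size (c k))%:R)%R).
  - by apply: emeasurable_funD => //; apply: emeasurable_funM => //;
      exact: (mfirst (fun k => k%:R)%R).
  move=> w _ /=; rewrite -EFinM -EFinD lee_fin.
  by apply: (@le_trans _ _ (first w).*2.+1%:R); rewrite ?ler_nat// -natr1 -muln2 natrM mulrC.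
rewrite ge0_integralD//; last first.
  by apply: emeasurable_funM => //; exact: (mfirst (fun k => k%:R)%R).
rewrite integral_cst// mul1e ge0_integralZl_EFin//.
rewrite (_ : 3%:E = 2%:E * 1 + 1); last by rewrite mule1 -EFinD; congr (_%:E); lra.
apply: leeD; last exact: (probability_le1 P measurableT).
by rewrite lee_wpmul2l// integral_first_le1.
Qed.

Local Close Scope ereal_scope.

(** * The decoder's race in the first batch *)

Notation p' := (cond_YX' muX muY pX pX'X pYX).

Definition dlam j w := weight (p' (X' w)) q (Y 0 j w).

(** A rival whose hash differs from that of [k] is discarded by the decoder and adds no speed. The
    quotient is meaningful for [0 < dlam k w] only, a condition that [good] includes. *)
Definition slow k j w : R := (H 0 j w == H 0 k w)%:R * (dlam j w / dlam k w).

Definition good k w : bool := (0 < dlam k w) && win 0 k (slow k) w.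

Let p'0 x' y : 0 <= p' x' y.
Proof. exact: (cond_YX'_ge0 densX densX'X densYX). Qed.

Lemma dlam_ge0 j w : 0 <= dlam j w.
Proof. by rewrite /dlam /weight divr_ge0. Qed.

Lemma slow_ge0 k j w : 0 <= slow k j w.
Proof. by rewrite mulr_ge0// divr_ge0 ?dlam_ge0. Qed.

Lemma dlam_le j w : dlam j w <= omega.
Proof.
rewrite /dlam /weight; have [->|qy] := eqVneq (q (Y 0 j w)) 0.
  by rewrite invr0 mulr0.
have q1 : 0 < q (Y 0 j w) by rewrite lt_neqAle eq_sym qy q0.
by rewrite ler_pdivrMr// (cond_YX'_le densX densX'X densYX densQ).
Qed.

Lemma good_match k w : good k w ->
  ~ mismatch muX muY pX pX'X q X X' U Y H S pYX w.
Proof.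
move=> /andP[dk W].
have acc : accepts (pYX (X w)) q (shared w 0%N).
  exact: win_accepts (slow_ge0 k ^~ w) W.
have cand := win_candidate (slow_ge0 k ^~ w) W.
have f0 : first w = 0%N by exact: first_accepted_eq.
have KA : K_A q X U Y H S pYX w = (0%N, k) by rewrite /K_A /encoder_select f0 cand.
have KB : K_B muX muY pX pX'X q X X' U Y H S pYX w = (0%N, k).
  rewrite /K_B /decoder_select /message /encoder_message /encoder_select f0 cand /=.
  congr pair; apply: arg_min_unique => // j /eqP Hj jk.
  have /and4P[lk _ Sk /forallP/(_ j)] := W; rewrite jk /= => Sj.
  (* The inequality of [win] serves a second time, the encoder's ratio now being the slack. *)
  apply: (@race_lt _ _ _ _ _ _ _ _ (lam 0 j w / lam 0 k w + slow k j w)) => //.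
    by move=> y; rewrite /weight divr_ge0.
  rewrite /slow Hj eqxx mul1r lerDr divr_ge0 ?lam_ge0//.
by rewrite /mismatch /= KA KB.
Qed.

Section measurable_dlam.
Variables (c : component n) (cX : Source <> c).

Lemma measurable_dlam j : Proposal 0 j <> c ->
  measurable_fun setT (dlam j : Others c -> R).
Proof.
move=> cY; apply: (@measurable_weight _ _ _ _ (Others c) _ _ p' q) => //.
- exact: (measurable_cond_YX' densX densX'X densYX).
- exact: measurable_Others_X'.
- exact: measurable_Others_Y.
Qed.

End measurable_dlam.

Let mdlam j : measurable_fun setT (dlam j).
Proof.
apply: (@measurable_weight _ _ _ _ _ _ _ p' q) => //.
exact: (measurable_cond_YX' densX densX'X densYX).
Qed.

Local Open Scope ereal_scope.

Lemma integral_dlam j (g : Omega -> R) :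
  measurable_fun setT (g : Others (Proposal 0 j) -> R) -> (forall w, 0 <= g w)%R ->
  \int[P]_w (g w * dlam j w)%:E <= \int[P]_w (g w)%:E.
Proof.
move=> mg g0.
have mp' := measurable_cond_YX' densX densX'X densYX.
have mX' : measurable_fun setT (X' : Others (Proposal 0 j) -> TX').
  exact: measurable_Others_X'.
have mX1 := measurableT_comp mX' (@measurable_fst _ _ (Others (Proposal 0 j)) TY).
have mg1 := measurableT_comp mg (@measurable_fst _ _ (Others (Proposal 0 j)) TY).
have mw : measurable_fun setT (fun z : Others (Proposal 0 j) * TY =>
    weight (p' (X' z.1)) q z.2).
  by apply: (measurable_weight mp' mq mX1); exact: measurable_snd.
pose f (z : Others (Proposal 0 j) * TY) := (g z.1 * weight (p' (X' z.1)) q z.2)%:E.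
have mf : measurable_fun setT f by rewrite /f; mfun.
have w0 x' y : (0 <= weight (p' x') q y)%R by rewrite /weight divr_ge0.
have f0 z : 0 <= f z by rewrite lee_fin mulr_ge0.
rewrite (integral_proposal densQ model mf f0).
apply: ge0_le_integral => //.
- by move=> w _; apply: integral_ge0 => y _; rewrite mule_ge0// lee_fin.
- exact: (measurable_integral_proposal densQ mf f0).
- by apply: measurable_EFin; exact: measurable_Others mg.
move=> w _; rewrite -[leRHS]mule1.
have mw' : measurable_fun setT (fun y => weight (p' (X' w)) q y).
  by apply: (measurable_weight mp' mq (measurable_cst (X' w))); exact: measurable_id.
have mp'' : measurable_fun setT (fun y => (p' (X' w) y)%:E).
  by apply: measurable_EFin; exact: (measurable_fun_pair2 (X' w) mp').
apply: (@le_trans _ _ ((g w)%:E * \int[muY]_y (p' (X' w) y)%:E)); last first.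
  by rewrite lee_wpmul2l ?lee_fin// (integral_cond_YX'_le1 densX densX'X densYX).
rewrite -ge0_integralZl_EFin//; last by move=> y _; rewrite lee_fin.
apply: ge0_le_integral => //.
- by move=> y _; rewrite mule_ge0// lee_fin.
- by rewrite /f/=; mfun.
- by apply: emeasurable_funM.
move=> y _; rewrite /f/= -!EFinM lee_fin mulrCA ler_wpM2l// /weight.
have [->|qy] := eqVneq (q y) 0%R; first by rewrite mul0r.
by rewrite mulrC divfK.
Qed.

Lemma integral_lamV j (g : Omega -> R) (K : R) :
  (forall x, d2 muY q (pYX x) <= K%:E) ->
  measurable_fun setT (g : Others (Proposal 0 j) -> R) -> (forall w, 0 <= g w)%R ->
  \int[P]_w ((g w)%:E * (lam 0 j w)%:E^-1) <= K%:E * \int[P]_w (g w)%:E.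
Proof.
move=> hK mg g0.
have mX : measurable_fun setT (X : Others (Proposal 0 j) -> TX).
  exact: measurable_Others_X.
have mX1 := measurableT_comp mX (@measurable_fst _ _ (Others (Proposal 0 j)) TY).
have mg1 := measurableT_comp mg (@measurable_fst _ _ (Others (Proposal 0 j)) TY).
have mw : measurable_fun setT (fun z : Others (Proposal 0 j) * TY =>
    (weight (pYX (X z.1)) q z.2)%:E^-1).
  apply: (measurableT_comp (@measurable_inve R)); apply: measurable_EFin.
  by apply: (measurable_weight mpYX mq mX1); exact: measurable_snd.
pose f (z : Others (Proposal 0 j) * TY) :=
  (g z.1)%:E * (weight (pYX (X z.1)) q z.2)%:E^-1.
have mf : measurable_fun setT f by rewrite /f; mfun.
have w0 x y : 0 <= (weight (pYX x) q y)%:E^-1.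
  by rewrite inve_ge0 lee_fin (weight_ge0 densYX' densQ).
have f0 z : 0 <= f z by rewrite mule_ge0// lee_fin.
rewrite (integral_proposal densQ model mf f0).
have K0 : (0 <= K)%R.
  rewrite -lee_fin; apply: le_trans (hK (X point)).
  by rewrite -(integral_weightV pYX densQ) integral_ge0// => y _;
    rewrite mule_ge0// lee_fin.
rewrite -ge0_integralZl_EFin//; last 2 first.
- by move=> w _; rewrite lee_fin.
- by apply: measurable_EFin; exact: measurable_Others mg.
apply: ge0_le_integral => //.
- by move=> w _; apply: integral_ge0 => y _; rewrite mule_ge0// lee_fin.
- exact: (measurable_integral_proposal densQ mf f0).
- by apply: emeasurable_funM => //; apply: measurable_EFin; exact: measurable_Others mg.
move=> w _.
have mw' : measurable_fun setT (fun y => (weight (pYX (X w)) q y)%:E^-1).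
  apply: (measurableT_comp (@measurable_inve R)); apply: measurable_EFin.
  by apply: (measurable_weight mpYX mq (measurable_cst (X w))); exact: measurable_id.
rewrite /f/=; under eq_integral do rewrite muleCA.
rewrite ge0_integralZl_EFin//; last 2 first.
- by move=> y _; rewrite mule_ge0// lee_fin.
- by mfun.
rewrite muleC lee_wpmul2r ?lee_fin// (integral_weightV pYX densQ).
exact: hK.
Qed.

(** * The mean of the denominator *)

Variables (N0 : nat) (eps : R).
Hypotheses (eps_gt0 : (0 < eps)%R)
  (threshold : is_threshold muY pYX q omega eps N0) (N0_le : (N0 <= n.+1)%N).

Let n_gt0 : (0 < n)%N.
Proof. by case: threshold => N02 _; have := leq_trans N02 N0_le. Qed.

(** [Q] collects positions whose proposals [g] does not involve. The harmonic mean over these m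
    positions gives m^-2 times a sum of m inverse weights, each of mean at most [K]. *)
Lemma integral_tot_le (Q : pred 'I_n.+1) (g : Omega -> R) (K : R) :
  (0 < #|Q|)%N -> (forall x, d2 muY q (pYX x) <= K%:E) ->
  measurable_fun setT g ->
  (forall l, Q l -> measurable_fun setT (g : Others (Proposal 0 l) -> R)) ->
  (forall w, 0 <= g w)%R ->
  \int[P]_w (g w / tot 0 w)%:E <= (K / #|Q|%:R)%:E * \int[P]_w (g w)%:E.
Proof.
move=> Q0 hK mg mgQ g0.
have m0 : (0 < #|Q|%:R :> R)%R by rewrite ltr0n.
have I0 : 0 <= \int[P]_w (g w)%:E by apply: integral_ge0 => w _; rewrite lee_fin.
have minv l : measurable_fun setT (fun w => (lam 0 l w)%:E^-1).
  by apply: (measurableT_comp (@measurable_inve R)); exact: measurable_EFin.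
have v0 l w : 0 <= (lam 0 l w)%:E^-1 by rewrite inve_ge0 lee_fin lam_ge0.
have t0 w : (0 <= tot 0 w)%R by apply: sumr_ge0 => l _; exact: lam_ge0.
have mtot : measurable_fun setT (tot 0) by rewrite /tot; mfun.
apply: (@le_trans _ _ (\int[P]_w ((#|Q|%:R ^- 2)%:E *
    \sum_(l | Q l) ((g w)%:E * (lam 0 l w)%:E^-1)))).
  apply: ge0_le_integral => //.
  - by move=> w _; rewrite lee_fin divr_ge0.
  - by mfun.
  - by mfun.
  move=> w _; rewrite -ge0_sume_distrr//.
  rewrite EFinM muleCA lee_wpmul2l ?lee_fin//.
  apply: (inv_sum_le (l := fun l => lam 0 l w)) => //.
    by move=> l; exact: lam_ge0.
  rewrite /tot [leRHS](bigID Q)/= lerDl; apply: sumr_ge0 => l _; exact: lam_ge0.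
have sg0 w : 0 <= \sum_(l | Q l) ((g w)%:E * (lam 0 l w)%:E^-1).
  by apply: sume_ge0 => l _; rewrite mule_ge0// lee_fin.
have msg : measurable_fun setT (fun w => \sum_(l | Q l) ((g w)%:E * (lam 0 l w)%:E^-1)).
  by mfun.
have iQ0 : (0 <= #|Q|%:R ^- 2 :> R)%R by rewrite invr_ge0 exprn_ge0.
rewrite ge0_integralZl_EFin//.
under eq_integral do rewrite -big_filter.
rewrite ge0_integral_sum//; last 2 first.
- by move=> l; mfun.
- by move=> l w _; rewrite mule_ge0// lee_fin.
rewrite big_filter.
apply: (@le_trans _ _ ((#|Q|%:R ^- 2)%:E *
    \sum_(l | Q l) (K%:E * \int[P]_w (g w)%:E))).
  rewrite lee_wpmul2l ?lee_fin ?invr_ge0 ?exprn_ge0//.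
  by apply: lee_sum => l Ql; apply: integral_lamV => //; exact: mgQ.
rewrite (_ : \sum_(l | Q l) _ = #|Q|%:R%:E * (K%:E * \int[P]_w (g w)%:E)); last first.
  by rewrite sumr_const mule_natl.
rewrite !muleA -!EFinM (_ : _ * _ * _ = K / #|Q|%:R)%R//.
by field; rewrite gt_eqF.
Qed.

Lemma kappa_exists : exists kappa : R, [/\ (0 <= kappa)%R,
  (n%:R * (1 + omega * kappa) <= n.+1%:R * (1 + eps))%R &
  forall j k (g : Omega -> R), j != k -> measurable_fun setT g ->
    (forall l, l != k -> measurable_fun setT (g : Others (Proposal 0 l) -> R)) ->
    (forall w, 0 <= g w)%R ->
    \int[P]_w (g w * dlam j w / tot 0 w)%:E <= kappa%:E * \int[P]_w (g w)%:E].
Proof.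
have [N02 thr] := threshold.
have om0 : (0 < omega)%R by exact: lt_le_trans ltr01 omega_ge1.
have mtot : measurable_fun setT (tot 0) by rewrite /tot; mfun.
have t0 w : (0 <= tot 0 w)%R by apply: sumr_ge0 => l _; exact: lam_ge0.
have d2le (a : R) : (0 < a)%R -> (omega / n.+1%:R * indicator_N n.+1 omega = a)%R ->
    forall x, d2 muY q (pYX x) <= (eps / a)%:E.
  move=> a0 ea x; have [_] := thr _ N0_le x; rewrite ea => h.
  by rewrite EFinM lee_pdivlMr// muleC.
have [n1|n1] := eqVneq n 1%N.
  have hK : forall x, d2 muY q (pYX x) <= (eps / (omega ^+ 2 / 2))%:E.
    apply: d2le; first by rewrite divr_gt0// exprn_gt0.
    by rewrite /indicator_N n1 /= mulr0 add0r mulr1; field.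
  (* For N = 2 only position j is left, so m_j is sacrificed to its bound [omega]. This second
     factor [omega] is the one that [indicator_N] provides. *)
  exists (omega * (eps / (omega ^+ 2 / 2)))%R; split.
  - by rewrite mulr_ge0// divr_ge0 ?(ltW eps_gt0)// divr_ge0// exprn_ge0.
  - rewrite n1 (_ : omega * (omega * _) = 2 * eps)%R; last by field; lra.
    by rewrite -[2%:R]/(2%R : R); lra.
  move=> j k g jk mg mgk g0.
  apply: (@le_trans _ _ (\int[P]_w (g w * omega / tot 0 w)%:E)).
    apply: ge0_le_integral => //.
    - by move=> w _; rewrite lee_fin divr_ge0// mulr_ge0// dlam_ge0.
    - by mfun.
    - by mfun.
    by move=> w _; rewrite lee_fin ler_wpM2r ?invr_ge0// ler_wpM2l// dlam_le.
  have gom0 w : (0 <= g w * omega)%R by rewrite mulr_ge0.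
  apply: le_trans (integral_tot_le (Q := pred1 j) _ hK _ _ gom0) _.
  - by rewrite card1.
  - by mfun.
  - by move=> l /eqP ->; have := mgk _ jk => mgj; mfun.
  rewrite card1 divr1; under eq_integral do rewrite mulrC EFinM.
  rewrite ge0_integralZl_EFin//; last 2 first.
  - by move=> w _; rewrite lee_fin.
  - by mfun.
  by rewrite muleA -EFinM mulrC.
have n2 : (1 < n)%N by rewrite ltn_neqAle eq_sym n1.
have hK : forall x, d2 muY q (pYX x) <= (eps / (2 * omega / n.+1%:R))%:E.
  apply: d2le; first by rewrite divr_gt0// mulr_gt0.
  rewrite /indicator_N ltnS n2 eqSS (negbTE n1) /= mulr0 addr0 mulr1; ring.
have m0 : (0 < n.-1%:R :> R)%R by rewrite ltr0n -ltnS prednK.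
(* For N > 2 the harmonic mean runs over the N - 2 positions other than j and k. The resulting
   factor (N - 1) / (N - 2) is at most 2, and the 2 of [indicator_N] compensates for it. *)
exists ((eps / (2 * omega / n.+1%:R)) / n.-1%:R)%R; split.
- by rewrite !divr_ge0 ?mulr_ge0// ltW.
- rewrite (_ : omega * _ = eps * n.+1%:R / (2 * n.-1%:R))%R; last first.
    by field; rewrite !gt_eqF// ?ltr0n.
  have -> : (n.+1%:R = n.-1%:R + 2 :> R)%R by rewrite -natrD addn2 prednK.
  have -> : (n%:R = n.-1%:R + 1 :> R)%R by rewrite natr1 prednK.
  have m1 : (1 <= n.-1%:R :> R)%R by rewrite ler1n -ltnS prednK.
  move: (n.-1%:R : R) m1 => m m1.
  have e0 := eps_gt0; have m0' : (0 < m)%R by exact: lt_le_trans ltr01 m1.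
  rewrite -subr_ge0 (_ : _ - _ = 1 + eps * (m + 2) * (m - 1) / (2 * m))%R; last first.
    by field; rewrite gt_eqF.
  apply: addr_ge0 => //; apply: divr_ge0; last by rewrite mulr_ge0// ltW.
  apply: mulr_ge0; last by rewrite subr_ge0.
  by apply: mulr_ge0; [exact: ltW|rewrite addr_ge0// ltW].
move=> j k g jk mg mgk g0.
pose Q := [pred l : 'I_n.+1 | (l != j) && (l != k)].
have cQ : #|Q| = n.-1.
  have := cardC (pred2 j k); rewrite card2 jk card_ord => e.
  rewrite (_ : #|Q| = #|predC (pred2 j k)|); last first.
    by apply: eq_card => l; rewrite !inE negb_or.
  by move: e => /= /(congr1 (subn^~ 2%N)); rewrite addKn => ->; rewrite subSS subn1.
have gd0 w : (0 <= g w * dlam j w)%R by rewrite mulr_ge0// dlam_ge0.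
apply: le_trans (integral_tot_le (Q := Q) _ hK _ _ gd0) _.
- by rewrite cQ -ltnS prednK.
- by mfun.
- move=> l /andP[lj lk]; have mgl := mgk _ lk.
  have mdl : measurable_fun setT (dlam j : Others (Proposal 0 l) -> R).
    by apply: measurable_dlam => // -[e]; rewrite e eqxx in lj.
  by mfun.
rewrite cQ lee_wpmul2l ?integral_dlam//; last exact: mgk.
by rewrite lee_fin !divr_ge0 ?mulr_ge0// ltW.
Qed.

(* Dominates the mean, given [X], [X'] and [Y 0 k], of the denominator in
   [integral_win]. *)
Definition bound k w : R :=
  (n.+1%:R * (1 + eps) * (1 + V%:R^-1 * (lam 0 k w / dlam k w)))%R.

Let bound_gt0 k w : (0 < bound k w)%R.
Proof.
have r0 : (0 <= V%:R^-1 * (lam 0 k w / dlam k w))%R.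
  by rewrite mulr_ge0// divr_ge0 ?lam_ge0 ?dlam_ge0.
rewrite /bound; apply: mulr_gt0; last exact: ltr_pwDl.
by rewrite mulr_gt0// addr_gt0.
Qed.

Lemma batch_size_le : (n%:R + omega <= n.+1%:R * (1 + eps))%R.
Proof.
have [_ /(_ _ N0_le)] := threshold; move=> /(_ point)[+ _].
by rewrite ler_pdivrMr// mulrDr mulr1 -natr1 => h; have o1 := omega_ge1; lra.
Qed.

(** As [rest + top <= tot + omega], the quotient by [tot] is at most [1 + omega / tot]. What results
    is a sum in which each rival [j] has its own term, with one hash comparison as a factor, so that
    the mean can be taken term by term. *)
Lemma denominator_le k w :
  ((rest 0 k w + top w) * (1 + lam 0 k w * (\sum_(j | j != k) slow k j w) / tot 0 w) <=
   rest 0 k w + omega + \sum_(j < n.+1 | j != k)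
     lam 0 k w / dlam k w * dlam j w * (1 + omega / tot 0 w) * (H 0 j w == H 0 k w)%:R)%R.
Proof.
have -> : (lam 0 k w * (\sum_(j | j != k) slow k j w) = \sum_(j < n.+1 | j != k)
    lam 0 k w / dlam k w * dlam j w * (H 0 j w == H 0 k w)%:R)%R.
  by rewrite mulr_sumr; apply: eq_bigr => j _; rewrite /slow; ring.
rewrite [in leRHS](eq_bigr (fun j => lam 0 k w / dlam k w * dlam j w * (H 0 j w == H 0 k w)%:R *
  (1 + omega / tot 0 w))%R); last by move=> j _; ring.
rewrite -mulr_suml; set s := (\sum_(j | _) _)%R.
have s0 : (0 <= s)%R.
  apply: sumr_ge0 => j _; apply: mulr_ge0 => //; apply: mulr_ge0; last exact: dlam_ge0.
  by apply: divr_ge0; [exact: lam_ge0|exact: dlam_ge0].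
have r0 := rest_ge0 0 k w; have l0 := lam_ge0 0 k w.
rewrite mulrDr mulr1.
 rewrite mulrCA; apply: lerD; first by rewrite lerD2l top_le.
rewrite ler_wpM2l//; have [t0|t0] := eqVneq (tot 0 w) 0%R.
  by rewrite t0 invr0 !mulr0 addr0.
have tp : (0 < tot 0 w)%R by rewrite lt_neqAle eq_sym t0 (totE 0 k) addr_ge0.
rewrite -[X in (_ <= X + _)%R](divff t0) -mulrDl ler_wpM2r ?invr_ge0 ?(ltW tp)//.
by rewrite (totE 0 k) lerD ?top_le// lerDr.
Qed.
Definition hit k w : R := ((0 < dlam k w)%R%:R * lam 0 k w)%R.

Let hit_ge0 k w : (0 <= hit k w)%R.
Proof. by rewrite mulr_ge0// lam_ge0. Qed.

Section measurable_hit.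
Variables (k : 'I_n.+1) (c : component n) (cX : Source <> c) (cY : Proposal 0 k <> c).

Let ml := measurable_lam cX cY.
Let md := measurable_dlam cX cY.

Lemma measurable_hit : measurable_fun setT (hit k : Others c -> R).
Proof. by rewrite /hit; mfun. Qed.

Lemma measurable_bound : measurable_fun setT (bound k : Others c -> R).
Proof. by rewrite /bound; mfun. Qed.

Lemma measurable_density_ratio :
  measurable_fun setT (fun w : Others c => (lam 0 k w / dlam k w)%R).
Proof. by mfun. Qed.

End measurable_hit.

Lemma measurable_slow k j c : Source <> c -> (forall l, Proposal 0 l <> c) ->
  (forall l, Hash 0 l <> c) -> measurable_fun setT (slow k j : Others c -> R).
Proof.
move=> cX cY cH; have md l := measurable_dlam cX (cY l).
have mH l : measurable_fun setT (H 0 l : Others c -> nat).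
  exact: measurable_Others_H.
rewrite /slow; apply: measurable_funM; last by mfun.
by apply: measurable_fun_natr_bool; exact: measurable_fun_eq_nat.
Qed.

Let bound_ge1 k w : (1 <= bound k w)%R.
Proof.
have r0 : (0 <= V%:R^-1 * (lam 0 k w / dlam k w))%R.
  by rewrite mulr_ge0// divr_ge0 ?lam_ge0 ?dlam_ge0.
rewrite /bound; apply: mulr_ege1; last by rewrite lerDl.
by apply: mulr_ege1; rewrite ?ler1n// lerDl ltW.
Qed.

(** Jensen's inequality with [c = bound k]. The weight is [h = hit / bound ^ 2], so domination on
    average means that the integral of [h] times the denominator is at most that of [h * bound],
    which is [hit / bound]. *)
Lemma good_ge k : \int[P]_w (hit k w / bound k w)%:E <= \int[P]_w (good k w)%:R%:E.
Proof.
have [kappa [kappa0 kappa_le Ikappa]] := kappa_exists.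
have n0 : (0 < n.+1%:R :> R)%R by rewrite ltr0n.
have V0 : (0 < V%:R :> R)%R by rewrite ltr0n.
pose g w : R := (0 < dlam k w)%R%:R.
have md c : Source <> c -> Proposal 0 k <> c -> measurable_fun setT (g : Others c -> R).
  by move=> cX cY; have md := measurable_dlam cX cY; rewrite /g; mfun.
rewrite [leRHS](_ : _ = \int[P]_w (g w * (win 0 k (slow k) w)%:R)%:E); last first.
  by apply: eq_integral => w _; rewrite /g -natrM mulnb.
rewrite integral_win//; last 5 first.
- exact: md.
- by move=> j; apply: measurable_slow.
- by move=> j; exact: md.
- by move=> j j'; apply: measurable_slow.
- by move=> j w; exact: slow_ge0.
have mhit : measurable_fun setT (hit k) by rewrite /hit; mfun.
have mbound : measurable_fun setT (bound k) by rewrite /bound; mfun.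
have mtot : measurable_fun setT (tot 0) by rewrite /tot; mfun.
have mH j : measurable_fun setT (H 0 j) by [].
have mslow j : measurable_fun setT (slow k j).
  rewrite /slow; apply: measurable_funM; last by mfun.
  by apply: measurable_fun_natr_bool; exact: measurable_fun_eq_nat.
have t0 w : (0 <= tot 0 w)%R by apply: sumr_ge0 => l _; exact: lam_ge0.
have top0 w : (0 <= top w)%R by exact: le_trans (lam_ge0 0 k w) (lam_le_top 0 k w).
have s0 w : (0 <= \sum_(j | j != k) slow k j w)%R.
  by apply: sumr_ge0 => j _; exact: slow_ge0.
have f0 w : (0 <= lam 0 k w * (\sum_(j | j != k) slow k j w) / tot 0 w)%R.
  by rewrite divr_ge0// mulr_ge0// lam_ge0.
apply: integral_div_ge => //.
- by mfun.
- move=> w; rewrite /hit mulf_eq0 negb_or => /andP[_ l0].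
  apply: mulr_gt0; last by rewrite ltr_pwDl.
  apply: ltr_wpDl; first exact: rest_ge0.
  by apply: lt_le_trans (lam_le_top 0 k w); rewrite lt_neqAle eq_sym l0 lam_ge0.
- by move=> w; rewrite mulr_ge0 ?addr_ge0 ?rest_ge0.
- apply: (@le_lt_trans _ _ (\int[P]_w (1 * lam 0 k w)%:E)).
    apply: ge0_le_integral => //.
    + by move=> w _; rewrite lee_fin divr_ge0 ?hit_ge0 ?(ltW (bound_gt0 k w)).
    + by mfun.
    + by mfun.
    move=> w _; rewrite lee_fin mul1r ler_pdivrMr//.
    apply: (@le_trans _ _ (lam 0 k w)).
      by rewrite /hit ler_piMl ?lam_ge0// lern1 leq_b1.
    by rewrite ler_peMr ?lam_ge0// bound_ge1.
  rewrite (@integral_lam 0%N k (cst 1%R))//.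
  rewrite -[X in X < _]/(\int[P]_w (cst 1 w)) integral_cst// mul1e.
  by apply: le_lt_trans (probability_le1 P measurableT) _; rewrite ltry.
pose h w := (hit k w / bound k w ^+ 2)%R.
pose rho w := (lam 0 k w / dlam k w)%R.
have h0 w : (0 <= h w)%R by rewrite divr_ge0 ?hit_ge0// exprn_ge0// ltW.
have rho0 w : (0 <= rho w)%R by rewrite divr_ge0 ?lam_ge0 ?dlam_ge0.
have mh : measurable_fun setT h.
  by apply: measurable_funM => //; apply: measurable_funV; exact: measurable_funX.
have mrho : measurable_fun setT rho by rewrite /rho; mfun.
have mhc c : Source <> c -> Proposal 0 k <> c -> measurable_fun setT (h : Others c -> R).
  move=> cX cY; have := measurable_bound cX cY; have := measurable_hit cX cY.
  move=> mhc mbc; apply: measurable_funM; first exact: mhc.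
  by apply: measurable_funV; exact: measurable_funX.
have mrhoc c : Source <> c -> Proposal 0 k <> c -> measurable_fun setT (rho : Others c -> R).
  exact: measurable_density_ratio.
have hr0 w : (0 <= h w * rho w)%R by rewrite mulr_ge0.
have hrd0 j w : (0 <= h w * rho w * dlam j w)%R by rewrite mulr_ge0// dlam_ge0.
have ot0 w : (0 <= omega / tot 0 w)%R by rewrite divr_ge0.
have hrt0 j w : (0 <= h w * rho w * dlam j w * (1 + omega / tot 0 w))%R.
  by rewrite mulr_ge0// addr_ge0.
pose F j w := (h w * rho w * dlam j w * (1 + omega / tot 0 w) *
  (H 0 j w == H 0 k w)%:R)%R.
have F0 j w : (0 <= F j w)%R by rewrite mulr_ge0.
have mE j : measurable_fun setT (fun w => H 0 j w == H 0 k w).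
  exact: measurable_fun_eq_nat.
have mF j : measurable_fun setT (F j) by rewrite /F; mfun.
apply: (@le_trans _ _ (\int[P]_w ((h w * (rest 0 k w + omega))%:E +
    \sum_(j < n.+1 | j != k) (F j w)%:E))).
  apply: ge0_le_integral => //.
  - move=> w _; rewrite lee_fin mulr_ge0//; first exact: h0.
    by rewrite mulr_ge0 ?addr_ge0 ?rest_ge0.
  - by mfun.
  - by apply: emeasurable_funD; mfun.
  move=> w _; rewrite sumEFin -EFinD lee_fin.
  apply: le_trans (ler_wpM2l (h0 w) (denominator_le k w)) _.
  rewrite mulrDr mulr_sumr le_eqVlt; apply/orP; left; apply/eqP; congr (_ + _)%R.
  by apply: eq_bigr => j _; rewrite /F /rho; ring.
have I1 : \int[P]_w (h w * (rest 0 k w + omega))%:E <=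
    (n.+1%:R * (1 + eps))%:E * \int[P]_w (h w)%:E.
  rewrite integral_rest//.
    rewrite lee_wpmul2r ?lee_fin ?batch_size_le//.
    by apply: integral_ge0 => w _; rewrite lee_fin.
  by move=> j jk; apply: mhc => // -[e]; rewrite e eqxx in jk.
(* The hash of [j] goes first and leaves [V^-1]. Then [Y 0 j] is integrated out of the term without
   [tot], and the term with [tot] is left to [Ikappa]. This is possible because [h] and [rho]
   involve X, X' and [Y 0 k] only. *)
have I2 j : j != k -> \int[P]_w (F j w)%:E <=
    (V%:R^-1 * (1 + omega * kappa))%:E * \int[P]_w (h w * rho w)%:E.
  move=> jk; have kj : k != j by rewrite eq_sym.
  have mt c : Source <> c -> (forall l, Proposal 0 l <> c) ->
      measurable_fun setT (tot 0 : Others c -> R).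
    by move=> cX cY; have ml l := measurable_lam cX (cY l); rewrite /tot; mfun.
  have mtj : measurable_fun setT (tot 0 : Others (Hash 0 j) -> R) by exact: mt.
  have mdj : measurable_fun setT (dlam j : Others (Hash 0 j) -> R).
    by apply: measurable_dlam.
  have mhj : measurable_fun setT (h : Others (Hash 0 j) -> R) by exact: mhc.
  have mrj : measurable_fun setT (rho : Others (Hash 0 j) -> R) by exact: mrhoc.
  apply: (le_trans (integral_hash_le V_gt0 model (i := 0%N) (j := j) (h := H 0 k)
    (g := fun w => (h w * rho w * dlam j w * (1 + omega / tot 0 w))%R) _ _ (hrt0 j))).
  - by mfun.
  - by apply: measurable_Others_H => -[e]; rewrite e eqxx in kj.
  rewrite (_ : \int[P]_w _ = V%:R^-1%:E * (\int[P]_w (h w * rho w * dlam j w)%:E +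
      omega%:E * \int[P]_w (h w * rho w * dlam j w / tot 0 w)%:E)); last first.
    have hrdt0 w : (0 <= h w * rho w * dlam j w / tot 0 w)%R by rewrite divr_ge0.
    have m1 : measurable_fun setT (fun w => (h w * rho w * dlam j w)%:E) by mfun.
    have m2 : measurable_fun setT (fun w => (h w * rho w * dlam j w / tot 0 w)%:E) by mfun.
    rewrite -ge0_integralZl_EFin//; last by move=> w _; rewrite lee_fin.
    rewrite -ge0_integralD//; last 3 first.
    - by move=> w _; rewrite lee_fin.
    - by move=> w _; rewrite mule_ge0// lee_fin.
    - by apply: emeasurable_funM.
    rewrite -ge0_integralZl_EFin//; last 2 first.
    - by move=> w _; rewrite adde_ge0 ?mule_ge0 ?lee_fin.
    - by apply: emeasurable_funD => //; exact: emeasurable_funM.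
    by apply: eq_integral => w _; rewrite -[omega%:E * _]EFinM -EFinD -EFinM; congr (_%:E); ring.
  rewrite EFinM -muleA lee_wpmul2l ?lee_fin ?invr_ge0//.
  rewrite EFinD ge0_muleDl// ?lee_fin ?mulr_ge0// mul1e; apply: leeD.
    by apply: integral_dlam => //; apply: measurable_funM;
      [apply: mhc|apply: mrhoc] => // -[e]; rewrite e eqxx in kj.
  rewrite EFinM -muleA lee_wpmul2l ?lee_fin//.
  apply: (Ikappa _ k) => //; first by mfun.
  move=> l lk; apply: measurable_funM; [apply: mhc|apply: mrhoc] => // -[e];
    by rewrite e eqxx in lk.
have hE w : (h w * bound k w = hit k w / bound k w)%R.
  by rewrite /h; field; rewrite gt_eqF.
rewrite ge0_integralD//; last 4 first.
- by move=> w _; rewrite lee_fin mulr_ge0// addr_ge0 ?rest_ge0.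
- by mfun.
- by move=> w _; apply: sume_ge0 => j _; rewrite lee_fin.
- by mfun.
(* These are the two coefficients of [bound], as a polynomial in [rho]: the right-hand side is the
   integral of [h * bound]. *)
apply: (@le_trans _ _ ((n.+1%:R * (1 + eps))%:E * \int[P]_w (h w)%:E +
    (n.+1%:R * (1 + eps) / V%:R)%:E * \int[P]_w (h w * rho w)%:E)).
  apply: leeD => //.
  under eq_integral do rewrite -big_filter.
  rewrite ge0_integral_sum//; last 2 first.
  - by move=> j; mfun.
  - by move=> j w _; rewrite lee_fin.
  rewrite big_filter; apply: (le_trans (lee_sum _ I2)).
  rewrite (_ : \sum_(j < n.+1 | j != k) _ = n%:R%:E *
      ((V%:R^-1 * (1 + omega * kappa))%:E * \int[P]_w (h w * rho w)%:E)); last first.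
    by rewrite sumr_const (cardC1 k) card_ord mule_natl.
  rewrite muleA -EFinM lee_wpmul2r ?lee_fin//.
    by apply: integral_ge0 => w _; rewrite lee_fin.
  by rewrite mulrCA mulrC ler_wpM2r ?invr_ge0.
have hE' w : (hit k w / bound k w)%:E = (n.+1%:R * (1 + eps))%:E * (h w)%:E +
    (n.+1%:R * (1 + eps) / V%:R)%:E * (h w * rho w)%:E.
  by rewrite -hE -!EFinM -EFinD; congr (_%:E); rewrite /bound -/(rho w); ring.
have c0 : (0 <= n.+1%:R * (1 + eps))%R by rewrite mulr_ge0 ?addr_ge0// ltW.
under [leRHS]eq_integral do rewrite hE'.
rewrite ge0_integralD//; last 4 first.
- by move=> w _; rewrite mule_ge0 ?lee_fin.
- by mfun.
- by move=> w _; rewrite mule_ge0 ?lee_fin// divr_ge0.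
- by mfun.
have c1 : (0 <= n.+1%:R * (1 + eps) / V%:R)%R by rewrite divr_ge0.
by rewrite !ge0_integralZl_EFin//; do ?[by move=> w _; rewrite lee_fin]; mfun.
Qed.

(** * From good indices to the mismatch event *)

Lemma measurable_good k : measurable_fun setT (good k).
Proof.
have mH j : measurable_fun setT (H 0 j) by [].
apply: measurable_and; first by mfun.
apply: measurable_win => j; rewrite /slow; apply: measurable_funM; last by mfun.
by apply: measurable_fun_natr_bool; exact: measurable_fun_eq_nat.
Qed.

Lemma measurable_mismatch : measurable [set z : TY * TY | z.1 = z.2] ->
  measurable (mismatch muX muY pX pX'X q X X' U Y H S pYX).
Proof.
move=> diagY.
have mset (f : Omega -> bool) : measurable_fun setT f -> measurable [set w | f w].
  by move=> mf; have := mf measurableT [set true] I; rewrite setTI.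
have mneq i k k' : measurable [set w | Y i k w <> Y i k' w].
  have mYY : measurable_fun setT (fun w => (Y i k w, Y i k' w)).
    by apply: measurable_fun_pair.
  have := mYY measurableT _ (measurableC diagY); rewrite setTI.
  by rewrite (_ : _ @^-1` _ = [set w | Y i k w <> Y i k' w]).
pose dec i (k : 'I_n.+1) w : 'I_n.+1 := [arg min_(j < ord0 | H i j w == H i k w)
  race (p' (X' w)) q (shared w i) j]%O.
(* Once the batch, the candidate and the decoder's choice are fixed, the mismatch compares two fixed
   random variables; there are countably many such cases. *)
rewrite (_ : mismatch _ _ _ _ _ _ _ _ _ _ _ _ = \bigcup_i \bigcup_(k : 'I_n.+1)
    \bigcup_(k' : 'I_n.+1) (((first @^-1` [set i] `&`
    [set w | candidate (pYX (X w)) q (shared w i) == k]) `&` [set w | dec i k w == k'])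
    `&` [set w | Y i k w <> Y i k' w])).
  apply: bigcup_measurable => i _.
  apply: fin_bigcup_measurable => // k _; apply: fin_bigcup_measurable => // k' _.
  apply: measurableI => //; apply: measurableI.
    apply: measurableI; first by rewrite -[X in measurable X]setTI; exact: measurable_first.
    by apply: mset; exact: (measurable_candidate (bat := fun w => shared w i) mpYX mq).
  apply: mset; apply: (measurable_decoder (bat := fun w => shared w i) _ mq) => //.
  exact: (measurable_cond_YX' densX densX'X densYX).
apply/seteqP; split => w.
  move=> W; exists (first w) => //; exists (candidate (pYX (X w)) q (shared w (first w))) => //.
  exists (dec (first w) (candidate (pYX (X w)) q (shared w (first w))) w) => //.
  by do ![split => //=].
by move=> [i _ [k _ [k' _ [[[<- /eqP <-] /eqP <-]]]]].
Qed.

(** A pointwise bound: on the mismatch event no index is good, and off it at most one is. *)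
Lemma mismatch_good_le1 : measurable [set z : TY * TY | z.1 = z.2] ->
  P (mismatch muX muY pX pX'X q X X' U Y H S pYX) +
  \sum_(k < n.+1) \int[P]_w (good k w)%:R%:E <= 1.
Proof.
move=> /measurable_mismatch mmis; set M := mismatch _ _ _ _ _ _ _ _ _ _ _ _ in mmis *.
have mgood k : measurable_fun setT (fun w => (good k w)%:R%:E : \bar R).
  by apply: measurable_EFin; apply: measurable_fun_natr_bool; exact: measurable_good.
have mM : measurable_fun setT (fun w => (\1_M w)%:E : \bar R).
  by apply: measurable_EFin; exact: measurable_indic.
rewrite -[M]setIT -integral_indic//.
rewrite -ge0_integral_sum//.
rewrite -ge0_integralD//; last 2 first.
- by move=> w _; apply: sume_ge0 => k _; rewrite lee_fin.
- by apply: measurable_fun_sume => k _.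
apply: (@le_trans _ _ (\int[P]_w (cst 1 w))); last first.
  by rewrite integral_cst// mul1e; exact: (probability_le1 P measurableT).
apply: ge0_le_integral => //.
- by move=> w _; rewrite adde_ge0 ?lee_fin// sume_ge0// => k _; rewrite lee_fin.
- by apply: emeasurable_funD => //; apply: measurable_fun_sume => k _.
move=> w _; rewrite sumEFin -EFinD lee_fin.
have [Mw|Mw] := pselect (M w).
  rewrite big1 ?addr0 ?indicE; first by rewrite lern1 leq_b1.
  by move=> k _; have [/good_match|] := boolP (good k w).
rewrite indicE (memNset Mw) add0r.
apply: (@le_trans _ _ (\sum_(k < n.+1) (win 0 k (slow k) w)%:R)%R).
  by apply: ler_sum => k _; rewrite /good; case: (0 < _)%R => //=; rewrite ?ler0n.
by rewrite sum_win ?lern1 ?leq_b1// => k j; exact: slow_ge0.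
Qed.

(** * The expectation under the joint law *)

Definition success x x' y : R := (1 + eps + (1 + eps) * V%:R^-1
  * 2 `^ (info_YX muX muX' pX pX'X pYX y x - info_YX' muX muX' muY pX pX'X pYX y x'))^-1%R.

(** The marginal of Y' cancels in the difference of the information densities. The logarithms are
    kept because [ln] has a default value at 0: the exponential is the ratio of the densities only
    where both are positive. *)
Lemma successE x x' y : success x x' y =
  ((1 + eps) * (1 + V%:R^-1 * expR (ln (pYX x y) - ln (p' x' y))))^-1%R.
Proof.
rewrite /success /info_YX /info_YX' /log2.
have ln2 : (0 < ln (2 : R))%R by rewrite ln_gt0// ltr1n.
rewrite /powR pnatr_eq0/= (_ : _ * ln 2 = ln (pYX x y) - ln (p' x' y))%R.
  by congr (_^-1)%R; ring.
by field; rewrite gt_eqF.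
Qed.

Let success_den_ge1 x x' y :
  (1 <= (1 + eps) * (1 + V%:R^-1 * expR (ln (pYX x y) - ln (p' x' y))))%R.
Proof.
have e0 : (0 <= V%:R^-1 * expR (ln (pYX x y) - ln (p' x' y)))%R.
  by rewrite mulr_ge0// expR_ge0.
by apply: mulr_ege1; rewrite lerDl// ltW.
Qed.

Lemma success_ge0 x x' y : (0 <= success x x' y)%R.
Proof. by rewrite successE invr_ge0 (le_trans ler01). Qed.

Lemma success_le1 x x' y : (success x x' y <= 1)%R.
Proof. by rewrite successE invf_le1 ?success_den_ge1// (lt_le_trans ltr01). Qed.

Lemma measurable_success :
  measurable_fun setT (fun z : TX * TX' * TY => success z.1.1 z.1.2 z.2).
Proof.
have mp' : measurable_fun setT (fun z : TX * TX' * TY => p' z.1.2 z.2).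
  have m23 : measurable_fun setT (fun z : TX * TX' * TY => (z.1.2, z.2)).
    apply: measurable_fun_pair => //.
    exact: (measurableT_comp measurable_snd measurable_fst).
  exact: (measurableT_comp (measurable_cond_YX' densX densX'X densYX) m23).
have mp : measurable_fun setT (fun z : TX * TX' * TY => pYX z.1.1 z.2).
  by apply: measurable_pYX => //; apply: measurableT_comp measurable_fst.
have ml : measurable_fun setT (fun z : TX * TX' * TY => ln (pYX z.1.1 z.2)).
  exact: (measurableT_comp (@measurable_ln R) mp).
have ml' : measurable_fun setT (fun z : TX * TX' * TY => ln (p' z.1.2 z.2)).
  exact: (measurableT_comp (@measurable_ln R) mp').
rewrite (_ : (fun _ => _) = fun z : TX * TX' * TY => ((1 + eps) *
    (1 + V%:R^-1 * expR (ln (pYX z.1.1 z.2) - ln (p' z.1.2 z.2))))^-1%R).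
  by mfun.
by apply/funext => z; exact: successE.
Qed.

(** The proposal density cancels in [lam' / mu']. In each degenerate case, with [q], the decoder's
    density or the encoder's density equal to 0, both sides vanish. *)
Lemma hit_bound_density x x' y (lam' := weight (pYX x) q y) (mu' := weight (p' x') q y) :
  (q y * ((0 < mu')%R%:R * lam' / (n.+1%:R * (1 + eps) * (1 + V%:R^-1 * (lam' / mu')))) =
   n.+1%:R^-1 * (pYX x y * (success x x' y * (0 < p' x' y)%R%:R)))%R.
Proof.
have py0 : (0 <= pYX x y)%R by have [_ + _] := densYX' x.
have N0' : (n.+1%:R != 0 :> R)%R by rewrite pnatr_eq0.
have V0 : (0 < V%:R :> R)%R by rewrite ltr0n.
have e1 : (0 < 1 + eps)%R by rewrite addr_gt0.
rewrite /lam' /mu' /weight.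
have [qy|qy] := eqVneq (q y) 0%R.
  have : (pYX x y <= omega * q y)%R by exact: (density_le densYX' densQ).
  by rewrite qy mulr0 mul0r => p_le; rewrite (@le_anti _ _ (pYX x y) 0%R) ?p_le// mul0r mulr0.
have q1 : (0 < q y)%R by rewrite lt_neqAle eq_sym qy q0.
rewrite (pmulr_lgt0 _ (_ : 0 < (q y)^-1)%R) ?invr_gt0//.
have [p'y|p'y] := ltP 0%R (p' x' y); last by rewrite !mul0r !mulr0.
have [->|pn] := eqVneq (pYX x y) 0%R; first by rewrite !mul0r !mulr0 !mul0r !mulr0.
have py : (0 < pYX x y)%R by rewrite lt_neqAle eq_sym pn.
rewrite successE expRB !lnK ?posrE//; field.
have s1 : (0 < V%:R * p' x' y + pYX x y)%R by rewrite addr_gt0// mulr_gt0.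
have n1 : (0 < 1 + n%:R :> R)%R by rewrite ltr_pwDl.
by rewrite qy (gt_eqF p'y) (gt_eqF V0) (gt_eqF s1) (gt_eqF e1) (gt_eqF n1).
Qed.

(** A change of measure: weighting by [lam 0 k] turns the proposal law into [pYX] given X, so X, X'
    and [Y 0 k] acquire the joint law. The value is the same for every [k], and the N terms cancel
    the factor 1 / N. *)
Lemma integral_hit k : \int[P]_w (hit k w / bound k w)%:E =
  n.+1%:R^-1%:E * \int[muX]_x \int[muX']_x' \int[muY]_y
    (joint pX pX'X pYX x x' y * (success x x' y * (0 < p' x' y)%R%:R))%:E.
Proof.
have mp' := measurable_cond_YX' densX densX'X densYX.
have mX : measurable_fun setT (X : Others (Proposal 0 k) -> TX).
  exact: measurable_Others_X.
have mX' : measurable_fun setT (X' : Others (Proposal 0 k) -> TX').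
  exact: measurable_Others_X'.
have mX1 := measurableT_comp mX (@measurable_fst _ _ (Others (Proposal 0 k)) TY).
have mX'1 := measurableT_comp mX' (@measurable_fst _ _ (Others (Proposal 0 k)) TY).
have mw : measurable_fun setT (fun z : Others (Proposal 0 k) * TY =>
    weight (pYX (X z.1)) q z.2).
  by apply: (measurable_weight mpYX mq mX1); exact: measurable_snd.
have mw' : measurable_fun setT (fun z : Others (Proposal 0 k) * TY =>
    weight (p' (X' z.1)) q z.2).
  by apply: (measurable_weight mp' mq mX'1); exact: measurable_snd.
pose F (l m : R) := ((0 < m)%R%:R * l / (n.+1%:R * (1 + eps) * (1 + V%:R^-1 * (l / m))))%R.
pose f (z : Others (Proposal 0 k) * TY) :=
  (F (weight (pYX (X z.1)) q z.2) (weight (p' (X' z.1)) q z.2))%:E.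
have F0 x x' y : (0 <= F (weight (pYX x) q y) (weight (p' x') q y))%R.
  have l0 : (0 <= weight (pYX x) q y)%R by exact: (weight_ge0 densYX' densQ).
  have m0 : (0 <= weight (p' x') q y)%R by rewrite /weight divr_ge0.
  rewrite /F; apply: divr_ge0; first by rewrite mulr_ge0.
  apply: mulr_ge0; first by rewrite mulr_ge0// addr_ge0// ltW.
  by rewrite addr_ge0// mulr_ge0// divr_ge0.
have mf : measurable_fun setT f by rewrite /f /F; mfun.
have f0 z : 0 <= f z by rewrite lee_fin.
apply: (etrans (integral_proposal densQ model mf f0)).
have mS := measurable_success.
have mp'1 : measurable_fun setT (fun z : TX * TX' * TY => p' z.1.2 z.2).
  have m23 : measurable_fun setT (fun z : TX * TX' * TY => (z.1.2, z.2)).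
    apply: measurable_fun_pair => //.
    exact: (measurableT_comp measurable_snd measurable_fst).
  exact: (measurableT_comp mp' m23).
have mp1 : measurable_fun setT (fun z : TX * TX' * TY => pYX z.1.1 z.2).
  by apply: measurable_pYX => //; apply: measurableT_comp measurable_fst.
pose G (z : TX * TX' * TY) := (pYX z.1.1 z.2 *
  (success z.1.1 z.1.2 z.2 * (0 < p' z.1.2 z.2)%R%:R))%:E.
have mG : measurable_fun setT G by rewrite /G; mfun.
have G0 z : 0 <= G z.
  rewrite lee_fin; have [_ py0 _] := densYX' z.1.1.
  by rewrite mulr_ge0// mulr_ge0// success_ge0.
pose h (z : TX * TX') := \int[muY]_y G (z, y).
have mh : measurable_fun setT h by exact: measurable_fun_fubini_tonelli_F.
have h0 z : 0 <= h z by apply: integral_ge0.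
transitivity (\int[P]_w (n.+1%:R^-1%:E * h (X w, X' w))).
  apply: eq_integral => w _.
  rewrite /h -ge0_integralZl_EFin//; last exact: (measurable_fun_pair2 (X w, X' w) mG).
  by apply: eq_integral => y _; rewrite /f /F /G/= -EFinM hit_bound_density.
have mhX : measurable_fun setT (fun w => h (X w, X' w)).
  by apply: (measurableT_comp mh); exact: measurable_fun_pair.
have hX0 w : setT w -> 0 <= h (X w, X' w) by [].
have Ni0 : (0 <= n.+1%:R^-1 :> R)%R by [].
apply: (etrans (ge0_integralZl_EFin P measurableT hX0 mhX Ni0)).
congr (_ * _); apply: (etrans (integral_source densX densX'X model mh h0)).
apply: eq_integral => x _; apply: eq_integral => x' _.
have [_ pX0 _] := densX; have [_ /(_ x) [_ pX'X0 _]] := densX'X.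
rewrite /h -ge0_integralZl_EFin//; last 2 first.
- exact: (measurable_fun_pair2 (x, x') mG).
- by rewrite mulr_ge0.
by apply: eq_integral => y _; rewrite /G/= -EFinM /joint; congr (_%:E); ring.
Qed.

Lemma mismatch_bound : measurable [set z : TY * TY | z.1 = z.2] ->
  P (mismatch muX muY pX pX'X q X X' U Y H S pYX) <=
  joint_expectation muX muX' muY pX pX'X pYX (fun x x' y => (1 - success x x' y)%R).
Proof.
move=> diagY; rewrite /joint_expectation; set L := P _.
pose J (z : TX * TX' * TY) := joint pX pX'X pYX z.1.1 z.1.2 z.2.
pose s (z : TX * TX' * TY) := success z.1.1 z.1.2 z.2.
have mS : measurable_fun setT s := measurable_success.
have m11 : measurable_fun setT (fun z : TX * TX' * TY => z.1.1).
  exact: (measurableT_comp measurable_fst measurable_fst).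
have m12 : measurable_fun setT (fun z : TX * TX' * TY => z.1.2).
  exact: (measurableT_comp measurable_snd measurable_fst).
have mJ : measurable_fun setT J.
  exact: (measurable_joint densX densX'X densYX m11 m12 measurable_snd).
have J0 z : (0 <= J z)%R by exact: (joint_ge0 densX densX'X densYX).
pose g1 z := (J z * (1 - s z))%:E; pose g2 z := (J z)%:E * (s z)%:E.
have mg1 : measurable_fun setT g1 by rewrite /g1; mfun.
have mg2 : measurable_fun setT g2 by rewrite /g2; mfun.
have g10 z : 0 <= g1 z by rewrite lee_fin mulr_ge0// subr_ge0 success_le1.
have g20 z : 0 <= g2 z by rewrite mule_ge0// lee_fin// success_ge0.
have s01 z : 0 <= (s z)%:E <= 1 by rewrite !lee_fin success_ge0 success_le1.
(* The indicator [0 < p'] left by [hit] costs nothing, as it is 1 almost surely under the joint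
   law. *)
have h2E : \int[muX]_x \int[muX']_x' \int[muY]_y g2 (x, x', y) =
    \int[muX]_x \int[muX']_x' \int[muY]_y
    (joint pX pX'X pYX x x' y * (success x x' y * (0 < p' x' y)%R%:R))%:E.
  apply: (etrans (joint_cond_YX'_gt0 densX densX'X densYX densQ omega_ge0 bounding
    (measurable_EFin mS) s01)).
  apply: eq_integral => x _; apply: eq_integral => x' _.
  by apply: eq_integral => y _; rewrite !EFinM.
set I2 := (X in _ = X) in h2E.
set I1 := \int[muX]_x _.
have I12 : I1 + I2 = 1.
  rewrite -h2E -(ge0_integral3D muX muX' muY mg1 g10 mg2 g20).
  rewrite -(integral_joint densX densX'X densYX).
  apply: eq_integral => x _; apply: eq_integral => x' _; apply: eq_integral => y _.
  by rewrite /g1 /g2 -EFinM -EFinD /J /s/=; congr (_%:E); ring.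
have I20 : 0 <= I2.
  rewrite -h2E; apply: integral_ge0 => x _; apply: integral_ge0 => x' _.
  by apply: integral_ge0 => y _.
have I10 : 0 <= I1.
  by apply: integral_ge0 => x _; apply: integral_ge0 => x' _; apply: integral_ge0 => y _;
    exact: g10 (x, x', y).
have hitE k : \int[P]_w (hit k w / bound k w)%:E = n.+1%:R^-1%:E * I2.
  exact: integral_hit.
have goodL : L + \sum_(k < n.+1) \int[P]_w (good k w)%:R%:E <= 1.
  exact: mismatch_good_le1.
clearbody L I2 I1.
have LI2 : L + I2 <= 1.
  apply: le_trans goodL; apply: leeD2l.
  rewrite (_ : I2 = \sum_(k < n.+1) (n.+1%:R^-1%:E * I2)).
    by apply: lee_sum => k _; rewrite -(hitE k); exact: good_ge.
  transitivity (n.+1%:R%:E * (n.+1%:R^-1%:E * I2)).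
    by rewrite muleA -EFinM divff ?mul1e// pnatr_eq0.
  by rewrite sumr_const card_ord mule_natl.
(* Finiteness permits passing from [L + I2 <= I1 + I2] to [L <= I1]. *)
have I2f : I2 \is a fin_num.
  rewrite ge0_fin_numE// (le_lt_trans _ (ltry (1%R : R)))// -I12.
  by rewrite leeDr.
by rewrite -(leeD2rE _ _ I2f) I12.
Qed.

End estimates.

(* The batch size N of the protocol is n.+1.  [diagY] and [meas_omega] are what
   makes the mismatch event and the encoder measurable. *)
Theorem proposition5p6 (R : realType) (d dX dX' dY : measure_display)
    (Omega : measurableType d) (P : probability Omega R)
    (TX : measurableType dX) (TX' : measurableType dX') (TY : measurableType dY)
    (muX : {sigma_finite_measure set TX -> \bar R})
    (muX' : {sigma_finite_measure set TX' -> \bar R})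
    (muY : {sigma_finite_measure set TY -> \bar R})
    (pX : TX -> R) (pX'X : TX -> TX' -> R) (pYX : TX -> TY -> R) (q : TY -> R)
    (V N0 n : nat) (eps omega : R)
    (X : {RV P >-> TX}) (X' : {RV P >-> TX'})
    (U : nat -> {RV P >-> R}) (Y : nat -> 'I_n.+1 -> {RV P >-> TY})
    (H : nat -> 'I_n.+1 -> {RV P >-> nat}) (S : nat -> 'I_n.+1 -> {RV P >-> R})
    (densX : is_density muX pX)
    (densX'X : is_cond_density muX' pX'X)
    (densYX : is_cond_density muY pYX)
    (densQ : is_density muY q)
    (diagY : measurable [set z : TY * TY | z.1 = z.2])
    (meas_omega : measurable_fun setT (fun x => sup_weight (pYX x) q))
    (V_gt0 : (0 < V)%N) (eps_gt0 : 0 < eps) (omega_ge1 : 1 <= omega)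
    (bounding : extended_bounding pYX q omega)
    (threshold : is_threshold muY pYX q omega eps N0)
    (N_ge : Num.max N0%:R omega <= n.+1%:R)
    (model : wz_model muX muX' muY pX pX'X q V X X' U Y H S) :
  (P (mismatch muX muY pX pX'X q X X' U Y H S pYX)
     <= joint_expectation muX muX' muY pX pX'X pYX (fun x x' y =>
          (1 - (1 + eps + (1 + eps) * V%:R^-1
                 * 2 `^ (info_YX muX muX' pX pX'X pYX y x
                         - info_YX' muX muX' muY pX pX'X pYX y x'))^-1)%R))%E
  /\ exists (s : R) (c : nat -> seq bool),
       [/\ zipf_code s c,
           coding_cost q V X U Y H S pYX c
             = ((log2 V%:R)%:E + index_cost q X U Y H S pYX c)%E
         & (index_cost q X U Y H S pYX c <= 4%:E)%E].
Proof.
have [N0_le omega_le] : (N0 <= n.+1)%N /\ omega <= n.+1%:R.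
  by move: N_ge; rewrite ge_max ler_nat => /andP[].
split.
  exact: (mismatch_bound densX densX'X densYX densQ meas_omega V_gt0 omega_ge1 bounding
    model eps_gt0 threshold N0_le diagY).
have [c [zc cl]] := @zipf2_code_exists R.
exists 2, c.
pose len w : R := (size (c (message q X U Y H S pYX w).1))%:R.
have mlen : measurable_fun setT len.
  have mh : measurable_fun [set: nat] (fun k => (size (c k))%:R : R) by [].
  have mf : measurable_fun setT
      (fun w => first_accepted (pYX (X w)) q (shared U Y H S w)).
    exact: (measurable_first _ _ _ _ _ densYX densQ meas_omega).
  exact: (measurableT_comp mh mf).
have len0 w : 0 <= len w by [].
have costE : index_cost q X U Y H S pYX c = (\int[P]_w (len w)%:E)%E.
  by rewrite /index_cost unlock.
have log0 : 0 <= log2 (V%:R : R).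
  by rewrite /log2 divr_ge0// ln_ge0 ?ler1n.
split => //.
  rewrite costE /coding_cost unlock.
  transitivity (\int[P]_w (cst (log2 V%:R)%:E w + (len w)%:E))%E.
    by apply: eq_integral => w _; rewrite -EFinD.
  rewrite ge0_integralD//.
  - congr (_ + _)%E; apply: (etrans (integral_cst _ measurableT _)).
    by rewrite [X in (_ * X)%E](_ : _ = 1%E) ?mule1//; exact: probability_setT.
  - by move=> w _; rewrite lee_fin.
  - exact: measurable_EFin.
(* A length of at most 2 k + 1 and an index of mean at most 1 give 3 bits, which is within the 4
   bits claimed. *)
rewrite costE; apply: (@le_trans _ _ 3%:E%E); last by rewrite lee_fin ler_nat.
exact: (expected_length densYX densQ meas_omega omega_ge1 bounding omega_le model cl).
Qed.
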